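(* Consider the largest-class weighted MaxWeight policy (defined in the context) for a multiclass switched network. If $\boldsymbol\rho\in\mathcal C$, where $\mathcal C$ is the interior of the convex hull of the set $\mathcal S$ of feasible schedules, then the associated queueing network process is positive recurrent.
   Context: **Multiclass switched network.** $\mathcal J$ is a finite set of queues and $\mathcal K$ a finite set of job classes. Each class belongs to exactly one queue, and $\mathcal{C}l(j)\subset\mathcal K$ is the set of classes belonging to queue $j$. Time is discrete. *External arrivals.* The numbers of external class $k$ arrivals per time unit are $\mathbb Z_+$-valued, i.i.d. over time, independent across classes, with mean $a_k\in\mathbb R_+$. *Job sizes and routing.* Class $k$ job sizes are geometric with parameter $p_k\in(0,1]$: each unit of service devoted to class $k$ completes the job being served with probability $p_k$, independently. A served class $k$ job becomes a class $k'$ job with probability $P_{kk'}$ and otherwise leaves the network, independently of everything else. The network is open: $I-P$ is invertible. *Traffic intensity.* Total arrival rates $\lambda_k$ solve $\lambda_k=a_k+\sum_{k'\in\mathcal K}\lambda_{k'}P_{k'k}$. Put $\tilde\rho_k=\lambda_k/p_k$ (assumed positive), $\rho_j=\sum_{k\in\mathcal{C}l(j)}\tilde\rho_k$ and $\boldsymbol\rho=(\rho_j)_{j\in\mathcal J}$. *Schedules.* $\mathcal S\subset\mathbb Z_+^{|\mathcal J|}$ is a finite set such that $\boldsymbol\sigma\in\mathcal S$, $\boldsymbol\sigma'\in\mathbb Z_+^{|\mathcal J|}$ and $\boldsymbol\sigma'\le\boldsymbol\sigma$ coordinatewise imply $\boldsymbol\sigma'\in\mathcal S$. $\sigma_j$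 is the amount of work devoted to queue $j$ in one time unit. *State.* The queueing network process records the number $\tilde Q_k(t)$ of class $k$ jobs at time $t\in\mathbb Z_+$, for each $k\in\mathcal K$. It is a discrete time countable state space Markov chain. In each time step the schedule is determined by the state at the end of the previous step. Jobs initially present are served first (if $s$ units of work are assigned to class $k$, then $s\wedge\tilde Q_k$ units are used), and then routed jobs and external arrivals join their classes. **Largest-class weighted MaxWeight policy.** With $Q_j^*:=\max_{k\in\mathcal{C}l(j)}\tilde Q_k/\tilde\rho_k$, choose a schedule $\boldsymbol\sigma$ maximizing $\sum_{j\in\mathcal J}Q_j^*\sigma_j$ over $\boldsymbol\sigma\in\mathcal S$. The entire work $\sigma_j$ at queue $j$ is then devoted to jobs of the class $k\in\mathcal{C}l(j)$ at which $\tilde Q_k/\tilde\rho_k$ is maximized. Ties are broken arbitrarily or randomly, depending only on the current state. *)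

(* Defs.v *)
From mathcomp Require Import all_boot all_order all_algebra finmap.
From mathcomp Require Import all_classical all_reals all_analysis.

Set Implicit Arguments.
Unset Strict Implicit.
Unset Printing Implicit Defensive.
Import Order.TTheory GRing.Theory Num.Theory.
Import numFieldNormedType.Exports.
Local Open Scope classical_set_scope.
Local Open Scope ring_scope.

Section MarkovChain.
Context {R : realType} {T : choiceType}.
Variable p : T -> T -> \bar R.

(* With tau_F := inf {n >= 1 | X n \in F}, for the chain X with transition
   probabilities p started at x, this is P_x(tau_F = n.+1). *)
Fixpoint first_passage (F : set T) (n : nat) (x : T) : \bar R :=
  match n with
  | 0 => \esum_(y in F) p x y
  | m.+1 => \esum_(y in ~` F) (p x y * first_passage F m y)
  end%E.

(* tau_F is almost surely finite under P_x, and E_x[tau_F] < +oo. *)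
Definition finite_mean_passage (F : set T) (x : T) : Prop :=
  (\sum_(0 <= n <oo) first_passage F n x = 1 /\
   \sum_(0 <= n <oo) n.+1%:R%:E * first_passage F n x < +oo)%E.

Definition positive_recurrent_state (x : T) : Prop :=
  finite_mean_passage [set x] x.

(* The chains considered need not be irreducible (e.g. the empty state is
   transient when arrivals are deterministic and nonzero), and may have several closed
   classes.  A chain is positive recurrent when it reaches, from every initial
   state and in finite mean time, a fixed finite set of positive recurrent
   states; for an irreducible chain this holds if and only if all states are
   positive recurrent. *)
Definition positive_recurrent : Prop :=
  exists F : set T, [/\ finite_set F,
    forall x, F x -> positive_recurrent_state x &
    forall x, finite_mean_passage F x].

End MarkovChain.

Definition convex_hull {R : numDomainType} {E : lmodType R} (A : set E)
  : set E := smallest (@convex_set R E) A.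

Record network (R : realType) (J K : finType) := Network {
  queue_of : K -> J;
  arrival_law : K -> probability nat R;
  arrival_mean : K -> R;
  completion : K -> R;
  routing : K -> K -> R;
  schedules : {fset {ffun J -> nat}};
  arrival_meanE : forall k,
    (\int[arrival_law k]_n (n%:R)%:E = (arrival_mean k)%:E)%E;
  completion_itv : forall k, 0 < completion k <= 1;
  routing_ge0 : forall k k', 0 <= routing k k';
  routing_le1 : forall k, \sum_k' routing k k' <= 1;
  network_open :
    1%:M - \matrix_(i < #|K|, j < #|K|) routing (enum_val i) (enum_val j)
      \in unitmx;
  schedules_monotone : forall s s' : {ffun J -> nat}, s \in schedules ->
    (forall j, s' j <= s j)%N -> s' \in schedules
}.

Section Network.
Context {R : realType} {J K : finType}.
Variable N : network R J K.

Definition traffic_equations (lambda : K -> R) : Prop :=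
  forall k, lambda k =
    arrival_mean N k + \sum_k' lambda k' * routing N k' k.

Definition class_intensity (lambda : K -> R) (k : K) : R :=
  lambda k / completion N k.

Definition queue_intensity (lambda : K -> R) : {ptws J -> R} :=
  fun j => \sum_(k | queue_of N k == j) class_intensity lambda k.

Definition schedule_vector (s : {ffun J -> nat}) : J -> R :=
  fun j => (s j)%:R.

Definition capacity_region : set {ptws J -> R} :=
  interior (convex_hull (schedule_vector @` [set` schedules N])
    : set {ptws J -> R}).

Local Notation state := {ffun K -> nat}.
Local Notation schedule := {ffun J -> nat}.

(* All the work [s j] at queue [j] goes to the class [c j]. *)
Definition assigned_work (s : schedule) (c : {ffun J -> K}) (k : K) : nat :=
  if c (queue_of N k) == k then s (queue_of N k) else 0%N.

Definition used_unit (x : state) (s : schedule) (c : {ffun J -> K}) : finType :=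
  {k : K & 'I_(minn (assigned_work s c k) (x k))}.

(* Result of one unit of service: [None] if the job is not completed,
   [Some None] if it is completed and leaves the network, [Some (Some k')] if
   it is completed and becomes a class [k'] job. *)
Definition unit_probability (k : K) (o : option (option K)) : R :=
  match o with
  | None => 1 - completion N k
  | Some None => completion N k * (1 - \sum_k' routing N k k')
  | Some (Some k') => completion N k * routing N k k'
  end.

(* The subtraction never truncates, as at most [x k] units are used. *)
Definition next_state (x : state) (s : schedule) (c : {ffun J -> K})
    (o : {ffun used_unit x s c -> option (option K)}) (A : {ffun K -> nat})
    : state :=
  [ffun k => x k - #|[pred u | (tag u == k) && (o u != None)]|
             + #|[pred u | o u == Some (Some k)]| + A k]%N.

(* [pol x s c] is the probability that, in state [x], the schedule is [s] and
   each queue [j] serves the class [c j].  The transition probability is that of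
   [next_state o A = y], for the used service units [o] and the arrivals [A]
   mutually independent given [s] and [c]. *)
Definition transition (pol : state -> schedule -> {ffun J -> K} -> R)
    (x y : state) : \bar R :=
  (\sum_(s <- schedules N) \sum_c (pol x s c)%:E *
    \sum_(o : {ffun used_unit x s c -> option (option K)})
      (\prod_u unit_probability (tag u) (o u))%:E *
      \esum_(A in [set A | next_state o A = y])
        \prod_k arrival_law N k [set A k])%E.

Section Policy.
Variable nu : K -> R.

Definition queue_weight (x : state) (j : J) : R :=
  \big[Num.max/0]_(k | queue_of N k == j) ((x k)%:R / nu k).

Definition schedule_weight (x : state) (s : schedule) : R :=
  \sum_j queue_weight x j * (s j)%:R.

Definition maxweight_schedule (x : state) (s : schedule) : Prop :=
  s \in schedules N /\
  forall s', s' \in schedules N -> schedule_weight x s' <= schedule_weight x s.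

Definition largest_class (x : state) (j : J) (k : K) : Prop :=
  queue_of N k = j /\
  forall k', queue_of N k' = j -> (x k')%:R / nu k' <= (x k)%:R / nu k.

Definition largest_class_maxweight
    (pol : state -> schedule -> {ffun J -> K} -> R) : Prop :=
  [/\ forall x s c, 0 <= pol x s c,
      forall x, \sum_(s <- schedules N) \sum_c pol x s c = 1 &
      forall x s c, pol x s c != 0 ->
        maxweight_schedule x s /\ forall j, largest_class x j (c j)].

End Policy.
End Network.

(* Main.v *)
Require Import Defs.
From mathcomp Require Import all_boot all_order all_algebra finmap.
From mathcomp Require Import all_classical all_reals all_analysis.
From mathcomp Require Import ring lra zify.
Import numFieldNormedType.Exports.
Local Open Scope classical_set_scope.
Local Open Scope ring_scope.

Set Implicit Arguments.
Unset Strict Implicit.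
Unset Printing Implicit Defensive.
Import Order.TTheory GRing.Theory Num.Theory.

(* Write [nu] for the class intensities, [D] for the work used in a time step and
   [v = D / nu - 1]. By the traffic equations the mean increment of the state [x]
   pairs with a vector [w] as a bilinear form [b(v, w)], which is negative definite
   because the network is open and [lambda] is subinvariant for the routing. Up to
   a constant, the policy chooses [D] so that [<x, v>] is the maximum [V(x)] over
   all feasible services, and [V] is bounded below by a multiple of the population
   because [rho] is an interior point. By maximality,
     [V(x_t) - V(x_s) <= <x_t - x_s, v_t> = b(v_s + ... + v_(t-1), v_t) + noise].
   As [b] is not symmetric and [v] may oscillate, this is not negative for a single
   step or a single window. It is therefore summed over all windows of length
   [h = g0 B^j] with [1 <= j <= n]. A window cut into [B] blocks whose mean vectors
   of service are close to the mean [w] of the window contributes about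
   [b(w, w) h^2 / 2], which is negative. The deviations of the blocks are square
   summable over the scales, because the variance over the blocks is the difference
   of the energies of [v] averaged at two successive scales, and these telescope;
   so for large [n] the total is negative.
   The noise is negligible for large [g0] by the weak law of large numbers, the
   arrivals being truncated as only their first moment is finite. This gives
   a function satisfying Foster's criterion, hence a finite set hit in finite mean
   time, and a minimal such set consists of positive recurrent states. *)

(** * Negative drift over many scales *)

(** A quadratic function of the state would need second moments of the arrivals; [V] is homogeneous
    of degree one, so first moments suffice, but its drift must then be measured against time and
    every error per time step must be small. Dividing the sum over a window of length [h] by [h ^ 2]
    makes each scale yield the same gain, while the telescoping deviations cost a total independent
    of the number [n] of scales. That [b(w, w)] is bounded away from zero also needs a large initial
    population: every service vector along the path then pairs with the initial state to nearly
    [delta] times its population, so service vectors cannot cancel over a window. The constants must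
    be fixed in this order: [eps] and [B] (a positive gain per scale), [n] (the gain beats the
    telescoped cost), the noise rate [eta] and its additive constant [M], the smallest scale [g0]
    (which absorbs [M]), and last the population threshold. *)

Lemma sum_ord_add (V : nmodType) (F : nat -> V) (m n : nat) :
  \sum_(r < m + n) F r = \sum_(r < m) F r + \sum_(r < n) F (m + r)%N.
Proof. by rewrite big_split_ord. Qed.

Lemma sum_ord_mul (V : nmodType) (F : nat -> V) (B g : nat) :
  \sum_(r < B * g) F r = \sum_(i < B) \sum_(r < g) F (i * g + r)%N.
Proof.
elim: B => [|B IH]; first by rewrite !big_ord0.
by rewrite mulSn addnC (sum_ord_add F) IH big_ord_recr.
Qed.

Section MultiscaleDrift.
Variables (R : archiRealFieldType) (E : lmodType R) (b ip : E -> E -> R) (N : E -> R).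
Variables (Cb Cq c C1 : R).
Hypotheses (bDl : forall u v w, b (u + v) w = b u w + b v w)
  (bDr : forall u v w, b w (u + v) = b w u + b w v)
  (bZl : forall a u w, b (a *: u) w = a * b u w)
  (bZr : forall a u w, b w (a *: u) = a * b w u)
  (b_bound : forall u w, b u w <= Cb * N u * N w)
  (b_neg : forall u, b u u <= - c * N u ^+ 2).
Hypotheses (ipDl : forall u v w, ip (u + v) w = ip u w + ip v w)
  (ipZl : forall a u w, ip (a *: u) w = a * ip u w)
  (ipC : forall u w, ip u w = ip w u)
  (N_ip : forall u, N u ^+ 2 <= Cq * ip u u) (ip_N : forall u, ip u u <= N u ^+ 2)
  (ip_ge0 : forall u, 0 <= ip u u).
Hypotheses (N_ge0 : forall u, 0 <= N u) (N_add : forall u v, N (u + v) <= N u + N v)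
  (N_0 : N 0 = 0).
Hypotheses (Cb_gt0 : 0 < Cb) (Cq_gt0 : 0 < Cq) (c_gt0 : 0 < c) (C1_gt0 : 0 < C1).

Let N_sum (n : nat) (F : nat -> E) : N (\sum_(i < n) F i) <= \sum_(i < n) N (F i).
Proof.
elim: n => [|n IH]; first by rewrite !big_ord0 N_0.
by rewrite !big_ord_recr /=; apply: (le_trans (N_add _ _)); rewrite lerD2r.
Qed.

Let bl_sum (n : nat) (F : nat -> E) w :
  b (\sum_(i < n) F i) w = \sum_(i < n) b (F i) w.
Proof.
elim: n => [|n IH]; first by rewrite !big_ord0 -(scale0r 0) bZl mul0r.
by rewrite !big_ord_recr /= bDl IH.
Qed.

Let br_sum (n : nat) (F : nat -> E) w :
  b w (\sum_(i < n) F i) = \sum_(i < n) b w (F i).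
Proof.
elim: n => [|n IH]; first by rewrite !big_ord0 -(scale0r 0) bZr mul0r.
by rewrite !big_ord_recr /= bDr IH.
Qed.

Let ipl_sum (n : nat) (F : nat -> E) w :
  ip (\sum_(i < n) F i) w = \sum_(i < n) ip (F i) w.
Proof.
elim: n => [|n IH]; first by rewrite !big_ord0 -(scale0r 0) ipZl mul0r.
by rewrite !big_ord_recr /= ipDl IH.
Qed.

(** The variance decomposition; it later turns the deviations of blocks into a difference of
    energies at two scales. *)
Lemma ip_variance (B : nat) (w : nat -> E) : (0 < B)%N ->
  \sum_(i < B) ip (w i - B%:R^-1 *: \sum_(l < B) w l) (w i - B%:R^-1 *: \sum_(l < B) w l)
  = \sum_(i < B) ip (w i) (w i)
    - B%:R^-1 * ip (\sum_(l < B) w l) (\sum_(l < B) w l).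
Proof.
move=> B0; set W := \sum_(l < B) w l; set e := B%:R^-1.
have Be : B%:R * e = 1 :> R by rewrite /e mulfV // pnatr_eq0 -lt0n.
have ipB (u v : E) : ip (u - e *: v) (u - e *: v)
    = ip u u - 2%:R * e * ip u v + e * e * ip v v.
  have ipZN x y : ip (x - e *: v) y = ip x y - e * ip v y.
    by rewrite -scaleNr ipDl ipZl mulNr.
  by rewrite ipZN (ipC u) (ipC v) !ipZN (ipC v u); ring.
transitivity (\sum_(i < B) (ip (w i) (w i) - 2%:R * e * ip (w i) W + e * e * ip W W)).
  by apply: eq_bigr => i _; rewrite ipB.
rewrite !big_split /= sumr_const card_ord sumrN -mulr_sumr -ipl_sum -/W.
by rewrite -[(e * e * _) *+ B]mulr_natl !mulrA Be mul1r; ring.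
Qed.

Section Path.
Variables (v : nat -> E).
Hypothesis v_bound : forall t, N (v t) <= C1.

Definition window (a h : nat) : E := \sum_(r < h) v (a + r)%N.

Lemma window_add a g h : window a (g + h) = window a g + window (a + g) h.
Proof.
rewrite /window (sum_ord_add (fun r => v (a + r)%N)); congr (_ + _).
by apply: eq_bigr => r _; rewrite addnA.
Qed.

Lemma window_mul a B g : window a (B * g) = \sum_(i < B) window (a + i * g) g.
Proof.
rewrite /window (sum_ord_mul (fun r => v (a + r)%N)).
by apply: eq_bigr => i _; apply: eq_bigr => r _; rewrite addnA.
Qed.

Lemma N_window a h : N (window a h) <= h%:R * C1.
Proof.
apply: (le_trans (N_sum _ (fun r => v (a + r)%N))).
apply: (@le_trans _ _ (\sum_(r < h) C1)); first by apply: ler_sum.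
by rewrite sumr_const card_ord mulr_natl.
Qed.

Definition deviation a B g i : E :=
  window (a + i * g) g - B%:R^-1 *: window a (B * g).

Lemma sum_ltn_natr (B : nat) : \sum_(i < B) i%:R = B%:R * (B%:R - 1) / 2%:R :> R.
Proof.
elim: B => [|B IH]; first by rewrite big_ord0 mul0r mul0r.
by rewrite big_ord_recr /= IH -natr1; field.
Qed.

(** Each block is the mean [W / B] plus a deviation. The means contribute [i / B ^ 2 * b W W] for
    block [i], so only the diagonal of [b] occurs in the main term and its asymmetry does no harm.
    The factor 2 in the error covers deviations in either argument. *)
Lemma block_sum_le a B g : (1 < B)%N -> 
  \sum_(i < B) b (window a (i * g)) (window (a + i * g) g)
  <= (B%:R - 1) / (2%:R * B%:R) * b (window a (B * g)) (window a (B * g))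
     + 2%:R * Cb * (B * g)%:R * C1 * \sum_(i < B) N (deviation a B g i).
Proof.
move=> B1; set W := window a (B * g); set D := deviation a B g.
have B0 : (0 < B)%N by apply: ltnW.
have B0' : B%:R != 0 :> R by rewrite pnatr_eq0 -lt0n.
pose e : R := B%:R^-1.
have we i : window (a + i * g) g = e *: W + D i by rewrite /D /deviation addrC subrK.
have Wi i : window a (i * g) = (i%:R * e) *: W + \sum_(l < i) D l.
  rewrite window_mul (eq_bigr (fun l : 'I_i => e *: W + D l)) => [|l _]; last exact: we.
  by rewrite big_split /= sumr_const card_ord -scaler_nat scalerA.
have ND : 0 <= \sum_(i < B) N (D i) by apply: sumr_ge0.
have t1 (i : 'I_B) : b (window a (i * g)) (window (a + i * g) g) <=
    i%:R * e ^+ 2 * b W W + i%:R * e * b W (D i)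
    + Cb * (g%:R * C1) * \sum_(l < B) N (D l).
  rewrite {1}Wi bDl bZl {1}we bDr bZr.
  have -> : i%:R * e * (e * b W W + b W (D i))
    = i%:R * e ^+ 2 * b W W + i%:R * e * b W (D i) by ring.
  rewrite lerD2l.
  rewrite bl_sum; apply: (@le_trans _ _ (\sum_(l < i) Cb * (g%:R * C1) * N (D l))).
    apply: ler_sum => l _; apply: (le_trans (b_bound _ _)).
    rewrite -mulrA -mulrA ler_pM2l // mulrC ler_wpM2r //.
    exact: N_window.
  rewrite -mulr_sumr ler_wpM2l //; first by rewrite !mulr_ge0 ?ler0n // ltW.
  rewrite (big_ord_widen B (fun l => N (D l)) (ltnW (ltn_ord i))) [X in X <= _]big_mkcond /=.
  by apply: ler_sum => l _; case: ifP.
apply: (le_trans (ler_sum _ (fun i _ => t1 i))).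
rewrite !big_split /= sumr_const card_ord -!mulr_suml sum_ltn_natr.
have -> : B%:R * (B%:R - 1) / 2%:R * e ^+ 2 * b W W
   = (B%:R - 1) / (2%:R * B%:R) * b W W by rewrite /e; field.
rewrite -addrA lerD2l.
have t2 (i : 'I_B) : i%:R * e * b W (D i) <= Cb * ((B * g)%:R * C1) * N (D i).
  have := b_bound W (D i); have := b_bound (- W) (D i).
  rewrite -scaleN1r bZl mulN1r => _ H.
  have ie : 0 <= i%:R * e <= 1.
    rewrite mulr_ge0 ?ler0n ?invr_ge0 ?ler0n //= ler_pdivrMr ?ltr0n // mul1r.
    by rewrite ler_nat ltnW.
  have H2 : Cb * N W * N (D i) <= Cb * ((B * g)%:R * C1) * N (D i).
    by rewrite ler_wpM2r // ler_pM2l // N_window.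
  have H3 : 0 <= Cb * N W * N (D i) by rewrite !mulr_ge0 // ltW.
  case/andP: ie => i0 i1; apply: le_trans H2.
  apply: (@le_trans _ _ (i%:R * e * (Cb * N W * N (D i)))); first exact: ler_wpM2l.
  by rewrite -[leRHS]mul1r ler_wpM2r.
apply: (@le_trans _ _ (Cb * ((B * g)%:R * C1) * (\sum_(i < B) N (D i))
   + (Cb * (g%:R * C1) * \sum_(l < B) N (D l)) *+ B)).
  by rewrite lerD2r mulr_sumr; apply: ler_sum => i _; apply: t2.
by rewrite -[(_ * _) *+ B]mulr_natl natrM; rewrite le_eqVlt; apply/orP; left; apply/eqP; ring.
Qed.

(** Inside a block the window issued from [a] is frozen at the start of the block. This changes it
    by at most [g * C1] in norm, whence a last term that is only a fraction [1 / B] of the order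
    [(B * g) ^ 2] of the main one. *)
Lemma window_drift_le a B g : (1 < B)%N -> 
  \sum_(r < B * g) b (window a r) (v (a + r))
  <= 4%:R^-1 * b (window a (B * g)) (window a (B * g))
     + 2%:R * Cb * (B * g)%:R * C1 * \sum_(i < B) N (deviation a B g i)
     + (B * g)%:R * g%:R * Cb * C1 ^+ 2.
Proof.
move=> B1; rewrite (sum_ord_mul (fun r => b (window a r) (v (a + r)%N))).
apply: (@le_trans _ _ (\sum_(i < B) (b (window a (i * g)) (window (a + i * g) g)
   + g%:R * g%:R * Cb * C1 ^+ 2))).
  apply: ler_sum => i _.
  rewrite [window (a + i * g) g]/window (br_sum _ (fun r => v (a + i * g + r)%N)).
  apply: (@le_trans _ _ (\sum_(r < g) (b (window a (i * g)) (v (a + i * g + r)%N)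
     + g%:R * Cb * C1 ^+ 2))); last first.
    by rewrite big_split /= sumr_const card_ord -[(_ * _) *+ g]mulr_natl !mulrA.
  apply: ler_sum => r _; rewrite window_add bDl -addnA lerD2l addnA.
  apply: (le_trans (b_bound _ _)).
  have := N_window (a + i * g) r; have := v_bound (a + i * g + r).
  have rg : r%:R <= g%:R :> R by rewrite ler_nat ltnW.
  move=> H1 H2; rewrite (mulrC g%:R) -!mulrA ler_pM2l // expr2 mulrA.
  by apply: ler_pM => //; apply: (le_trans H2); rewrite ler_wpM2r // ltW.
rewrite big_split /= sumr_const card_ord -[(_ * _) *+ B]mulr_natl.
apply: lerD; last by rewrite natrM; rewrite le_eqVlt; apply/orP; left; apply/eqP; ring.
apply: (le_trans (block_sum_le _ _ B1)); rewrite lerD2r.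
have bW := b_neg (window a (B * g)).
have {bW} bW : b (window a (B * g)) (window a (B * g)) <= 0.
  by apply: (le_trans bW); rewrite mulNr oppr_le0 mulr_ge0 ?exprn_ge0 // ltW.
apply: ler_wnM2r => //.
(* As [b W W] is nonpositive, its coefficient may be lowered to [1 / 4], which is below
   [(B - 1) / (2 * B)] for [B >= 2]. *)
have B2 : 2%:R <= B%:R :> R by rewrite ler_nat.
have Bp : 0 < B%:R :> R by rewrite ltr0n ltnW.
by rewrite ler_pdivlMr ?mulr_gt0 //; lra.
Qed.

Lemma window_energy_le a g : (0 < g)%N ->
  0 <= ip (window a g) (window a g) / g%:R ^+ 2 <= C1 ^+ 2.
Proof.
move=> g0; have gp : 0 < g%:R :> R by rewrite ltr0n.
rewrite divr_ge0 ?exprn_ge0 //= ler_pdivrMr ?exprn_gt0 // -exprMn.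
apply: (le_trans (ip_N _)); rewrite (mulrC C1).
by apply: lerXn2r; rewrite ?nnegrE ?N_window // mulr_ge0 // ltW.
Qed.

(** [f] stands for the Lyapunov function along a path, [d] for the defect in the lower bound on
    windows and [e] for the noise. The horizon is [2 * T] because windows start before [T] and have
    length at most [T]. *)
Variables (f d e : nat -> R) (g0 B n : nat) (kap eps : R).
Hypotheses (g0_gt0 : (0 < g0)%N) (B_gt1 : (1 < B)%N).
Hypotheses (kap_gt0 : 0 < kap) (eps_gt0 : 0 < eps).
Let T := (g0 * B ^ n)%N.
Hypotheses (d_ge0 : forall t, 0 <= d t) (e_ge0 : forall t, 0 <= e t).
Hypothesis f_incr : forall a r, (a + r < 2 * T)%N ->
  f (a + r)%N - f a <= b (window a r) (v (a + r)) + e a + e (a + r)%N.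
Hypothesis window_lower : forall a h, (a + h <= 2 * T)%N ->
  kap * h%:R - \sum_(r < h) d (a + r)%N <= N (window a h).

Let energy g := \sum_(a < T) ip (window a g) (window a g) / g%:R ^+ 2.

Lemma sum_shift (V : zmodType) (F : nat -> V) (m r : nat) :
  \sum_(a < m) F (a + r)%N - \sum_(a < m) F a = \sum_(t < r) (F (m + t)%N - F t).
Proof.
rewrite sumrB; apply/eqP; rewrite subr_eq addrAC eq_sym subr_eq eq_sym.
rewrite -[X in _ == X](addrC (\sum_(a < m) F a)) -(sum_ord_add F) addnC (sum_ord_add F).
by rewrite addrC; apply/eqP; congr (_ + _); apply: eq_bigr => i _; rewrite addnC.
Qed.

Lemma sum_shift_le (F : nat -> R) (h : nat) : (forall t, 0 <= F t) -> (h <= T)%N ->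
  \sum_(a < T) \sum_(r < h) F (a + r)%N <= h%:R * \sum_(t < 2 * T) F t.
Proof.
move=> F0 hT; rewrite exchange_big /= mulr_natl -[h in _ *+ h]card_ord -sumr_const.
apply: ler_sum => r _.
have rT : (T + r <= 2 * T)%N by have := ltn_ord r; lia.
rewrite -(subnKC rT) (sum_ord_add F) addnC (sum_ord_add F).
under eq_bigr do rewrite addnC.
by rewrite -addrA addrCA lerDl addr_ge0 ?sumr_ge0.
Qed.

(** By [ip_variance] the block variance is the mean energy of the blocks minus that of the whole
    window. Block [i] starts at [a + i * g] instead of [a]; this shift alters the sum over [a < T]
    by at most [i * g * C1 ^ 2]. *)
Lemma energy_step g : (0 < g)%N ->
  \sum_(a < T) (B%:R^-1 * \sum_(i < B)
     ip (deviation a B g i) (deviation a B g i) / g%:R ^+ 2)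
  <= energy g - energy (B * g) + (B * g)%:R * C1 ^+ 2.
Proof.
move=> gp; have B0 : (0 < B)%N by apply: ltnW.
have BR : B%:R != 0 :> R by rewrite pnatr_eq0 -lt0n.
have gR : g%:R != 0 :> R by rewrite pnatr_eq0 -lt0n.
pose phi a := ip (window a g) (window a g) / g%:R ^+ 2.
have -> : \sum_(a < T) (B%:R^-1 * \sum_(i < B)
     ip (deviation a B g i) (deviation a B g i) / g%:R ^+ 2) =
   B%:R^-1 * (\sum_(i < B) \sum_(a < T) phi (a + i * g)%N) - energy (B * g).
  rewrite exchange_big /= mulr_sumr /energy -sumrB; apply: eq_bigr => a _.
  rewrite -mulr_suml /deviation window_mul.
  rewrite (ip_variance (fun i => window (a + i * g) g)) // /phi -mulr_suml natrM.
  by field; rewrite BR gR.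
rewrite addrAC lerD2r ler_pdivrMl ?ltr0n // mulrDr.
apply: (@le_trans _ _ (\sum_(i < B) (energy g + (B * g)%:R * C1 ^+ 2))); last first.
  by rewrite sumr_const card_ord -[(_ + _) *+ B]mulr_natl mulrDr.
apply: ler_sum => i _; rewrite -lerBlDl (sum_shift phi).
apply: (@le_trans _ _ (\sum_(t < i * g) C1 ^+ 2)).
  apply: ler_sum => t _.
  have /andP[_ H1] := window_energy_le (T + t) gp.
  have /andP[H2 _] := window_energy_le t gp.
  by rewrite lerBlDr -[leLHS]addr0 lerD.
rewrite sumr_const card_ord -[_ *+ (i * g)]mulr_natl; apply: ler_wpM2r.
  by rewrite exprn_ge0 // ltW.
by rewrite ler_nat leq_mul2r ltnW ?orbT.
Qed.

(** The normalised gain of one window: a quarter of the negative definite term, less the linear part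
    of the deviations and the motion inside the blocks. [slope] is the price of the block
    variance. *)
Let gain : R := c * kap ^+ 2 / 4%:R - Cb * C1 * eps - Cb * C1 ^+ 2 / B%:R.
Let slope : R := Cb * C1 * Cq / eps.

Lemma window_increment_le a g : (0 < g)%N -> (a + B * g <= 2 * T)%N ->
  ((B * g)%:R ^+ 2)^-1 * \sum_(r < B * g) (f (a + r)%N - f a)
  <= - gain
     + slope * (B%:R^-1 * \sum_(i < B)
          ip (deviation a B g i) (deviation a B g i) / g%:R ^+ 2)
     + c * kap / 2%:R * ((B * g)%:R^-1 * \sum_(r < B * g) d (a + r)%N)
     + (B * g)%:R^-1 * e a + ((B * g)%:R ^+ 2)^-1 * \sum_(r < B * g) e (a + r)%N.
Proof.
move=> gp aT; have B0 : (0 < B)%N by apply: ltnW.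
have Bp : 0 < B%:R :> R by rewrite ltr0n.
have gpR : 0 < g%:R :> R by rewrite ltr0n.
set h := (B * g)%N; have hE : h%:R = B%:R * g%:R :> R by rewrite natrM.
have hp : 0 < h%:R :> R by rewrite hE mulr_gt0.
set D := \sum_(r < h) d (a + r)%N; set W := window a h.
have D0 : 0 <= D by apply: sumr_ge0.
have H1 : \sum_(r < h) (f (a + r)%N - f a) <=
    \sum_(r < h) b (window a r) (v (a + r)) + h%:R * e a + \sum_(r < h) e (a + r)%N.
  apply: (@le_trans _ _ (\sum_(r < h) (b (window a r) (v (a + r)%N) + e a + e (a + r)%N))).
    by apply: ler_sum => r _; apply: f_incr; apply: leq_trans aT; rewrite ltn_add2l.
  by rewrite !big_split /= sumr_const card_ord -[(_ *+ h)]mulr_natl.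
have H2 : b W W <= - (c * kap ^+ 2) * h%:R ^+ 2 + 2%:R * c * kap * h%:R * D.
  have := window_lower aT; rewrite -/W -/D => HW.
  apply: (le_trans (b_neg W)).
  (* The tangent to the square at [kap * h] bounds [N W ^ 2] from below whatever the sign of
     [kap * h - D]. *)
  have sq : 0 <= (N W - kap * h%:R) ^+ 2 by apply: sqr_ge0.
  have H : 0 <= c * (N W - kap * h%:R) ^+ 2 by apply: mulr_ge0 => //; apply: ltW.
  have H' : 0 <= 2%:R * c * kap * h%:R * (N W - (kap * h%:R - D)).
    apply: mulr_ge0; last by rewrite subr_ge0.
    by rewrite !mulr_ge0 // ltW.
  lra.
(* Young's inequality with parameter [eps]: the deviations enter linearly, but only their squares
   telescope over the scales. *)
have H3 : \sum_(i < B) N (deviation a B g i) <= h%:R * (eps / 2%:R +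
    Cq / (2%:R * eps) * (B%:R^-1 * \sum_(i < B)
          ip (deviation a B g i) (deviation a B g i) / g%:R ^+ 2)).
  apply: (@le_trans _ _ (\sum_(i < B) (g%:R * (eps / 2%:R) + g%:R * (Cq / (2%:R * eps)) *
     (ip (deviation a B g i) (deviation a B g i) / g%:R ^+ 2)))).
    apply: ler_sum => i _; set y := deviation a B g i.
    have y1 : N y ^+ 2 <= Cq * ip y y by apply: N_ip.
    have sq : 0 <= (N y / g%:R - eps) ^+ 2 by apply: sqr_ge0.
    have -> : g%:R * (eps / 2%:R) + g%:R * (Cq / (2%:R * eps)) * (ip y y / g%:R ^+ 2)
      = g%:R / (2%:R * eps) * (eps ^+ 2 + Cq * ip y y / g%:R ^+ 2).
      by field; rewrite !gt_eqF.
    have -> : N y = g%:R / (2%:R * eps) * (2%:R * eps * (N y / g%:R)).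
      by field; rewrite !gt_eqF.
    rewrite ler_pM2l ?divr_gt0 ?mulr_gt0 //.
    have y2 : (N y / g%:R) ^+ 2 <= Cq * ip y y / g%:R ^+ 2.
      by rewrite expr_div_n ler_pM2r ?invr_gt0 ?exprn_gt0.
    lra.
  rewrite big_split /= sumr_const card_ord -mulr_sumr -[(_ *+ B)]mulr_natl hE.
  by rewrite le_eqVlt; apply/orP; left; apply/eqP; field; rewrite !gt_eqF.
rewrite ler_pdivrMl ?exprn_gt0 //; apply: (le_trans H1).
have H4 := window_drift_le a g B_gt1; rewrite -/h -/W in H4.
set Q := B%:R^-1 * \sum_(i < B) _ in H3 *.
set Se := \sum_(r < h) e (a + r)%N.
have H5 : 2%:R * Cb * h%:R * C1 * (\sum_(i < B) N (deviation a B g i))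
   <= 2%:R * Cb * h%:R * C1 * (h%:R * (eps / 2%:R + Cq / (2%:R * eps) * Q)).
  by rewrite ler_pM2l // !mulr_gt0.
apply: (@le_trans _ _ (4%:R^-1 * (- (c * kap ^+ 2) * h%:R ^+ 2 + 2%:R * c * kap * h%:R * D)
   + 2%:R * Cb * h%:R * C1 * (h%:R * (eps / 2%:R + Cq / (2%:R * eps) * Q))
   + h%:R * g%:R * Cb * C1 ^+ 2 + h%:R * e a + Se)).
  by lra.
rewrite /gain /slope hE le_eqVlt; apply/orP; left; apply/eqP.
by field; rewrite !gt_eqF.
Qed.

Definition scale j := (g0 * B ^ j)%N.

Lemma scale_gt0 j : (0 < scale j)%N.
Proof. by rewrite /scale muln_gt0 g0_gt0 expn_gt0 ltnW. Qed.

Lemma scaleS j : scale j.+1 = (B * scale j)%N.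
Proof. by rewrite /scale expnS mulnCA. Qed.

Lemma scaleS_le j : (j < n)%N -> (scale j.+1 <= T)%N.
Proof. by move=> jn; rewrite /scale leq_mul2l leq_exp2l // jn orbT. Qed.

Lemma sum_scale_le m : (\sum_(j < m) scale j.+1 <= 2 * scale m)%N.
Proof.
elim: m => [|m IH]; first by rewrite big_ord0.
rewrite big_ord_recr /= scaleS.
have H : (2 * scale m <= B * scale m)%N by rewrite leq_mul2r B_gt1 orbT.
by move: (\sum_(j < m) _)%N (scale m) (B * scale m)%N IH H; lia.
Qed.

(** The telescoped variances cost at most [3 * T * C1 ^ 2]: one part for the energy at the smallest
    scale, two for the geometric sum of the shift errors. This does not grow with [n], whereas the
    gain is collected at every scale. *)
Lemma multiscale_increment_le :
  \sum_(j < n) \sum_(a < T) ((scale j.+1)%:R ^+ 2)^-1 *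
     \sum_(r < scale j.+1) (f (a + r)%N - f a)
  <= T%:R * (3%:R * slope * C1 ^+ 2 - n%:R * gain)
     + n%:R * (c * kap / 2%:R) * \sum_(t < 2 * T) d t
     + 2%:R * n%:R / g0%:R * \sum_(t < 2 * T) e t.
Proof.
have slope0 : 0 < slope by rewrite /slope divr_gt0 ?mulr_gt0.
have ck0 : 0 < c * kap / 2%:R by rewrite divr_gt0 ?mulr_gt0.
have g0R : 0 < g0%:R :> R by rewrite ltr0n.
set Sd := \sum_(t < 2 * T) d t; set Se := \sum_(t < 2 * T) e t.
have Sd0 : 0 <= Sd by apply: sumr_ge0.
have Se0 : 0 <= Se by apply: sumr_ge0.
apply: (@le_trans _ _ (\sum_(j < n) (- T%:R * gain
  + slope * (energy (scale j) - energy (scale j.+1) + (scale j.+1)%:R * C1 ^+ 2)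
  + c * kap / 2%:R * Sd + 2%:R / g0%:R * Se))); last first.
  rewrite !big_split /= !sumr_const !card_ord -!mulr_sumr !big_split /= -mulr_suml.
  rewrite -[(- T%:R * gain) *+ n]mulr_natl -[(_ * Sd) *+ n]mulr_natl
    -[(_ * Se) *+ n]mulr_natl.
  have tele m : \sum_(j < m) energy (scale j) + \sum_(j < m) - energy (scale j.+1)
      = energy (scale 0) - energy (scale m).
    elim: m => [|m IH]; first by rewrite !big_ord0 addr0 subrr.
    by rewrite !big_ord_recr /= addrACA IH; ring.
  rewrite tele.
  have E0 m : 0 <= energy (scale m) <= T%:R * C1 ^+ 2.
    apply/andP; split.
      by apply: sumr_ge0 => a _; have /andP[] := window_energy_le a (scale_gt0 m).
    rewrite mulr_natl -[T in _ *+ T]card_ord -sumr_const.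
    by apply: ler_sum => a _; have /andP[] := window_energy_le a (scale_gt0 m).
  have /andP[_ e1] := E0 0%N; have /andP[e2 _] := E0 n.
  have s1 : \sum_(j < n) (scale j.+1)%:R <= 2%:R * T%:R :> R.
    by rewrite -natr_sum -natrM ler_nat; apply: sum_scale_le.
  have s2 : (\sum_(j < n) (scale j.+1)%:R) * C1 ^+ 2 <= 2%:R * T%:R * C1 ^+ 2.
    by rewrite ler_wpM2r ?exprn_ge0 // ltW.
  have s3 : slope * (energy (scale 0) - energy (scale n)
     + (\sum_(j < n) (scale j.+1)%:R) * C1 ^+ 2) <= slope * (3%:R * T%:R * C1 ^+ 2).
    by rewrite ler_pM2l //; lra.
  lra.
apply: ler_sum => j _; set g := scale j; set h := scale j.+1.
have hE : h = (B * g)%N by rewrite /h scaleS.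
have gp : (0 < g)%N by apply: scale_gt0.
have hp : (0 < h)%N by apply: scale_gt0.
have hpR : 0 < h%:R :> R by rewrite ltr0n.
have hT : (h <= T)%N by apply: scaleS_le.
have g0h : (g0 <= h)%N.
  by rewrite /h /scale -[leqLHS]muln1 leq_mul2l expn_gt0 (ltnW B_gt1) orbT.
have hg0 : h%:R^-1 <= g0%:R^-1 :> R by rewrite lef_pV2 ?posrE // ler_nat.
apply: (@le_trans _ _ (\sum_(a < T) (- gain
     + slope * (B%:R^-1 * \sum_(i < B)
          ip (deviation a B g i) (deviation a B g i) / g%:R ^+ 2)
     + c * kap / 2%:R * (h%:R^-1 * \sum_(r < h) d (a + r)%N)
     + h%:R^-1 * e a + (h%:R ^+ 2)^-1 * \sum_(r < h) e (a + r)%N))).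
  apply: ler_sum => a _; rewrite hE; apply: window_increment_le => //.
  by rewrite -hE mul2n -addnn leq_add // ltnW.
rewrite !big_split /= sumr_const card_ord -!mulr_sumr -[(- gain) *+ T]mulr_natl.
have X1 := energy_step gp; rewrite -hE -mulr_sumr in X1.
have {X1} X1 := ler_wpM2l (ltW slope0) X1.
have X2 := sum_shift_le d_ge0 hT; have X3 := sum_shift_le e_ge0 hT.
have {X2} X2 : c * kap / 2%:R * (h%:R^-1 * (\sum_(a < T) \sum_(r < h) d (a + r)%N))
    <= c * kap / 2%:R * Sd.
  by rewrite ler_pM2l // ler_pdivrMl.
have {X3} X3 : (h%:R ^+ 2)^-1 * (\sum_(a < T) \sum_(r < h) e (a + r)%N)
    <= g0%:R^-1 * Se.
  apply: (@le_trans _ _ (h%:R^-1 * Se)); last by rewrite ler_wpM2r.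
  rewrite ler_pdivrMl ?exprn_gt0 // expr2 -mulrA (mulrA _ _^-1) mulfV ?gt_eqF // mul1r.
  exact: X3.
have X4 : h%:R^-1 * (\sum_(a < T) e a) <= g0%:R^-1 * Se.
  apply: ler_pM; [by rewrite invr_ge0 ltW|exact: sumr_ge0|exact: hg0|].
  by rewrite /Se mul2n -addnn (sum_ord_add e) lerDl sumr_ge0.
lra.
Qed.

(* Summing by parts, [sum_(a < T) (f (a + r) - f a)] only involves the differences
   [f (T + t) - f t] with [t < r]; their total coefficient over all scales is
   [weight t]. *)
Definition weight t : R :=
  \sum_(j < n) ((scale j.+1)%:R ^+ 2)^-1 * \sum_(r < scale j.+1) (t < r)%:R.

Lemma weight_ge0 t : 0 <= weight t.
Proof. by apply: sumr_ge0 => j _; rewrite mulr_ge0 ?invr_ge0 ?exprn_ge0 ?ler0n // sumr_ge0. Qed.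

Lemma multiscale_drift :
  \sum_(t < T) weight t * f (T + t)%N
    + T%:R * (n%:R * gain - 3%:R * slope * C1 ^+ 2)
  <= \sum_(t < T) weight t * f t
     + n%:R * (c * kap / 2%:R) * \sum_(t < 2 * T) d t
     + 2%:R * n%:R / g0%:R * \sum_(t < 2 * T) e t.
Proof.
have := multiscale_increment_le.
have -> : \sum_(j < n) \sum_(a < T) ((scale j.+1)%:R ^+ 2)^-1 *
     (\sum_(r < scale j.+1) (f (a + r)%N - f a)) =
  \sum_(t < T) weight t * f (T + t)%N - \sum_(t < T) weight t * f t.
  rewrite -sumrB (eq_bigr (fun t : 'I_T => \sum_(j < n) ((scale j.+1)%:R ^+ 2)^-1 *
     (\sum_(r < scale j.+1) (t < r)%:R) * (f (T + t)%N - f t))); last first.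
    by move=> t _; rewrite -mulrBr /weight mulr_suml.
  rewrite [RHS]exchange_big /=; apply: eq_bigr => j _.
  rewrite -mulr_sumr [X in _ * X]exchange_big /=.
  under [RHS]eq_bigr do rewrite -mulrA.
  rewrite -mulr_sumr; congr (_ * _).
  under [RHS]eq_bigr do rewrite mulr_suml.
  rewrite [RHS]exchange_big /=; apply: eq_bigr => r _.
  rewrite sumrB -sumrB; have := sum_shift f T r; rewrite sumrB -!sumrB => ->.
  have rT : (r <= T)%N by apply: ltnW; apply: leq_trans (scaleS_le (ltn_ord j)).
  rewrite (big_ord_widen T (fun t => f (T + t)%N - f t) rT) big_mkcond /=.
  by apply: eq_bigr => t _; case: ifP; rewrite ?mul1r ?mul0r.
lra.
Qed.

End Path.

(** [B], [n] and [C] are chosen before [g0], so the noise factor [C / g0] can still be made small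
    afterwards. The weights [w] do not depend on the path, so the inequality can be averaged over
    paths. *)
Lemma multiscale_lyapunov (kap : R) : 0 < kap ->
  exists (B n : nat) (C : R), [/\ (1 < B)%N, 0 < C & forall g0 : nat, (0 < g0)%N ->
  exists w : nat -> R, (forall t, 0 <= w t) /\
  forall (v : nat -> E) (f d e : nat -> R),
    (forall t, N (v t) <= C1) -> (forall t, 0 <= d t) -> (forall t, 0 <= e t) ->
    (forall a r, (a + r < 2 * (g0 * B ^ n))%N ->
       f (a + r)%N - f a <= b (window v a r) (v (a + r)%N) + e a + e (a + r)%N) ->
    (forall a h, (a + h <= 2 * (g0 * B ^ n))%N ->
       kap * h%:R - \sum_(r < h) d (a + r)%N <= N (window v a h)) ->
    \sum_(t < g0 * B ^ n) w t * f (g0 * B ^ n + t)%N + (g0 * B ^ n)%:R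
    <= \sum_(t < g0 * B ^ n) w t * f t
       + C * \sum_(t < 2 * (g0 * B ^ n)) d t
       + C / g0%:R * \sum_(t < 2 * (g0 * B ^ n)) e t].
Proof.
move=> kap0; pose G := c * kap ^+ 2.
have G0 : 0 < G by rewrite mulr_gt0 ?exprn_gt0.
(* With this [eps] and the next [B], each of the two losses in [gain] is at most [G / 16], so that
   [G / 8] remains out of [G / 4]. *)
pose eps := G / (16%:R * Cb * C1).
have eps0 : 0 < eps by rewrite divr_gt0 // !mulr_gt0.
pose slope := Cb * C1 * Cq / eps.
have slope0 : 0 < slope by rewrite /slope divr_gt0 // !mulr_gt0.
have [B B1 HB] : exists2 B : nat, (1 < B)%N & Cb * C1 ^+ 2 / B%:R <= G / 16%:R.
  pose x := 16%:R * Cb * C1 ^+ 2 / G.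
  exists (Num.truncn x).+2; first by [].
  have xB : x <= (Num.truncn x).+2%:R.
    by apply: ltW; apply: (lt_le_trans (truncnS_gt x)); rewrite ler_nat.
  have BR : 0 < (Num.truncn x).+2%:R :> R by rewrite ltr0n.
  rewrite ler_pdivrMr // -ler_pdivrMl ?divr_gt0 //; apply: le_trans xB.
  by rewrite /x le_eqVlt; apply/orP; left; apply/eqP; field; rewrite gt_eqF.
(* Enough scales for the total gain to exceed the telescoped cost by 1. *)
have [n n0 Hn] : exists2 n : nat, (0 < n)%N & 1 + 3%:R * slope * C1 ^+ 2 <= n%:R * (G / 8%:R).
  set x := (1 + 3%:R * slope * C1 ^+ 2) / (G / 8%:R).
  exists (Num.truncn x).+1; first by [].
  by rewrite -ler_pdivrMr ?divr_gt0 // ltW // truncnS_gt.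
have nR : 0 < n%:R :> R by rewrite ltr0n.
pose C := n%:R * (c * kap / 2%:R) + 2%:R * n%:R.
have C0 : 0 < C by rewrite addr_gt0 // !mulr_gt0 // invr_gt0.
exists B, n, C; split => // g0 g00; exists (weight g0 B n); split => [t|v f d e v1 d0 e0 U W].
  exact: weight_ge0.
have := multiscale_drift v1 g00 B1 kap0 eps0 d0 e0 U W.
set T := (g0 * B ^ n)%N; set gain := (_ - Cb * C1 ^+ 2 / B%:R); rewrite -/slope.
set Sd := \sum_(t < 2 * T) d t; set Se := \sum_(t < 2 * T) e t.
have Sd0 : 0 <= Sd by apply: sumr_ge0.
have Se0 : 0 <= Se by apply: sumr_ge0.
have gainG : G / 8%:R <= gain.
  have -> : gain = G / 4%:R - Cb * C1 * eps - Cb * C1 ^+ 2 / B%:R by [].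
  have -> : Cb * C1 * eps = G / 16%:R by rewrite /eps; field; rewrite !gt_eqF.
  lra.
have g0R : 0 < g0%:R :> R by rewrite ltr0n.
have X1 : T%:R <= T%:R * (n%:R * gain - 3%:R * slope * C1 ^+ 2).
  rewrite -[leLHS]mulr1 ler_wpM2l // lerBrDr; apply: (le_trans Hn).
  by rewrite ler_pM2l.
have X2 : n%:R * (c * kap / 2%:R) * Sd <= C * Sd.
  by rewrite ler_wpM2r // lerDl mulr_ge0.
have X3 : 2%:R * n%:R / g0%:R * Se <= C / g0%:R * Se.
  rewrite ler_wpM2r // ler_pM2r ?invr_gt0 // lerDr ltW //.
  by rewrite !mulr_gt0 // invr_gt0.
move: (\sum_(t < T) _) (\sum_(t < T) _) (T%:R * _) X1 X2 X3 => Y1 Y2 Y3; lra.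
Qed.

End MultiscaleDrift.

(** * Hitting times and positive recurrence *)

Lemma esumZl (R : realType) (T : choiceType) (D : set T) (r : R) (f : T -> \bar R) :
  0 <= r -> (forall x, 0 <= f x)%E ->
  (\esum_(x in D) (r%:E * f x) = r%:E * \esum_(x in D) f x)%E.
Proof.
rewrite le_eqVlt => /predU1P[<- f0|r0 f0].
  by rewrite mul0e esum1 // => x _; rewrite mul0e.
have le (s : R) (h : T -> \bar R) : 0 < s -> (forall x, 0 <= h x)%E ->
    (\esum_(x in D) (s%:E * h x) <= s%:E * \esum_(x in D) h x)%E.
  move=> s0 h0; apply: ge_ereal_sup => _ [X [finX XD]] <-.
  rewrite -ge0_mule_fsumr // lee_pmul2l // ?lte_fin //.
  by apply: ereal_sup_ubound; exists X.
apply/eqP; rewrite eq_le le //=.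
have {1}-> : (\esum_(x in D) f x = \esum_(x in D) (r^-1%:E * (r%:E * f x)))%E.
  by apply: eq_esum => x _; rewrite muleA -EFinM mulVf ?gt_eqF // mul1e.
apply: (@le_trans _ _ (r%:E * (r^-1%:E * \esum_(x in D) (r%:E * f x))))%E.
  rewrite lee_pmul2l // ?lte_fin //; apply: le; first by rewrite invr_gt0.
  by move=> x; rewrite mule_ge0 // lee_fin ltW.
by rewrite muleA -EFinM mulfV ?gt_eqF // mul1e.
Qed.

Lemma esum_exchange (R : realType) (T1 T2 : choiceType) (D1 : set T1) (D2 : set T2)
    (a : T1 -> T2 -> \bar R) : (forall x y, 0 <= a x y)%E ->
  (\esum_(x in D1) \esum_(y in D2) a x y = \esum_(y in D2) \esum_(x in D1) a x y)%E.
Proof.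
move=> a0; rewrite !esum_esum //.
rewrite (reindex_esum (D2 `*`` (fun=> D1)) _ (fun z => (z.2, z.1))) //; split.
- by move=> [y x] [/= ? ?].
- by move=> [y1 x1] [y2 x2] /= _ _ [-> ->].
- by move=> [x y] [/= ? ?]; exists (y, x).
Qed.

Lemma esum_nneseries (R : realType) (T : choiceType) (D : set T)
    (a : T -> nat -> \bar R) : (forall x n, 0 <= a x n)%E ->
  (\esum_(x in D) \sum_(0 <= n <oo) a x n = \sum_(0 <= n <oo) \esum_(x in D) a x n)%E.
Proof.
move=> a0; under eq_esum do rewrite nneseries_esumT //.
rewrite nneseries_esumT; first exact: esum_exchange.
by move=> n; apply: esum_ge0.
Qed.

Lemma nneseries_le_bound (R : realType) (u : nat -> \bar R) (C : \bar R) :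
  (forall n, 0 <= u n)%E -> (forall n, \sum_(k < n) u k <= C)%E ->
  (\sum_(0 <= n <oo) u n <= C)%E.
Proof.
move=> u0 uC; apply: lime_le; first by apply: is_cvg_nneseries => n _ _.
by apply: nearW => n; rewrite big_mkord.
Qed.

Section Recurrence.
Context {R : realType} {T : choiceType}.
Variable p : T -> T -> \bar R.
Hypothesis p_ge0 : forall x y, (0 <= p x y)%E.
Hypothesis p_sum : forall x, (\esum_(y in setT) p x y = 1)%E.
Local Open Scope ereal_scope.

Let p_le1 x y : p x y <= 1.
Proof.
rewrite -(p_sum x) -[leLHS](@esum_set1 _ _ y (p x) (p_ge0 x y)).
rewrite esum_mkcond; apply: le_esum => z _; case: ifP => // _; exact: p_ge0.
Qed.

Let pE x y : p x y = (fine (p x y))%:E.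
Proof.
rewrite fineK // ge0_fin_numE //; exact: le_lt_trans (p_le1 x y) (ltry _).
Qed.

Let pr_ge0 x y : (0 <= fine (p x y))%R.
Proof. exact: fine_ge0. Qed.

(** The transition operator of the chain killed on entering [F]. *)
Definition taboo (F : set T) (h : T -> \bar R) (x : T) : \bar R :=
  \esum_(y in ~` F) (p x y * h y).

(** The expected sum of [h] over the times before [tau_F], time 0 included. For [h = 1] it is the
    mean of [tau_F]; for [h = p ^~ z] with [z] in [F] it is the probability that the chain first
    enters [F] at [z]. *)
Definition green (F : set T) (h : T -> \bar R) (x : T) : \bar R :=
  \sum_(0 <= n <oo) iter n (taboo F) h x.

Lemma taboo_ge0 F h : (forall y, 0 <= h y) -> forall x, 0 <= taboo F h x.
Proof. by move=> h0 x; apply: esum_ge0 => y _; rewrite mule_ge0. Qed.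

Lemma le_taboo F h1 h2 : (forall y, h1 y <= h2 y) ->
  forall x, taboo F h1 x <= taboo F h2 x.
Proof. by move=> h12 x; apply: le_esum => y _; rewrite lee_wpmul2l. Qed.

Lemma tabooD F h1 h2 : (forall y, 0 <= h1 y) -> (forall y, 0 <= h2 y) ->
  forall x, taboo F (h1 \+ h2) x = taboo F h1 x + taboo F h2 x.
Proof.
move=> h10 h20 x; rewrite /taboo -esumD => [|y _|y _]; try by rewrite mule_ge0.
by apply: eq_esum => y _; rewrite /= ge0_muleDr.
Qed.

Lemma tabooZ F (r : R) h : (0 <= r)%R -> (forall y, 0 <= h y) ->
  forall x, taboo F (fun y => r%:E * h y) x = r%:E * taboo F h x.
Proof.
move=> r0 h0 x; rewrite /taboo -esumZl //; last by move=> y; rewrite mule_ge0.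
by apply: eq_esum => y _; rewrite muleCA.
Qed.

Lemma iter_taboo_ge0 F h n : (forall y, 0 <= h y) ->
  forall x, 0 <= iter n (taboo F) h x.
Proof. by move=> h0; elim: n => [//|n IH] x /=; exact: taboo_ge0. Qed.

Lemma green_ge0 F h : (forall y, 0 <= h y) -> forall x, 0 <= green F h x.
Proof. by move=> h0 x; apply: nneseries_ge0 => n _ _; apply: iter_taboo_ge0. Qed.

Lemma taboo_green F h x : (forall y, 0 <= h y) ->
  green F h x = h x + taboo F (green F h) x.
Proof.
move=> h0; rewrite {1}/green nneseries_recl //; last first.
  by move=> n _; apply: iter_taboo_ge0.
congr (_ + _); rewrite /taboo.
under [RHS]eq_esum => y _.
  rewrite /green pE -nneseriesZl => [|n _]; last exact: iter_taboo_ge0.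
  over.
rewrite esum_nneseries => [|y n]; last by rewrite mule_ge0 ?lee_fin ?iter_taboo_ge0.
rewrite -(nneseries_addn 1) => [|n]; last exact: iter_taboo_ge0.
apply: eq_eseriesr => n _; rewrite addn1 /= /taboo.
by apply: eq_esum => y _; rewrite -pE.
Qed.

(** The Green function is the least nonnegative supersolution: by induction all its partial sums lie
    below [u]. *)
Lemma green_le F h u x : (forall y, 0 <= h y) -> (forall y, 0 <= u y) ->
  (forall y, h y + taboo F u y <= u y) -> green F h x <= u x.
Proof.
move=> h0 u0 hu; apply: nneseries_le_bound => [n|n]; first exact: iter_taboo_ge0.
elim: n x => [|n IH] x; first by rewrite big_ord0.
apply: le_trans (hu x); rewrite big_ord_recl leeD2l //.
apply: le_trans (le_taboo _ IH x); rewrite /taboo.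
rewrite -[leLHS]/(\sum_(i < n) \esum_(y in ~` F) (p x y * iter i (taboo F) h y)).
rewrite -esum_sum => [|y i _ _]; last by rewrite mule_ge0 ?iter_taboo_ge0.
apply: le_esum => y _; rewrite ge0_sume_distrr // => i _; exact: iter_taboo_ge0.
Qed.

(** The probability that [tau_F > n]. *)
Definition survival (F : set T) n x := iter n (taboo F) (cst 1) x.

Lemma survival_ge0 F n x : 0 <= survival F n x.
Proof. by apply: iter_taboo_ge0 => y; rewrite lee01. Qed.

Lemma green_le1 (F : set T) z x : F z -> green F (p ^~ z) x <= 1.
Proof.
move=> Fz; apply: green_le => [//|y|y]; first by rewrite lee01.
rewrite -[leRHS](p_sum y) [leRHS](esumID F) // !setTI; apply: leeD.
  rewrite -[leLHS](@esum_set1 _ _ z (p y)) // esum_mkcond [leRHS]esum_mkcond.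
  apply: le_esum => w _; case: ifPn => [/set_mem ->|_]; first by rewrite mem_set.
  by case: ifP.
by apply: le_esum => w _; rewrite /= mule1.
Qed.

Lemma first_passage_ge0 F n x : 0 <= first_passage p F n x.
Proof.
elim: n x => [|n IH] x /=; first exact: esum_ge0.
by apply: esum_ge0 => y _; rewrite mule_ge0.
Qed.

Lemma first_passage_survival F n x :
  first_passage p F n x + survival F n.+1 x = survival F n x.
Proof.
elim: n x => [|n IH] x.
  rewrite /survival /= /taboo -[RHS](p_sum x) [RHS](esumID F) // !setTI; congr (_ + _).
  by apply: eq_esum => y _; rewrite mule1.
rewrite -[first_passage _ _ _ _]/(taboo F (first_passage p F n) x).
rewrite -[survival F n.+2 x]/(taboo F (survival F n.+1) x) -tabooD.
- by apply: eq_esum => y _; rewrite /= IH.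
- exact: first_passage_ge0.
- by move=> y; apply: survival_ge0.
Qed.

Lemma survival_le1 F n x : survival F n x <= 1.
Proof.
elim: n x => [|n IH] x; first by [].
apply: le_trans (IH x); rewrite -[leRHS](first_passage_survival F n x).
by rewrite leeDr // first_passage_ge0.
Qed.

Lemma survival_nincr F n x : survival F n.+1 x <= survival F n x.
Proof. by rewrite -[leRHS](first_passage_survival F n x) leeDr // first_passage_ge0. Qed.

Lemma survival_fin_num F n x : survival F n x \is a fin_num.
Proof.
rewrite ge0_fin_numE ?survival_ge0 //.
exact: le_lt_trans (survival_le1 F n x) (ltry _).
Qed.

Lemma sum_first_passage F n x :
  \sum_(k < n) first_passage p F k x + survival F n x = 1.
Proof.
elim: n => [|n IH]; first by rewrite big_ord0 add0e.
by rewrite big_ord_recr /= -addeA first_passage_survival.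
Qed.

Lemma sum_mean_first_passage F n x :
  \sum_(k < n) k.+1%:R%:E * first_passage p F k x <= \sum_(k < n) survival F k x.
Proof.
(* Summation by parts, with boundary term [n] times the probability that [tau_F >= n + 1]. *)
suff -> : \sum_(k < n) survival F k x =
    \sum_(k < n) k.+1%:R%:E * first_passage p F k x + n%:R%:E * survival F n x.
  by rewrite leeDl // mule_ge0 ?survival_ge0 // lee_fin ler0n.
elim: n => [|n IH]; first by rewrite !big_ord0 add0e mul0e.
have fpn := first_passage_survival F n x.
rewrite !big_ord_recr /= IH -!addeA; congr (_ + _).
rewrite -fpn ge0_muleDr ?first_passage_ge0 ?survival_ge0 // -!addeA.
rewrite -natr1 EFinD !ge0_muleDl ?lee_fin ?ler0n // !mul1e.
by rewrite [LHS]addeCA -!addeA addeCA; congr (_ + _); rewrite addeCA addeC -addeA.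
Qed.

Lemma finite_mean_passage_green F x :
  green F (cst 1) x < +oo -> finite_mean_passage p F x.
Proof.
move=> fin; have green_bound n : \sum_(k < n) survival F k x <= green F (cst 1) x.
  have := @nneseries_lim_ge R (survival F ^~ x) xpredT 0%N n; rewrite big_mkord.
  by apply => k _ _; apply: survival_ge0.
split; last first.
  apply: le_lt_trans fin; apply: nneseries_le_bound => n.
    by rewrite mule_ge0 ?first_passage_ge0 // lee_fin ler0n.
  exact: le_trans (sum_mean_first_passage F n x) (green_bound n).
apply/eqP; rewrite eq_le; apply/andP; split.
  apply: nneseries_le_bound => n; first exact: first_passage_ge0.
  by rewrite -[leRHS](sum_first_passage F n x) leeDl // survival_ge0.
have g0 : 0 <= green F (cst 1) x by apply: green_ge0 => y; rewrite lee01.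
have gE : green F (cst 1) x = (fine (green F (cst 1%E) x))%:E.
  by rewrite fineK // ge0_fin_numE.
set M := fine _ in gE.
have M0 : (0 <= M)%R by apply: fine_ge0.
(* Survival probabilities decrease, so [n] times the [n]-th one is at most their sum. Hence they
   tend to 0 and [tau_F] is almost surely finite. *)
have surv_small n : (fine (survival F n x) * n%:R <= M)%R.
  rewrite -lee_fin -gE EFinM fineK ?survival_fin_num //; apply: le_trans (green_bound n).
  elim: n => [|n IH]; first by rewrite mule0 big_ord0.
  rewrite big_ord_recr /= -natr1 EFinD ge0_muleDr ?lee_fin ?ler0n // mule1.
  apply: leeD; last exact: survival_nincr.
  by apply: le_trans IH; rewrite lee_wpmul2r ?lee_fin ?ler0n // survival_nincr.
apply/lee_addgt0Pr => e e0.
pose n := (Num.truncn (M / e)).+1.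
have nR : (0 < n%:R :> R)%R by rewrite ltr0n.
rewrite -(sum_first_passage F n x); apply: leeD.
  have := @nneseries_lim_ge R (first_passage p F ^~ x) xpredT 0%N n; rewrite big_mkord.
  by apply => k _ _; apply: first_passage_ge0.
rewrite -(fineK (survival_fin_num F n x)) lee_fin -(ler_pM2r nR).
apply: (le_trans (surv_small n)); rewrite mulrC -ler_pdivrMr //.
by apply: ltW; apply: truncnS_gt.
Qed.

Definition hit_finite_mean (F : set T) := forall x, green F (cst 1) x < +oo.

Lemma foster (C : set T) (g : T -> R) (delta : R) : (0 < delta)%R ->
  (forall x, (0 <= g x)%R) ->
  (forall x, \esum_(y in setT) (p x y * (g y)%:E) < +oo) ->
  (forall x, ~ C x -> \esum_(y in setT) (p x y * (g y)%:E) + delta%:E <= (g x)%:E) ->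
  hit_finite_mean C.
Proof.
move=> d0 g0 Pfin drift x.
pose P x := \esum_(y in setT) (p x y * (g y)%:E).
have P0 y : 0 <= P y by apply: esum_ge0 => z _; rewrite mule_ge0 ?lee_fin.
(* The drift condition is silent on [C], so there the supersolution is obtained by taking one step.
   The taboo sum only sees its values outside [C]. *)
pose u y := if y \in C then 1 + delta^-1%:E * P y else (delta^-1 * g y)%:E.
have di : (0 <= delta^-1)%R by rewrite invr_ge0 ltW.
have u0 y : 0 <= u y.
  by rewrite /u; case: ifP => _; rewrite ?lee_fin ?mulr_ge0 // adde_ge0 // mule_ge0 ?lee_fin.
have tu y : taboo C u y <= delta^-1%:E * P y.
  rewrite /P -esumZl // => [|z]; last by rewrite mule_ge0 ?lee_fin.
  rewrite /taboo esum_mkcond; apply: le_esum => z _.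
  have q0 : 0 <= delta^-1%:E * (p y z * (g z)%:E) by rewrite !mule_ge0 ?lee_fin.
  case: ifPn => // zC.
  have -> : u z = (delta^-1 * g z)%:E by rewrite /u -[z \in C]negbK -in_setC zC.
  by rewrite EFinM muleCA.
apply: (@le_lt_trans _ _ (u x)).
  apply: green_le => // y; apply: (le_trans (leeD2l 1 (tu y))).
  rewrite /u; case: ifPn => // yC.
  have := drift y; rewrite notin_setE in yC => /(_ yC) H.
  have di' : 0 <= delta^-1%:E by rewrite lee_fin.
  rewrite EFinM; apply: le_trans (lee_wpmul2l di' H).
  by rewrite -/(P y) ge0_muleDr ?lee_fin ?(ltW d0) // -EFinM mulVf ?gt_eqF // addeC.
rewrite /u; case: ifP => _; last by rewrite ltry.
apply: lte_add_pinfty; first by rewrite ltry.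
by apply: lte_mul_pinfty => //; apply: Pfin.
Qed.

Section Minimal.
Variables (F : set T) (z : T).
Hypotheses (Fz : F z) (Fhit : hit_finite_mean F).

Let alpha := green F (p ^~ z).

Let alpha_ge0 x : 0 <= alpha x. Proof. by apply: green_ge0. Qed.

Let esum_F_split (h : T -> \bar R) : (forall y, 0 <= h y) ->
  \esum_(y in F) h y = h z + \esum_(y in F `\ z) h y.
Proof.
move=> h0; rewrite (esumID [set z]) // -setDE; congr (_ + _).
rewrite (_ : _ `&` _ = [set z]) ?esum_set1 //.
by apply/seteqP; split => [y [] //|y /= ->]; split.
Qed.

Let taboo_setD1 h x : (forall y, 0 <= h y) ->
  taboo (F `\ z) h x = taboo F h x + p x z * h z.
Proof.
move=> h0; rewrite /taboo (esumID F) => [|y _]; last by rewrite mule_ge0.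
have -> : ~` (F `\ z) `&` ~` F = ~` F.
  by apply/seteqP; split => [y []//|y yF]; split => // -[].
have -> : ~` (F `\ z) `&` F = [set z].
  apply/seteqP; split => [y [yFz yF]|y /= ->]; last by split => // -[_]; apply.
  by apply: contrapT => yz; apply: yFz.
by rewrite esum_set1 ?mule_ge0 // addeC.
Qed.

Lemma hit_finite_mean_setD1 : alpha z < 1 -> hit_finite_mean (F `\ z).
Proof.
move=> az1 x; pose m := green F (cst 1).
have m0 y : 0 <= m y by apply: green_ge0 => w; rewrite lee01.
have mE y : m y = (fine (m y))%:E by rewrite fineK // ge0_fin_numE.
have aE y : alpha y = (fine (alpha y))%:E.
  by rewrite fineK // ge0_fin_numE //; apply: le_lt_trans (green_le1 y Fz) (ltry _).
have a1 : (0 < 1 - fine (alpha z))%R by rewrite subr_gt0 -lte_fin -aE.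
(* [k] solves [k = m z + k * alpha z], so it is the value of [u] at [z]: from [y] one waits for [F],
   and for a further [k] if the entrance is at [z]. *)
pose k := (fine (m z) / (1 - fine (alpha z)))%R.
have k0 : (0 <= k)%R by apply: divr_ge0; [exact: fine_ge0|exact: ltW].
pose u := m \+ (fun y => k%:E * alpha y).
have u0 y : 0 <= u y by rewrite /u /= adde_ge0 // mule_ge0 // lee_fin.
apply: (@le_lt_trans _ _ (u x)); last first.
  by rewrite /u /= mE aE -EFinM -EFinD ltry.
apply: green_le => // y.
have uz : u z = k%:E.
  rewrite /u /= mE aE -EFinM -EFinD; congr EFin; rewrite /k.
  by field; rewrite gt_eqF.
rewrite taboo_setD1 // uz tabooD // => [|w]; last by rewrite mule_ge0 ?lee_fin.
rewrite tabooZ // /u /=.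
have -> : m y = 1 + taboo F m y by rewrite /m taboo_green.
have -> : alpha y = p y z + taboo F alpha y by rewrite /alpha taboo_green.
rewrite [X in _ <= _ + X]ge0_muleDr ?taboo_ge0 // -!addeA.
by rewrite !leeD2l // addeC muleC.
Qed.

Lemma positive_recurrent_state_of_hit : alpha z = 1 -> positive_recurrent_state p z.
Proof.
move=> az; apply: finite_mean_passage_green; apply: le_lt_trans (Fhit z).
apply: lee_nneseries => [n _ _|n _]; first exact: survival_ge0.
(* If [z] is not hit by time [n], then either [F] is not hit either, or the first entrance into [F]
   is not at [z]. This union bound is written with sums only, to avoid subtraction of extended
   reals; at [z], [alpha z = 1] makes the second event negligible. *)
have H x : survival [set z] n x + alpha x <= survival F n x + 1.
  elim: n x => [|n IH] x.
    by rewrite /survival /= leeD2l //; exact: green_le1.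
  have -> : survival [set z] n.+1 x = taboo F (survival [set z] n) x
      + \esum_(y in F `\ z) (p x y * survival [set z] n y).
    rewrite -[LHS]/(taboo [set z] (survival [set z] n) x) {1}/taboo.
    rewrite (esumID F) => [|y _]; last by rewrite mule_ge0 ?survival_ge0.
    rewrite addeC; congr (_ + _); congr esum; apply/seteqP; split => y /=.
    - by case.
    - by move=> yF; split => // yz; apply: yF; rewrite yz.
    - by case.
    - by case.
  have -> : alpha x = p x z + taboo F alpha x by rewrite /alpha taboo_green.
  have -> : survival F n.+1 x = taboo F (survival F n) x by [].
  apply: (@le_trans _ _ (taboo F (survival [set z] n \+ alpha) x + \esum_(y in F) p x y)).
    rewrite tabooD // => [|y]; last exact: survival_ge0.
    rewrite esum_F_split // [leLHS]addeACA [leRHS]addeACA leeD2l // addeC leeD2l //.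
    by apply: le_esum => y _; rewrite -[leRHS]mule1 lee_wpmul2l // survival_le1.
  apply: (@le_trans _ _ (taboo F (survival F n \+ cst 1) x + \esum_(y in F) p x y)).
    by rewrite leeD2r // le_taboo.
  rewrite tabooD // => [|y]; last exact: survival_ge0.
  rewrite -addeA leeD2l // -[leRHS](p_sum x) [leRHS](esumID F) // !setTI addeC leeD2l //.
  by apply: le_esum => y _; rewrite mule1.
have := H z; rewrite az leeD2rE //.
Qed.

End Minimal.

(* A hitting set of minimal cardinality consists of positive recurrent states:
   if from [z \in F] the chain could re-enter [F] elsewhere than in [z], then
   [F `\ z] would already be hit in finite mean time. *)
Lemma positive_recurrent_of_hit (C : set T) :
  finite_set C -> hit_finite_mean C -> positive_recurrent p.
Proof.
move=> /finite_fsetP[A ->]; have [n] := ubnP #|` A|%fset.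
elim: n A => // n IH A An hitA.
have [[z [zA az]]|none] := pselect (exists z, [set` A] z /\ green [set` A] (p ^~ z) z < 1).
  apply: (IH (A `\ z)%fset).
    by move: An; rewrite (cardfsD1 z) (_ : z \in A).
  by rewrite set_fsetD1; exact: hit_finite_mean_setD1.
exists [set` A]; split; [exact: finite_fset| |].
  move=> z zA; apply: (positive_recurrent_state_of_hit zA hitA).
  apply/eqP; rewrite eq_le; apply/andP; split; last first.
    by rewrite leNgt; apply/negP => az; apply: none; exists z.
  exact: green_le1.
by move=> x; apply: finite_mean_passage_green.
Qed.

End Recurrence.

(** * Expectation of nonnegative functions *)

Section Expectation.
Context {R : realType}.
Local Open Scope ereal_scope.

(* A functional that integrates nonnegative functions against a probability
   carried by [S], of which only finite additivity is recorded. *)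
Record expectation_on {T : Type} (S : set T) (E : (T -> \bar R) -> \bar R) : Prop :=
  ExpectationOn {
    le_expect : forall f g, (forall x, S x -> f x <= g x) -> E f <= E g;
    expectD : forall f g, (forall x, S x -> 0 <= f x) -> (forall x, S x -> 0 <= g x) ->
      E (fun x => f x + g x) = E f + E g;
    expectZ : forall (r : R) f, (0 <= r)%R -> (forall x, S x -> 0 <= f x) ->
      E (fun x => r%:E * f x) = r%:E * E f;
    expect1 : E (fun=> 1) = 1 }.

Section Theory.
Context {T : Type} {S : set T} {E : (T -> \bar R) -> \bar R}.
Hypothesis ES : expectation_on S E.

Lemma eq_expect f g : (forall x, S x -> f x = g x) -> E f = E g.
Proof.
by move=> fg; apply/eqP; rewrite eq_le !(le_expect ES) // => x Sx; rewrite fg.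
Qed.

Lemma expect_cst (r : R) : (0 <= r)%R -> E (fun=> r%:E) = r%:E.
Proof.
move=> r0; rewrite -[RHS]mule1 -(expect1 ES) -(expectZ ES) //.
by apply: eq_expect => x _; rewrite mule1.
Qed.

Lemma expect_ge0 f : (forall x, S x -> 0 <= f x) -> 0 <= E f.
Proof.
by move=> f0; rewrite -[leLHS](expect_cst (lexx 0%R)); apply: (le_expect ES).
Qed.

Lemma expect0 : E (fun=> 0) = 0.
Proof. exact: expect_cst (lexx 0%R). Qed.

Lemma expect_sum {I : Type} (r : seq I) (f : I -> T -> \bar R) :
  (forall i x, S x -> 0 <= f i x) ->
  E (fun x => \sum_(i <- r) f i x) = \sum_(i <- r) E (f i).
Proof.
move=> f0; elim: r => [|i r IH].
  rewrite big_nil -[RHS]expect0.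
  by apply: eq_expect => x _; rewrite big_nil.
rewrite big_cons -IH -(expectD ES) => [|x Sx|x Sx].
- by apply: eq_expect => x _; rewrite big_cons.
- exact: f0.
- by apply: sume_ge0 => k _; apply: f0.
Qed.

(* That [xi] is centred is expressed with the nonnegative variable [xi + C]. *)
Lemma expect_sqr_le (xi : T -> R) (C z : R) : (0 <= C)%R ->
  (forall x, S x -> `|xi x| <= C)%R -> E (fun x => (xi x + C)%:E) = C%:E ->
  E (fun x => ((z + xi x) ^+ 2)%:E) <= (z ^+ 2 + C ^+ 2)%:E.
Proof.
move=> C0 xiC Exi.
have xi0 x : S x -> (0 <= xi x + C)%R by move=> /xiC; rewrite ler_norml => /andP[]; lra.
have xi2 x : S x -> (xi x ^+ 2 <= C ^+ 2)%R.
  by move=> /xiC xC; rewrite -[leLHS]real_normK ?num_real // lerXn2r ?nnegrE.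
have sq0 x : (0 <= (z + xi x) ^+ 2)%R by apply: sqr_ge0.
(* The cross term [2 * z * xi] has no sign, while additivity holds for nonnegative functions. Its
   coefficient is split into [a - b], and the negative part is moved to the other side. *)
pose a := Num.max 0%R (2 * z)%R; pose b := Num.max 0%R (- (2 * z))%R.
have [a0 b0] : (0 <= a)%R /\ (0 <= b)%R by rewrite /a /b !le_max !lexx.
have ab : (a - b = 2 * z)%R.
  by rewrite /a /b; case: (leP 0%R (2 * z)%R) => ?; case: leP => ?; lra.
have abC : (0 <= a * C)%R /\ (0 <= b * C)%R by rewrite !mulr_ge0.
pose c := (z ^+ 2 + C ^+ 2 + b * C)%R.
have c0 : (0 <= c)%R by rewrite !addr_ge0 ?sqr_ge0 //; case: abC.
have : E (fun x => ((z + xi x) ^+ 2 + a * C)%:E + b%:E * (xi x + C)%:E)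
    <= E (fun x => c%:E + a%:E * (xi x + C)%:E).
  apply: (le_expect ES) => x Sx; rewrite -!EFinM -!EFinD lee_fin /c.
  have := xi2 x Sx; have -> : ((z + xi x) ^+ 2 = z ^+ 2 + xi x ^+ 2 + (a - b) * xi x)%R.
    by rewrite ab; ring.
  lra.
have sqC x : 0 <= ((z + xi x) ^+ 2 + a * C)%:E.
  by rewrite lee_fin addr_ge0 //; case: abC.
have bxi x : S x -> 0 <= b%:E * (xi x + C)%:E by move=> Sx; rewrite mule_ge0 ?lee_fin ?xi0.
have axi x : S x -> 0 <= a%:E * (xi x + C)%:E by move=> Sx; rewrite mule_ge0 ?lee_fin ?xi0.
rewrite (expectD ES) // (expectZ ES) //.
rewrite (expectD ES) // (expectZ ES) //.
rewrite (expect_cst c0) Exi.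
have -> : E (fun x => ((z + xi x) ^+ 2 + a * C)%:E)
    = E (fun x => ((z + xi x) ^+ 2)%:E) + (a * C)%:E.
  case: abC => aC _; rewrite -(expect_cst aC) -(expectD ES) //.
  by move=> x _; rewrite lee_fin.
rewrite -!EFinM -addeA -!EFinD.
have -> : (c + a * C)%:E = (z ^+ 2 + C ^+ 2)%:E + (a * C + b * C)%:E.
  by rewrite -EFinD /c; congr EFin; lra.
by rewrite leeD2rE.
Qed.

End Theory.

Lemma map_expectation {T U : Type} (phi : T -> U) (S : set T) (S' : set U) E :
  expectation_on S E -> (forall x, S x -> S' (phi x)) ->
  expectation_on S' (fun f => E (f \o phi)).
Proof.
move=> [leE DE ZE E1] SS'; split => //=.
- by move=> f g fg; apply: leE => x /SS'; exact: fg.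
- by move=> f g f0 g0; apply: DE => x /SS' ?; [exact: f0|exact: g0].
- by move=> r f r0 f0; apply: ZE => // x /SS' ?; exact: f0.
Qed.

Lemma bind_expectation {T U : Type} (S : set T) (S' : T -> set U) E1 E2 :
  expectation_on S E1 -> (forall x, expectation_on (S' x) (E2 x)) ->
  expectation_on [set xy | S xy.1 /\ S' xy.1 xy.2]
    (fun f => E1 (fun x => E2 x (fun y => f (x, y)))).
Proof.
move=> H1 H2; split.
- by move=> f g fg; apply: (le_expect H1) => x Sx; apply: (le_expect (H2 x)) => y S'y; apply: fg.
- move=> f g f0 g0; rewrite -(expectD H1).
  + by apply: (eq_expect H1) => x Sx; rewrite (expectD (H2 x)) // => y S'y; [apply: f0|apply: g0].
  + by move=> x Sx; apply: (expect_ge0 (H2 x)) => y S'y; apply: f0.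
  + by move=> x Sx; apply: (expect_ge0 (H2 x)) => y S'y; apply: g0.
- move=> r f r0 f0; rewrite -(expectZ H1) //.
  + by apply: (eq_expect H1) => x Sx; rewrite (expectZ (H2 x)) // => y S'y; apply: f0.
  + by move=> x Sx; apply: (expect_ge0 (H2 x)) => y S'y; apply: f0.
- rewrite -[RHS](expect1 H1); apply: (eq_expect H1) => x Sx; exact: (expect1 (H2 x)).
Qed.

(** Indices of weight zero are exempted because the rules of the policy only constrain choices of
    nonzero probability. *)
Lemma mix_expectation {I T : Type} (r : seq I) (w : I -> R) (S : set T)
    (E : I -> (T -> \bar R) -> \bar R) :
  (forall i, (0 <= w i)%R) -> (\sum_(i <- r) w i = 1)%R ->
  (forall i, w i != 0%R -> expectation_on S (E i)) ->
  expectation_on S (fun f => \sum_(i <- r) (w i)%:E * E i f).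
Proof.
move=> w0 w1 ES; split.
- move=> f g fg; apply: lee_sum => i _; have [->|wi] := eqVneq (w i) 0%R.
    by rewrite !mul0e.
  by rewrite lee_wpmul2l ?lee_fin //; apply: (le_expect (ES i wi)).
- move=> f g f0 g0; rewrite -big_split /=; apply: eq_bigr => i _.
  have [->|wi] := eqVneq (w i) 0%R; first by rewrite !mul0e adde0.
  by rewrite (expectD (ES i wi)) // ge0_muleDr // (expect_ge0 (ES i wi)).
- move=> a f a0 f0; rewrite ge0_sume_distrr => [|i _]; last first.
    have [->|wi] := eqVneq (w i) 0%R; first by rewrite mul0e.
    by rewrite mule_ge0 ?lee_fin // (expect_ge0 (ES i wi)).
  apply: eq_bigr => i _; have [->|wi] := eqVneq (w i) 0%R; first by rewrite !mul0e mule0.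
  by rewrite (expectZ (ES i wi)) // muleCA.
- transitivity (\sum_(i <- r) (w i)%:E); last by rewrite sumEFin w1.
  apply: eq_bigr => i _; have [->|wi] := eqVneq (w i) 0%R; first by rewrite mul0e.
  by rewrite (expect1 (ES i wi)) mule1.
Qed.

Lemma mix_expectation_le {I T : Type} (r : seq I) (w : I -> R)
    (E : I -> (T -> \bar R) -> \bar R) (f : T -> \bar R) (a : \bar R) :
  (forall i, (0 <= w i)%R) -> (\sum_(i <- r) w i = 1)%R -> 0 <= a ->
  (forall i, w i != 0%R -> E i f <= a) ->
  \sum_(i <- r) (w i)%:E * E i f <= a.
Proof.
move=> w0 w1 a0 Efa; rewrite -[leRHS]mul1e -w1 -sumEFin ge0_sume_distrl => [|i _]; last first.
  by rewrite lee_fin.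
apply: lee_sum => i _; have [->|wi] := eqVneq (w i) 0%R; first by rewrite !mul0e.
by rewrite lee_wpmul2l ?lee_fin // Efa.
Qed.

Lemma esum_expectation {T : choiceType} (m : T -> R) :
  (forall x, (0 <= m x)%R) -> \esum_(x in setT) (m x)%:E = 1 ->
  expectation_on setT (fun f => \esum_(x in setT) ((m x)%:E * f x)).
Proof.
move=> m0 m1; split.
- by move=> f g fg; apply: le_esum => x _; rewrite lee_wpmul2l ?lee_fin // fg.
- move=> f g f0 g0; rewrite -esumD => [|x _|x _].
  + by apply: eq_esum => x _; rewrite ge0_muleDr ?f0 ?g0.
  + by rewrite mule_ge0 ?lee_fin ?f0.
  + by rewrite mule_ge0 ?lee_fin ?g0.
- move=> r f r0 f0; rewrite -esumZl //.
  + by apply: eq_esum => x _; rewrite muleCA.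
  + by move=> x; rewrite mule_ge0 ?lee_fin ?f0.
- by rewrite -[RHS]m1; apply: eq_esum => x _; rewrite mule1.
Qed.

End Expectation.

(** * Countable sums over products, laws on the natural numbers and independent arrivals *)

Lemma esum_finType (R : realType) (I : finType) (a : I -> \bar R) :
  (forall i, 0 <= a i)%E -> (\esum_(i in setT) a i = \sum_i a i)%E.
Proof.
move=> a0; transitivity (\esum_(i in setT) \sum_j (if i \in [set j] then a i else 0))%E.
  apply: eq_esum => i _; rewrite (bigD1 i) //= mem_set // big1 ?adde0 // => j ji.
  by case: ifPn => // /set_mem /= ij; rewrite ij eqxx in ji.
rewrite esum_sum => [|i j _ _]; last by case: ifP.
by apply: eq_bigr => j _; rewrite -esum_mkcond esum_set1.
Qed.

Lemma nneseries_cvg (R : realType) (u : nat -> R) (s : R) : (forall n, 0 <= u n) ->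
  (\sum_(0 <= n <oo) (u n)%:E = s%:E)%E ->
  (fun m => \sum_(n < m) u n) @ \oo --> s.
Proof.
move=> u0 us.
have : (fun m => \sum_(0 <= n < m) (u n)%:E)%E @ \oo --> s%:E.
  by rewrite -us; apply: is_cvg_nneseries => n _ _; rewrite lee_fin.
move/fine_cvg; apply: cvg_trans; apply: near_eq_cvg; apply: nearW => m /=.
by rewrite sumEFin big_mkord.
Qed.

(** On the box of functions with values below [m] this is finite distributivity. Every finite set of
    functions lies in a box, which gives one inequality; the other follows as [m] tends to
    infinity. *)
Lemma esum_ffun_prod (R : realType) (K : finType) (F : K -> nat -> R) (s : K -> R) :
  (forall k n, 0 <= F k n) ->
  (forall k, \sum_(0 <= n <oo) (F k n)%:E = (s k)%:E)%E ->
  (\esum_(A in [set: {ffun K -> nat}]) (\prod_k F k (A k))%:E = (\prod_k s k)%:E)%E.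
Proof.
move=> F0 Fs.
pose G (A : {ffun K -> nat}) := (\prod_k F k (A k))%:E : \bar R.
have G0 A : (0 <= G A)%E by rewrite lee_fin prodr_ge0.
pose emb m (a : {ffun K -> 'I_m}) : {ffun K -> nat} := [ffun k => a k : nat].
have box m : (\esum_(A in range (@emb m)) G A = (\prod_k \sum_(n < m) F k n)%:E)%E.
  rewrite (esum_image setT) => [|a b _ _ ab]; last first.
    apply/ffunP => k; apply: val_inj.
    by move/ffunP: ab => /(_ k); rewrite !ffunE.
  rewrite esum_finType // bigA_distr_bigA /= -sumEFin; apply: eq_bigr => a _.
  by rewrite /G; congr EFin; apply: eq_bigr => k _; rewrite ffunE.
have Fle k m : \sum_(n < m) F k n <= s k.
  rewrite -lee_fin -Fs -sumEFin.
  have := @nneseries_lim_ge R (fun n => (F k n)%:E) xpredT 0%N m; rewrite big_mkord.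
  by apply => n _ _; rewrite lee_fin.
apply/eqP; rewrite eq_le; apply/andP; split.
  apply: ge_ereal_sup => _ [X [finX _]] <-.
  have [m Xm] : exists m, X `<=` range (@emb m).
    exists (\max_(A <- fset_set X) \max_k A k).+1 => A XA.
    have Am k : (A k < (\max_(A <- fset_set X) \max_k A k).+1)%N.
      rewrite ltnS; apply: (@leq_trans (\max_k A k)).
        exact: (@leq_bigmax _ (fun k => A k)).
      apply: (@leq_bigmax_seq _ _ xpredT (fun A : {ffun K -> nat} => \max_k A k)) => //.
      by rewrite in_fset_set // mem_set.
    by exists [ffun k => Ordinal (Am k)] => //; apply/ffunP => k; rewrite !ffunE.
  rewrite -esum_fset // => [|A _]; last exact: G0.
  apply: (@le_trans _ _ (\esum_(A in range (@emb m)) G A)%E).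
    rewrite esum_mkcond [leRHS]esum_mkcond; apply: le_esum => A _.
    case: ifPn => [/set_mem /Xm Am|_]; first by rewrite mem_set.
    by case: ifP => // _; exact: G0.
  rewrite box lee_fin; apply: ler_prod => k _; rewrite Fle andbT.
  by apply: sumr_ge0.
have low m : ((\prod_k \sum_(n < m) F k n)%:E <= \esum_(A in setT) G A)%E.
  rewrite -box esum_mkcond; apply: le_esum => A _.
  by case: ifP => // _; exact: G0.
have [->|] := eqVneq (\esum_(A in setT) G A)%E +oo%E; first by rewrite leey.
have e0 : (0 <= \esum_(A in setT) G A)%E by apply: esum_ge0.
move=> efin; have eE : (\esum_(A in setT) G A = (fine (\esum_(A in setT) G A))%:E)%E.
  by rewrite fineK // ge0_fin_numE // ltey.
rewrite -/G eE lee_fin.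
have cv : (fun m => \prod_k \sum_(n < m) F k n) @ \oo --> \prod_k s k.
  apply: cvg_big => [|k _]; last exact: nneseries_cvg.
  by move=> x; exact: mul_continuous.
apply: (cvgr_to_le cv); apply: nearW => m.
by rewrite -lee_fin -eE.
Qed.

Section NatProbability.
Context {R : realType}.
Implicit Types (mu : probability nat R) (f : nat -> R).

Definition mass mu (n : nat) : R := fine (mu [set n]).

Lemma mass_ge0 mu n : 0 <= mass mu n.
Proof. exact: fine_ge0. Qed.

Lemma massE mu n : (mass mu n)%:E = mu [set n].
Proof. by rewrite fineK // fin_num_measure. Qed.

Lemma integral_nat mu f : (forall n, 0 <= f n) ->
  (\int[mu]_n (f n)%:E = \sum_(0 <= n <oo) (f n * mass mu n)%:E)%E.
Proof.
move=> f0; have -> : [set: nat] = \bigcup_k [set k].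
  by apply/seteqP; split => // n _; exists n.
rewrite ge0_integral_bigcup //=; last 2 first.
  by move=> n _; rewrite lee_fin.
  by move=> i j _ _ [x [-> ->]].
apply: eq_eseriesr => n _; rewrite EFinM massE.
rewrite (eq_integral (fun=> (f n)%:E)) => [|m /set_mem /= ->] //.
by rewrite integral_cst.
Qed.

Lemma sum_mass mu : (\sum_(0 <= n <oo) (mass mu n)%:E = 1)%E.
Proof.
have := @integral_nat mu (fun=> 1) (fun=> ler01).
rewrite integral_cst // mul1e (_ : _ [set: nat] = 1%E) => [->|]; last exact: probability_setT.
by apply: eq_eseriesr => n _; rewrite mul1r.
Qed.

(** Splits an arrival variable into a part bounded by [L], to which second moments apply, and a tail
    of mean at most [tau]. *)
Lemma truncated_mean mu (a tau : R) : 0 < tau ->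
  (\int[mu]_n (n%:R)%:E = a%:E)%E ->
  exists (L : nat) (b : R), [/\ 0 <= b, a - tau <= b <= a, b <= L%:R,
    (\sum_(0 <= n <oo) ((minn n L)%:R * mass mu n)%:E = b%:E)%E &
    (\sum_(0 <= n <oo) ((n - L)%N%:R * mass mu n)%:E = (a - b)%:E)%E].
Proof.
move=> tau0; rewrite integral_nat // => mean.
have nm0 (m : nat -> nat) n : 0 <= (m n)%:R * mass mu n by rewrite mulr_ge0 ?mass_ge0.
have cv := nneseries_cvg (nm0 id) mean.
have [L _ HL] : \forall m \near \oo, a - tau <= \sum_(n < m) n%:R * mass mu n.
  by apply: (cvgr_ge _ cv); rewrite ltrBlDr ltrDl.
have := HL L (leqnn L) => {}HL.
have min0 n : (0 <= ((minn n L)%:R * mass mu n)%:E)%E by rewrite lee_fin (nm0 (minn^~ L)).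
have sub0 n : (0 <= ((n - L)%N%:R * mass mu n)%:E)%E by rewrite lee_fin (nm0 (subn^~ L)).
set B := (\sum_(0 <= n <oo) ((minn n L)%:R * mass mu n)%:E)%E.
set D := (\sum_(0 <= n <oo) ((n - L)%N%:R * mass mu n)%:E)%E.
have B0 : (0 <= B)%E by apply: nneseries_ge0.
have D0 : (0 <= D)%E by apply: nneseries_ge0.
have BD : (B + D = a%:E)%E.
  rewrite -mean -nneseriesD //.
  apply: eq_eseriesr => n _; rewrite -EFinD -mulrDl -natrD; congr (_ * _)%:E.
  by congr (_%:R); lia.
have BL : (B <= L%:R%:E)%E.
  have -> : (L%:R%:E = L%:R%:E * \sum_(0 <= n <oo) (mass mu n)%:E :> \bar R)%E.
    by rewrite sum_mass mule1.
  rewrite -nneseriesZl; last by move=> n _; rewrite lee_fin mass_ge0.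
  apply: lee_nneseries => // n _.
  by rewrite -EFinM lee_fin ler_wpM2r ?mass_ge0 // ler_nat geq_minr.
have Bfin : B \is a fin_num by rewrite ge0_fin_numE //; apply: le_lt_trans BL (ltry _).
have BE : B = (fine B)%:E by rewrite fineK.
have DE : D = (a - fine B)%:E by rewrite EFinB -BD BE addeAC subee ?add0e.
exists L, (fine B); split => //.
- exact: fine_ge0.
- apply/andP; split; last by rewrite -subr_ge0 -lee_fin -DE.
  apply: (le_trans HL); rewrite -lee_fin -BE -sumEFin.
  have := @nneseries_lim_ge R (fun n => ((minn n L)%:R * mass mu n)%:E) xpredT 0%N L.
  rewrite big_mkord => H; apply: le_trans (H _) => //.
  by apply: lee_sum => n _; rewrite (minn_idPl _) // ltnW.
- by rewrite -lee_fin -BE.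
Qed.

End NatProbability.

Section Arrivals.
Context {R : realType} {J K : finType}.
Variable N : network R J K.
Local Open Scope ereal_scope.

Definition arrival_expect (f : {ffun K -> nat} -> \bar R) : \bar R :=
  \esum_(A in [set: {ffun K -> nat}]) (\prod_k arrival_law N k [set A k] * f A).

Lemma arrival_weightE (A : {ffun K -> nat}) :
  \prod_k arrival_law N k [set A k] = (\prod_k mass (arrival_law N k) (A k))%:E.
Proof.
by rewrite -prodEFin; apply: eq_bigr => k _; rewrite massE.
Qed.

Lemma arrival_expectation : expectation_on setT arrival_expect.
Proof.
rewrite /arrival_expect (_ : (fun f => _) = fun f => \esum_(A in [set: {ffun K -> nat}])
    ((\prod_k mass (arrival_law N k) (A k))%:E * f A)); last first.
  by apply/funext => f; apply: eq_esum => A _; rewrite arrival_weightE.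
apply: esum_expectation => [A|]; first by apply: prodr_ge0 => k _; exact: mass_ge0.
have := @esum_ffun_prod R K (fun k n => mass (arrival_law N k) n) (fun=> 1%R)
  (fun k n => mass_ge0 _ n) (fun k => sum_mass _).
by rewrite big1.
Qed.

Lemma arrival_expect_marginal k (phi : nat -> R) (s : R) : (forall n, 0 <= phi n)%R ->
  \sum_(0 <= n <oo) (phi n * mass (arrival_law N k) n)%:E = s%:E ->
  arrival_expect (fun A => (phi (A k))%:E) = s%:E.
Proof.
move=> phi0 Es.
(* Absorbing [phi] into the factor of class [k] keeps the product form, so independence reduces to a
   product of one-dimensional sums. *)
pose F l n := (if l == k then phi n * mass (arrival_law N l) n
  else mass (arrival_law N l) n)%R.
pose S l := if l == k then s else 1%R.
transitivity (\esum_(A in [set: {ffun K -> nat}]) (\prod_l F l (A l))%:E).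
  apply: eq_esum => A _; rewrite arrival_weightE -EFinM; congr EFin.
  rewrite (bigD1 k) //= [RHS](bigD1 k) //= {1}/F eqxx mulrAC (mulrC (mass _ _)).
  congr (_ * _)%R; apply: eq_bigr => l lk; by rewrite /F (negbTE lk).
rewrite (@esum_ffun_prod R K F S) => [|l n|l].
- by rewrite (bigD1 k) //= big1 /S ?eqxx ?mulr1 // => l lk; rewrite (negbTE lk).
- by rewrite /F; case: ifP => _; rewrite ?mulr_ge0 ?mass_ge0.
- rewrite /F /S; case: eqVneq => [->//|_]; exact: sum_mass.
Qed.

End Arrivals.

(** * One step and finite paths of the network *)

Lemma sum_option (V : nmodType) (I : finType) (F : option I -> V) :
  \sum_e F e = F None + \sum_i F (Some i).
Proof.
rewrite [LHS](bigD1 None) //=; congr (_ + _).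
rewrite (reindex_omap Some id) /= => [|[i|] //].
by apply: eq_bigl => i; rewrite eqxx.
Qed.

Lemma sum_ffun_prod_additive (R : comPzRingType) (U O : finType) (P phi : U -> O -> R) :
  (forall u, \sum_e P u e = 1) ->
  \sum_(o : {ffun U -> O}) (\prod_u P u (o u)) * \sum_u phi u (o u)
  = \sum_u \sum_e P u e * phi u e.
Proof.
move=> P1; under eq_bigr do rewrite mulr_sumr.
rewrite exchange_big /=; apply: eq_bigr => u _.
(* The summand of [u] is absorbed into the factor of [u]; the other factors sum to 1. *)
pose P' w e := if w == u then P u e * phi u e else P w e.
transitivity (\sum_(o : {ffun U -> O}) \prod_w P' w (o w)).
  apply: eq_bigr => o _; rewrite (bigD1 u) //= [RHS](bigD1 u) //= {1}/P' eqxx mulrAC.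
  by congr (_ * _); apply: eq_bigr => w wu; rewrite /P' (negbTE wu).
rewrite -bigA_distr_bigA (bigD1 u) //= [X in _ * X]big1 ?mulr1.
  by apply: eq_bigr => e _; rewrite /P' eqxx.
by move=> w wu; rewrite -[RHS](P1 w); apply: eq_bigr => e _; rewrite /P' (negbTE wu).
Qed.

Section Service.
Context {R : realType} {J K : finType}.
Variable N : network R J K.
Local Notation state := {ffun K -> nat}.
Local Notation schedule := {ffun J -> nat}.
Local Notation outcome x s c := {ffun used_unit N x s c -> option (option K)}.

Lemma unit_probability_ge0 k e : 0 <= unit_probability N k e.
Proof.
have /andP[p0 p1] := completion_itv N k.
case: e => [[k'|]|] /=; last by rewrite subr_ge0.
  by rewrite mulr_ge0 ?routing_ge0 // ltW.
by rewrite mulr_ge0 ?(ltW p0) // subr_ge0 routing_le1.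
Qed.

Lemma unit_probability_sum k : \sum_e unit_probability N k e = 1.
Proof. by rewrite !sum_option /= -mulr_sumr -mulrDr subrK mulr1 subrK. Qed.

Definition used_work (x : state) (s : schedule) (c : {ffun J -> K}) : state :=
  [ffun k => minn (assigned_work N s c k) (x k)].

Lemma sum_used_unit (x : state) s c (G : K -> R) :
  \sum_(u : used_unit N x s c) G (tag u) = \sum_k (used_work x s c k)%:R * G k.
Proof.
rewrite /used_unit.
rewrite -(sig_big_dep xpredT (fun k => @predT 'I_(minn (assigned_work N s c k) (x k)))
  (fun k _ => G k)).
by apply: eq_bigr => k _; rewrite sumr_const card_ord ffunE mulr_natl.
Qed.

Definition served_state (x : state) s c (o : outcome x s c) : state :=
  [ffun k => x k - #|[pred u | (tag u == k) && (o u != None)]|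
             + #|[pred u | o u == Some (Some k)]|]%N.

Lemma next_stateE (x : state) s c (o : outcome x s c) (A : state) :
  next_state o A = [ffun k => (served_state o k + A k)%N].
Proof. by apply/ffunP => k; rewrite !ffunE. Qed.

Definition net_transfer (x : state) s c (o : outcome x s c) k : R :=
  \sum_(u : used_unit N x s c)
     ((o u == Some (Some k))%:R - ((tag u == k) && (o u != None))%:R).

Lemma served_state_sub (x : state) s c (o : outcome x s c) k :
  (served_state o k)%:R - (x k)%:R = net_transfer o k.
Proof.
have cardE (P : pred (used_unit N x s c)) : (#|P|)%:R = \sum_u (P u)%:R :> R.
  rewrite -sum1_card natr_sum big_mkcond /=.
  by apply: eq_bigr => u _; rewrite unfold_in; case: (P u).
(* At most [x k] units serve class [k], so the truncated subtraction of naturals is exact. *)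
have le : (#|[pred u | (tag u == k) && (o u != None)]| <= x k)%N.
  rewrite -(ler_nat R) cardE.
  apply: (@le_trans _ _ (\sum_(u : used_unit N x s c) (tag u == k)%:R)).
    by apply: ler_sum => u _ /=; rewrite ler_nat; case: (tag u == k); case: (o u != None).
  rewrite (sum_used_unit x s c (fun l => (l == k)%:R)) (bigD1 k) //= eqxx mulr1 big1 ?addr0.
    by rewrite ffunE ler_nat geq_minr.
  by move=> l lk; rewrite (negbTE lk) mulr0.
rewrite ffunE natrD natrB // /net_transfer sumrB -!cardE /=.
by ring.
Qed.

Definition mean_transfer (D : K -> R) k : R :=
  \sum_k' D k' * (completion N k' * routing N k' k) - D k * completion N k.

Definition service_expect (x : state) s c (f : outcome x s c -> \bar R) : \bar R :=
  (\sum_(o : outcome x s c) (\prod_u unit_probability N (tag u) (o u))%:E * f o)%E.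

Lemma service_weight_ge0 (x : state) s c (o : outcome x s c) :
  0 <= \prod_u unit_probability N (tag u) (o u).
Proof. by apply: prodr_ge0 => u _; exact: unit_probability_ge0. Qed.

Lemma service_weight_sum (x : state) s c :
  \sum_(o : outcome x s c) \prod_u unit_probability N (tag u) (o u) = 1.
Proof.
rewrite -(bigA_distr_bigA (fun (u : used_unit N x s c) e => unit_probability N (tag u) e)).
by rewrite big1 // => u _; exact: unit_probability_sum.
Qed.

Lemma service_mean (x : state) s c k :
  \sum_(o : outcome x s c) (\prod_u unit_probability N (tag u) (o u)) * net_transfer o k
  = mean_transfer (fun l => (used_work x s c l)%:R) k.
Proof.
rewrite /net_transfer (@sum_ffun_prod_additive _ _ _
  (fun (u : used_unit N x s c) e => unit_probability N (tag u) e)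
  (fun u e => (e == Some (Some k))%:R - ((tag u == k) && (e != None))%:R)); last first.
  by move=> u; exact: unit_probability_sum.
rewrite (sum_used_unit x s c (fun l => \sum_e unit_probability N l e *
  ((e == Some (Some k))%:R - ((l == k) && (e != None))%:R))).
rewrite /mean_transfer.
have H l : \sum_e unit_probability N l e *
    ((e == Some (Some k))%:R - ((l == k) && (e != None))%:R)
  = completion N l * routing N l k - (l == k)%:R * completion N l.
  under eq_bigr do rewrite mulrBr.
  rewrite sumrB; congr (_ - _).
    rewrite !sum_option /= !mulr0 !add0r (bigD1 k) //= eqxx mulr1 big1 ?addr0 //.
    move=> i ik; rewrite (_ : (_ == _) = false) ?mulr0 //.
    by apply/eqP => -[/eqP]; rewrite (negbTE ik).
  rewrite !sum_option /= andbF mulr0 add0r !andbT.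
  by rewrite -mulr_suml -mulr_sumr -mulrDl -mulrDr subrK mulr1 mulrC.
under eq_bigr do rewrite H mulrBr.
rewrite sumrB; congr (_ - _).
rewrite (bigD1 k) //= eqxx mul1r big1 ?addr0 // => l lk.
by rewrite (negbTE lk) mul0r mulr0.
Qed.

End Service.

Section Dynamics.
Context {R : realType} {J K : finType}.
Variable N : network R J K.
Local Notation state := {ffun K -> nat}.
Local Notation schedule := {ffun J -> nat}.
Local Notation outcome x s c := {ffun used_unit N x s c -> option (option K)}.
Variable pol : state -> schedule -> {ffun J -> K} -> R.
Hypothesis pol_ge0 : forall x s c, 0 <= pol x s c.
Hypothesis pol_sum : forall x, \sum_(s <- schedules N) \sum_c pol x s c = 1.

(* A time step: the work devoted to each class, the state once the served jobs
   have been routed, and the external arrivals. *)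
Definition step : Type := state * state * state.

Definition next (w : step) : state := [ffun k => (w.1.2 k + w.2 k)%N].

(** The support is carried along with the expectation, so that pathwise inequalities may use the
    rules of the policy and the form of the outcomes. *)
Definition step_ok (x : state) : set step := [set w | exists s c,
  pol x s c != 0 /\ exists o : outcome x s c, w.1 = (used_work N x s c, served_state o)].

Definition local_expect (x : state) s c (f : step -> \bar R) : \bar R :=
  service_expect (fun o : outcome x s c =>
    arrival_expect N (fun A => f (used_work N x s c, served_state o, A))).

Definition step_expect (x : state) (f : step -> \bar R) : \bar R :=
  (\sum_(s <- schedules N) \sum_c (pol x s c)%:E * local_expect x s c f)%E.

Lemma local_expectation (x : state) s c : pol x s c != 0 ->
  expectation_on (step_ok x) (local_expect x s c).
Proof.
move=> polx; apply: mix_expectation => [w| |w _].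
- exact: service_weight_ge0.
- exact: service_weight_sum.
- apply: (map_expectation (phi := fun A => (used_work N x s c, served_state w, A))
    (arrival_expectation N)) => A _.
  by exists s, c; split => //; exists w.
Qed.

Lemma step_expectE (x : state) f :
  (step_expect x f = \sum_(i <- [seq (s, c) | s <- schedules N, c <- index_enum {ffun J -> K}])
    (pol x i.1 i.2)%:E * local_expect x i.1 i.2 f)%E.
Proof. by rewrite big_allpairs. Qed.

Lemma pol_pair_sum (x : state) :
  \sum_(i <- [seq (s, c) | s <- schedules N, c <- index_enum {ffun J -> K}]) pol x i.1 i.2 = 1.
Proof. by rewrite big_allpairs pol_sum. Qed.

Lemma step_expectation (x : state) : expectation_on (step_ok x) (step_expect x).
Proof.
rewrite (_ : step_expect x = fun f =>
  (\sum_(i <- [seq (s, c) | s <- schedules N, c <- index_enum {ffun J -> K}])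
    (pol x i.1 i.2)%:E * local_expect x i.1 i.2 f)%E); last first.
  by apply/funext => f; exact: step_expectE.
apply: mix_expectation => [i| |i poli]; first exact: pol_ge0.
  exact: pol_pair_sum.
exact: local_expectation.
Qed.

Lemma step_expect_le (x : state) f (a : \bar R) : (0 <= a)%E ->
  (forall s c, pol x s c != 0 -> (local_expect x s c f <= a)%E) -> (step_expect x f <= a)%E.
Proof.
move=> a0 fa; rewrite step_expectE.
apply: (mix_expectation_le (E := fun i => local_expect x i.1 i.2)) => // [|i].
- exact: pol_pair_sum.
- exact: fa.
Qed.

Lemma transition_ge0 x y : (0 <= transition N pol x y)%E.
Proof.
rewrite /transition; apply: sume_ge0 => s _; apply: sume_ge0 => c _.
rewrite mule_ge0 ?lee_fin ?pol_ge0 //; apply: sume_ge0 => o _.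
rewrite mule_ge0 ?lee_fin ?service_weight_ge0 //; apply: esum_ge0 => A _.
by rewrite arrival_weightE lee_fin prodr_ge0 // => k _; exact: mass_ge0.
Qed.

Lemma transition_expect (x : state) (h : state -> R) : (forall y, 0 <= h y) ->
  (\esum_(y in setT) (transition N pol x y * (h y)%:E)
    = step_expect x (fun w => (h (next w))%:E))%E.
Proof.
move=> h0.
pose l (A : state) : \bar R := (\prod_k arrival_law N k [set A k])%E.
have l0 A : (0 <= l A)%E.
  by rewrite /l arrival_weightE lee_fin prodr_ge0 // => k _; exact: mass_ge0.
(* For fixed outcomes of service, summing over the target [y] merely regroups the arrivals by the
   state they lead to. *)
have fiber s c (o : outcome x s c) :
   (\esum_(y in setT) ((\esum_(A in [set A | next_state o A = y]) l A) * (h y)%:E)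
   = arrival_expect N (fun A => (h (next (used_work N x s c, served_state o, A)))%:E))%E.
  transitivity (\esum_(y in [set: state]) \esum_(A in [set: state])
      (if y \in [set next_state o A] then l A * (h y)%:E else 0))%E.
    apply: eq_esum => y _; rewrite muleC -esumZl // esum_mkcond; apply: eq_esum => A _.
    rewrite muleC; congr (if _ then _ else _).
    by apply/idP/idP => /set_mem /= e; apply/mem_set; rewrite e.
  rewrite esum_exchange => [|y A]; last by case: ifP => // _; rewrite mule_ge0 ?lee_fin.
  apply: eq_esum => A _; rewrite -esum_mkcond esum_set1 ?mule_ge0 ?lee_fin //.
  by rewrite /l next_stateE.
transitivity (\esum_(y in [set: state]) \sum_(s <- schedules N) \sum_c
   \sum_(o : outcome x s c) (pol x s c * \prod_u unit_probability N (tag u) (o u))%:E *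
     ((\esum_(A in [set A | next_state o A = y]) l A) * (h y)%:E))%E.
  apply: eq_esum => y _.
  have e0 s c (o : outcome x s c) : (0 <= \esum_(A in [set A | next_state o A = y]) l A)%E.
    by apply: esum_ge0.
  have so0 s c : (0 <= \sum_(o : outcome x s c) (\prod_u unit_probability N (tag u) (o u))%:E *
      \esum_(A in [set A | next_state o A = y]) l A)%E.
    by apply: sume_ge0 => o _; rewrite mule_ge0 ?lee_fin ?service_weight_ge0.
  rewrite /transition ge0_sume_distrl => [|s _]; last first.
    by apply: sume_ge0 => c _; rewrite mule_ge0 ?lee_fin ?pol_ge0.
  apply: eq_bigr => s _; rewrite ge0_sume_distrl => [|c _]; last first.
    by rewrite mule_ge0 ?lee_fin ?pol_ge0.
  apply: eq_bigr => c _; rewrite -muleA ge0_sume_distrl => [|o _]; last first.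
    by rewrite mule_ge0 ?lee_fin ?service_weight_ge0.
  rewrite ge0_sume_distrr => [|o _]; last first.
    by rewrite !mule_ge0 ?lee_fin ?service_weight_ge0.
  by apply: eq_bigr => o _; rewrite EFinM !muleA.
have t0 s c (o : outcome x s c) y :
    (0 <= (pol x s c * \prod_u unit_probability N (tag u) (o u))%:E *
     ((\esum_(A in [set A | next_state o A = y]) l A) * (h y)%:E))%E.
  rewrite !mule_ge0 ?lee_fin ?mulr_ge0 ?pol_ge0 ?service_weight_ge0 //.
  by apply: esum_ge0.
rewrite esum_sum => [|y s _ _]; last by apply: sume_ge0 => c _; apply: sume_ge0.
apply: eq_bigr => s _; rewrite esum_sum => [|y c _ _]; last by apply: sume_ge0.
apply: eq_bigr => c _; rewrite esum_sum // ge0_sume_distrr => [|o _]; last first.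
  rewrite mule_ge0 ?lee_fin ?service_weight_ge0 // (expect_ge0 (arrival_expectation N)) //.
  by move=> A _; rewrite lee_fin.
apply: eq_bigr => o _; rewrite muleA -EFinM -fiber esumZl //.
  by rewrite mulr_ge0 ?pol_ge0 ?service_weight_ge0.
by move=> y; rewrite mule_ge0 ?lee_fin //; apply: esum_ge0.
Qed.

Lemma transition_sum x : (\esum_(y in setT) transition N pol x y = 1)%E.
Proof.
rewrite -(expect1 (step_expectation x)) -(transition_expect x (h := fun=> 1)) //.
by apply: eq_esum => y _; rewrite mule1.
Qed.

Fixpoint path_expect (n : nat) (x : state) (f : seq step -> \bar R) : \bar R :=
  if n is m.+1
  then step_expect x (fun w => path_expect m (next w) (fun p => f (w :: p)))
  else f [::].

Fixpoint path_ok (x : state) (p : seq step) : Prop :=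
  if p is w :: q then step_ok x w /\ path_ok (next w) q else True.

Fixpoint state_at (x : state) (p : seq step) (t : nat) : state :=
  if t is u.+1 then if p is w :: q then state_at (next w) q u else x else x.

Lemma state_at0 x p : state_at x p 0 = x.
Proof. by case: p. Qed.

Lemma path_expectation n x :
  expectation_on [set p | size p = n /\ path_ok x p] (path_expect n x).
Proof.
elim: n x => [|n IH] x.
  split => //.
  by move=> f g fg; apply: fg.
apply: (map_expectation (phi := fun wp => wp.1 :: wp.2)
  (bind_expectation (step_expectation x) (fun w => IH (next w)))).
by move=> [w p] /= [ww [sp pp]]; rewrite sp.
Qed.

(** Read beyond the end of a path: no work is used there, so bounds on the service vector hold at
    all times. *)
Definition no_step : step := ([ffun=> 0%N], [ffun=> 0%N], [ffun=> 0%N]).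

Lemma path_ok_nth x p : path_ok x p -> forall i, (i < size p)%N ->
  step_ok (state_at x p i) (nth no_step p i) /\
  state_at x p i.+1 = next (nth no_step p i).
Proof.
elim: p x => [|w p IH] x //= [ww pp] [|i] /=; first by rewrite state_at0.
by rewrite ltnS => /(IH _ pp).
Qed.

Definition chain_expect (h : state -> \bar R) (x : state) : \bar R :=
  step_expect x (fun w => h (next w)).

Lemma path_expect_state_at (h : state -> R) n t x : (forall y, 0 <= h y) -> (t <= n)%N ->
  path_expect n x (fun p => (h (state_at x p t))%:E)
  = iter t chain_expect (fun y => (h y)%:E) x.
Proof.
move=> h0; elim: t n x => [|t IH] n x.
  move=> _; rewrite /= -(expect_cst (path_expectation n x) (h0 x)).
  by apply: (eq_expect (path_expectation n x)) => p _; rewrite state_at0.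
case: n => // n; rewrite ltnS => tn /=.
by apply: (eq_expect (step_expectation x)) => w _; rewrite IH.
Qed.

Definition walk (xi : state -> step -> R) (x : state) (p : seq step) (t : nat) : R :=
  \sum_(i < t) xi (state_at x p i) (nth no_step p i).

Lemma walkS xi x w p t : walk xi x (w :: p) t.+1 = xi x w + walk xi (next w) p t.
Proof. by rewrite /walk big_ord_recl. Qed.

(** The hypothesis for every [z] expresses that the increments are orthogonal to the past, so second
    moments add up. In the induction [z] collects the increments already made. *)
Lemma path_expect_walk_sqr (xi : state -> step -> R) (C : R) : 0 <= C ->
  (forall x z, step_expect x (fun w => ((z + xi x w) ^+ 2)%:E) <= (z ^+ 2 + C)%:E)%E ->
  forall n t x z, (t <= n)%N ->
  (path_expect n x (fun p => ((z + walk xi x p t) ^+ 2)%:E) <= (z ^+ 2 + t%:R * C)%:E)%E.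
Proof.
move=> C0 xiC n t x z; elim: t n x z => [|t IH] n x z.
  move=> _; rewrite mul0r addr0 -(expect_cst (path_expectation n x)) ?sqr_ge0 //.
  by apply: (le_expect (path_expectation n x)) => p _; rewrite /walk big_ord0 addr0.
case: n => // n; rewrite ltnS => tn /=.
apply: (@le_trans _ _ (step_expect x (fun w => ((z + xi x w) ^+ 2)%:E + (t%:R * C)%:E)))%E.
  apply: (le_expect (step_expectation x)) => w _; apply: le_trans (IH _ _ _ tn).
  by apply: (le_expect (path_expectation _ _)) => p _; rewrite walkS addrA.
rewrite (expectD (step_expectation x)) => [|w _|w _]; last 2 first.
- by rewrite lee_fin sqr_ge0.
- by rewrite lee_fin mulr_ge0.
rewrite (expect_cst (step_expectation x)) ?mulr_ge0 //.
apply: le_trans (leeD2r _ (xiC x z)) _; rewrite -EFinD lee_fin -natr1.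
by rewrite mulrDl mul1r -!addrA lerD2l addrC.
Qed.

Lemma path_expect_walk_mean (xi : state -> step -> R) (c : R) : 0 <= c ->
  (forall x w, 0 <= xi x w) ->
  (forall x, step_expect x (fun w => (xi x w)%:E) <= c%:E)%E ->
  forall n t x, (t <= n)%N ->
  (path_expect n x (fun p => (walk xi x p t)%:E) <= (t%:R * c)%:E)%E.
Proof.
move=> c0 xi0 xic n t x; elim: t n x => [|t IH] n x.
  move=> _; rewrite mul0r -(expect_cst (path_expectation n x)) //.
  by apply: (le_expect (path_expectation n x)) => p _; rewrite /walk big_ord0.
have w0 y p m : 0 <= walk xi y p m by apply: sumr_ge0.
case: n => // n; rewrite ltnS => tn /=.
apply: (@le_trans _ _ (step_expect x (fun w => (xi x w)%:E + (t%:R * c)%:E)))%E.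
  apply: (le_expect (step_expectation x)) => w _.
  apply: le_trans (leeD2l _ (IH n (next w) tn)).
  rewrite -(expect_cst (path_expectation n (next w)) (xi0 x w)).
  rewrite -(expectD (path_expectation n (next w))) => [|p _|p _]; rewrite ?lee_fin //.
  by apply: (le_expect (path_expectation _ _)) => p _; rewrite walkS.
rewrite (expectD (step_expectation x)) => [|w _|w _]; last 2 first.
- by rewrite lee_fin.
- by rewrite lee_fin mulr_ge0.
rewrite (expect_cst (step_expectation x)) ?mulr_ge0 //.
apply: le_trans (leeD2r _ (xic x)) _; rewrite -EFinD lee_fin -natr1.
by rewrite mulrDl mul1r addrC.
Qed.

End Dynamics.

(** * Weak law of large numbers for the noise *)

Section Noise.
Context {R : realType} {J K : finType}.
Variable N : network R J K.
Local Notation state := {ffun K -> nat}.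
Local Notation schedule := {ffun J -> nat}.
Local Notation outcome x s c := {ffun used_unit N x s c -> option (option K)}.
Variable pol : state -> schedule -> {ffun J -> K} -> R.
Hypothesis pol_ge0 : forall x s c, 0 <= pol x s c.
Hypothesis pol_sum : forall x, \sum_(s <- schedules N) \sum_c pol x s c = 1.
Hypothesis pol_schedule : forall x s c, pol x s c != 0 -> s \in schedules N.

Definition max_service : nat := \max_(s <- schedules N) \max_j s j.

Lemma schedule_le_max_service (s : schedule) j : s \in schedules N ->
  (s j <= max_service)%N.
Proof.
move=> sN; apply: (@leq_trans (\max_i s i)); first exact: (@leq_bigmax _ (fun i => s i)).
exact: (@leq_bigmax_seq _ _ xpredT (fun s : schedule => \max_i s i)).
Qed.

Lemma used_work_le (x : state) s c k : s \in schedules N ->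
  (used_work N x s c k <= max_service)%N.
Proof.
move=> sN; rewrite ffunE (leq_trans (geq_minl _ _)) // /assigned_work.
by case: ifP => // _; exact: schedule_le_max_service.
Qed.

Definition transfer_noise (k : K) (x : state) (w : step (K := K)) : R :=
  (w.1.2 k)%:R - (x k)%:R - mean_transfer N (fun l => (w.1.1 l)%:R) k.

Definition truncated_noise (k : K) (L : nat) (b : R) (x : state) (w : step (K := K)) : R :=
  (minn (w.2 k) L)%:R - b.

Definition arrival_tail (k : K) (L : nat) (x : state) (w : step (K := K)) : R :=
  (w.2 k - L)%N%:R.

Definition noise (k : K) (x : state) (w : step (K := K)) : R :=
  (next w k)%:R - (x k)%:R - mean_transfer N (fun l => (w.1.1 l)%:R) k - arrival_mean N k.

(** A net transfer is at most [#|K|] times [max_service], and its mean at most [#|K| + 1] times. *)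
Let Ct : R := (2 * #|K| + 1)%:R * max_service%:R.

Lemma mean_transfer_bound (D : state) k : (forall l, (D l <= max_service)%N) ->
  `|mean_transfer N (fun l => (D l)%:R) k| <= (#|K| + 1)%:R * max_service%:R.
Proof.
move=> Dle; have D1 l : (D l)%:R <= max_service%:R :> R by rewrite ler_nat.
have p01 l : 0 <= completion N l <= 1.
  by have /andP[/ltW -> ->] := completion_itv N l.
have r1 l : routing N l k <= 1.
  apply: le_trans (routing_le1 N l); rewrite (bigD1 k) //= lerDl.
  by apply: sumr_ge0 => i _; exact: routing_ge0.
apply: (le_trans (ler_normB _ _)); rewrite natrD mulrDl mul1r; apply: lerD; last first.
  have /andP[p0 p1] := p01 k.
  by rewrite ger0_norm ?mulr_ge0 // -[leRHS]mulr1 ler_pM.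
apply: (le_trans (ler_norm_sum _ _ _)).
apply: (@le_trans _ _ (\sum_(l : K) max_service%:R)); last first.
  by rewrite sumr_const mulr_natl.
apply: ler_sum => l _; have /andP[p0 p1] := p01 l.
rewrite ger0_norm ?mulr_ge0 ?routing_ge0 // -[leRHS]mulr1.
apply: ler_pM; rewrite ?mulr_ge0 ?routing_ge0 //.
by rewrite -[leRHS]mulr1 ler_pM ?routing_ge0.
Qed.

Lemma net_transfer_bound (x : state) s c (oc : outcome x s c) k : s \in schedules N ->
  `|net_transfer oc k| <= #|K|%:R * max_service%:R.
Proof.
move=> sN; apply: (le_trans (ler_norm_sum _ _ _)).
apply: (@le_trans _ _ (\sum_(u : used_unit N x s c) 1)).
  apply: ler_sum => u _; rewrite ler_norml.
  by case: (oc u == _); case: ((tag u == k) && _); apply/andP; split; rewrite /=; lra.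
rewrite (sum_used_unit N x s c (fun=> 1)).
apply: (@le_trans _ _ (\sum_(l : K) max_service%:R)); last first.
  by rewrite sumr_const mulr_natl.
by apply: ler_sum => l _; rewrite mulr1 ler_nat used_work_le.
Qed.

Lemma transfer_noise_bound k x w : step_ok N pol x w -> `|transfer_noise k x w| <= Ct.
Proof.
move=> [s [c [/pol_schedule sN [oc E]]]]; rewrite /transfer_noise E /=.
rewrite served_state_sub /Ct.
have -> : (2 * #|K| + 1)%:R * max_service%:R
    = #|K|%:R * max_service%:R + (#|K| + 1)%:R * max_service%:R :> R.
  by rewrite -mulrDl -natrD; congr (_%:R * _); lia.
apply: (le_trans (ler_normB _ _)); apply: lerD; first exact: net_transfer_bound.
by apply: mean_transfer_bound => l; exact: used_work_le.
Qed.

Let Ct_ge0 : 0 <= Ct. Proof. by rewrite mulr_ge0. Qed.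

Lemma service_expectation (x : state) s c :
  expectation_on setT (service_expect (N := N) (x := x) (s := s) (c := c)).
Proof.
apply: mix_expectation => [u| |u _]; [exact: service_weight_ge0|exact: service_weight_sum|].
by split => // f g; exact.
Qed.

Lemma transfer_noise_mean k (x : state) s c : pol x s c != 0 ->
  (local_expect N x s c (fun w => (transfer_noise k x w + Ct)%:E) = Ct%:E)%E.
Proof.
move=> polx; rewrite /local_expect.
transitivity (service_expect (fun u : outcome x s c =>
   (net_transfer u k - mean_transfer N (fun l => (used_work N x s c l)%:R) k + Ct)%:E)).
  apply: (eq_expect (service_expectation x s c)) => u _.
  rewrite /transfer_noise /= served_state_sub.
  rewrite (expect_cst (arrival_expectation N)) //.
  have := @transfer_noise_bound k x (used_work N x s c, served_state u, [ffun=> 0%N]).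
  rewrite /transfer_noise /= served_state_sub ler_norml => H.
  have /H/andP[] : step_ok N pol x (used_work N x s c, served_state u, [ffun=> 0%N]).
    by exists s, c; split => //; exists u.
  by rewrite -subr_ge0 opprK.
rewrite /service_expect; under eq_bigr do rewrite -EFinM.
rewrite sumEFin; congr EFin; under eq_bigr do rewrite mulrDr mulrBr.
rewrite !big_split /= sumrN -!mulr_suml service_weight_sum service_mean !mul1r.
by rewrite subrr add0r.
Qed.

Lemma transfer_noise_sqr k x z :
  (step_expect N pol x (fun w => ((z + transfer_noise k x w) ^+ 2)%:E)
   <= (z ^+ 2 + Ct ^+ 2)%:E)%E.
Proof.
apply: step_expect_le => // [|s c polx]; first by rewrite lee_fin addr_ge0 ?sqr_ge0.
apply: (expect_sqr_le (local_expectation N polx) (xi := transfer_noise k x)) => //.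
  by move=> w; exact: transfer_noise_bound.
exact: transfer_noise_mean.
Qed.

Lemma local_expect_arrival k (x : state) s c (phi : nat -> R) (r : R) :
  (forall n, 0 <= phi n) ->
  (\sum_(0 <= n <oo) (phi n * mass (arrival_law N k) n)%:E = r%:E)%E ->
  (local_expect N x s c (fun w => (phi (w.2 k))%:E) = r%:E)%E.
Proof.
move=> phi0 Er; have r0 : 0 <= r.
  rewrite -lee_fin -Er; apply: nneseries_ge0 => n _ _.
  by rewrite lee_fin mulr_ge0 ?mass_ge0.
rewrite -[RHS](expect_cst (service_expectation x s c) r0).
apply: (eq_expect (service_expectation x s c)) => u _ /=.
exact: (arrival_expect_marginal phi0 Er).
Qed.

Lemma truncated_noise_sqr k (L : nat) (b : R) x z : 0 <= b -> b <= L%:R ->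
  (\sum_(0 <= n <oo) ((minn n L)%:R * mass (arrival_law N k) n)%:E = b%:E)%E ->
  (step_expect N pol x (fun w => ((z + truncated_noise k L b x w) ^+ 2)%:E)
   <= (z ^+ 2 + L%:R ^+ 2)%:E)%E.
Proof.
move=> b0 bL Eb.
apply: step_expect_le => // [|s c polx]; first by rewrite lee_fin addr_ge0 ?sqr_ge0.
apply: (expect_sqr_le (local_expectation N polx) (xi := truncated_noise k L b x)) => // [w _|].
  have m0 : 0 <= (minn (w.2 k) L)%:R :> R by [].
  have mL : (minn (w.2 k) L)%:R <= L%:R :> R by rewrite ler_nat geq_minr.
  by rewrite ler_norml /truncated_noise; apply/andP; split; lra.
rewrite /truncated_noise.
apply: (local_expect_arrival x s c (k := k) (phi := fun n => (minn n L)%:R - b + L%:R)) => [n|].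
  by rewrite -addrA addr_ge0 // addrC subr_ge0.
transitivity (\sum_(0 <= n <oo) (((minn n L)%:R * mass (arrival_law N k) n)%:E
   + (L%:R - b)%:E * (mass (arrival_law N k) n)%:E))%E.
  by apply: eq_eseriesr => n _; rewrite -EFinM -EFinD -mulrDl -addrA [- b + _]addrC.
rewrite nneseriesD => [|n _ _|n _ _]; last 2 first.
- by rewrite lee_fin mulr_ge0 ?mass_ge0.
- by rewrite -EFinM lee_fin mulr_ge0 ?mass_ge0 // subr_ge0.
rewrite Eb nneseriesZl => [|n _]; last by rewrite lee_fin mass_ge0.
by rewrite sum_mass mule1 -EFinD addrC subrK.
Qed.

(** The noise is the sum of a bounded centred part from service, a bounded centred part from
    truncated arrivals, and the arrival tail, less the mean removed by truncation. The first two
    have second moments linear in [t]; the last two are at most [eta / 4] per time step in mean. *)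
Lemma noise_bound_class (k : K) (eta : R) : 0 < eta ->
  exists2 M : R, 0 <= M & forall n t x, (t <= n)%N ->
    (path_expect N pol n x (fun p => `|walk (noise k) x p t|%:E) <= (eta * t%:R + M)%:E)%E.
Proof.
move=> eta0; have eta4 : 0 < eta / 4 by rewrite divr_gt0.
have [L [b [b0 /andP[ab ba] bL Emin Etail]]] := truncated_mean eta4 (arrival_meanE N k).
pose Q := Ct ^+ 2 + L%:R ^+ 2 + 1.
have Q0 : 0 < Q by rewrite ltr_wpDl // addr_ge0 ?sqr_ge0.
(* Chosen so that [th] times the second moment bound [Q * t] is [eta / 4 * t]; the summand 1 in [Q]
   keeps it positive. *)
pose th := eta / 4 / Q; have th0 : 0 < th by rewrite divr_gt0.
exists (2 / th) => [|n t x tn]; first by rewrite divr_ge0 // ltW.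
have PE := path_expectation pol_ge0 pol_sum n x.
pose wS p := walk (transfer_noise k) x p t.
pose wB p := walk (truncated_noise k L b) x p t.
pose wT p := walk (arrival_tail k L) x p t.
have wT0 p : 0 <= wT p by apply: sumr_ge0.
have split p : walk (noise k) x p t = wS p + wB p + wT p - t%:R * (arrival_mean N k - b).
  rewrite /wS /wB /wT /walk -!big_split /= mulr_natl -[t in _ *+ t]card_ord -sumr_const -sumrB.
  apply: eq_bigr => i _; rewrite /noise /transfer_noise /truncated_noise /arrival_tail.
  set w := nth _ _ _; rewrite ffunE natrD.
  have -> : (w.2 k)%:R = (minn (w.2 k) L)%:R + (w.2 k - L)%N%:R :> R.
    by rewrite -natrD; congr (_%:R); lia.
  by ring.
(* Trades an absolute value for a small multiple of the square, at the price of a constant that does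
   not depend on [t]. *)
have young (y : R) : `|y| <= th * y ^+ 2 + th^-1.
  have -> : y ^+ 2 = `|y| ^+ 2 by rewrite real_normK ?num_real.
  have ti : 0 < th^-1 by rewrite invr_gt0.
  have : 0 <= th^-1 * (th * `|y| - 2^-1) ^+ 2 by rewrite mulr_ge0 ?sqr_ge0 // ltW.
  have -> : th^-1 * (th * `|y| - 2^-1) ^+ 2 = th * `|y| ^+ 2 - `|y| + th^-1 / 4.
    by field; rewrite gt_eqF.
  lra.
have pointwise p : `|walk (noise k) x p t| <=
   th * wS p ^+ 2 + (th * wB p ^+ 2 + (wT p + (2 / th + t%:R * (eta / 4)))).
  rewrite split; have := young (wS p); have := young (wB p).
  have tb : t%:R * (arrival_mean N k - b) <= t%:R * (eta / 4) by rewrite ler_wpM2l //; lra.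
  have tb0 : 0 <= t%:R * (arrival_mean N k - b) by rewrite mulr_ge0 // subr_ge0.
  move: (t%:R * _) tb tb0 => tab tb tb0 yB yS.
  apply: (le_trans (ler_normB _ _)); rewrite (ger0_norm tb0).
  have := ler_normD (wS p + wB p) (wT p); have := ler_normD (wS p) (wB p).
  by rewrite (ger0_norm (wT0 p)); lra.
apply: (le_trans (le_expect PE (g := fun p => (th%:E * (wS p ^+ 2)%:E +
   (th%:E * (wB p ^+ 2)%:E + ((wT p)%:E + (2 / th + t%:R * (eta / 4))%:E)))%E) _)).
  by move=> p _; rewrite -!EFinM -!EFinD lee_fin.
have c0 : 0 <= 2 / th + t%:R * (eta / 4).
  by rewrite addr_ge0 ?mulr_ge0 ?invr_ge0 // ltW.
have th0' := ltW th0.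
have s0 (y : R) : (0 <= th%:E * (y ^+ 2)%:E)%E by rewrite -EFinM lee_fin mulr_ge0 ?sqr_ge0.
have s1 (y : R) : (0 <= (y ^+ 2)%:E)%E by rewrite lee_fin sqr_ge0.
have s2 p : (0 <= (wT p)%:E)%E by rewrite lee_fin.
have s3 : (0 <= (2 / th + t%:R * (eta / 4))%:E)%E by rewrite lee_fin.
rewrite (expectD PE) => [|//|p _]; last by rewrite !adde_ge0.
rewrite (expectD PE) => [|//|p _]; last by rewrite !adde_ge0.
rewrite (expectD PE) // !(expectZ PE) // (expect_cst PE c0).
have ES : (path_expect N pol n x (fun p => (wS p ^+ 2)%:E) <= (t%:R * Ct ^+ 2)%:E)%E.
  have := path_expect_walk_sqr pol_ge0 pol_sum (sqr_ge0 Ct) (transfer_noise_sqr k) x 0 tn.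
  rewrite expr0n /= add0r; apply: le_trans.
  by apply: (le_expect PE) => p _; rewrite add0r.
have EB : (path_expect N pol n x (fun p => (wB p ^+ 2)%:E) <= (t%:R * L%:R ^+ 2)%:E)%E.
  have := path_expect_walk_sqr pol_ge0 pol_sum (sqr_ge0 L%:R)
    (fun x z => truncated_noise_sqr x z b0 bL Emin) x 0 tn.
  rewrite expr0n /= add0r; apply: le_trans.
  by apply: (le_expect PE) => p _; rewrite add0r.
have ET : (path_expect N pol n x (fun p => (wT p)%:E) <= (t%:R * (eta / 4))%:E)%E.
  apply: (path_expect_walk_mean pol_ge0 pol_sum) => //.
  - exact: ltW.
  - move=> y; apply: step_expect_le => // [|s c _]; first by rewrite lee_fin ltW.
    rewrite (local_expect_arrival y s c (k := k) (phi := fun m => (m - L)%N%:R) _ Etail) // lee_fin.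
    lra.
apply: (@le_trans _ _ (th%:E * (t%:R * Ct ^+ 2)%:E + (th%:E * (t%:R * L%:R ^+ 2)%:E +
   ((t%:R * (eta / 4))%:E + (2 / th + t%:R * (eta / 4))%:E))))%E.
  apply: leeD; first by rewrite lee_wpmul2l ?lee_fin.
  apply: leeD; first by rewrite lee_wpmul2l ?lee_fin.
  exact: leeD.
rewrite -!EFinM -!EFinD lee_fin.
have : t%:R * (th * Q) = t%:R * (eta / 4) by rewrite /th divfK ?gt_eqF.
have t0 : 0 <= t%:R * th by rewrite mulr_ge0.
have te : 0 <= t%:R * eta by rewrite mulr_ge0 // ltW.
by rewrite /Q => E; lra.
Qed.

Lemma noise_bound (eta : R) : 0 < eta ->
  exists2 M : R, 0 <= M & forall k n t x, (t <= n)%N ->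
    (path_expect N pol n x (fun p => `|walk (noise k) x p t|%:E) <= (eta * t%:R + M)%:E)%E.
Proof.
move=> eta0.
have /fin_all_exists2[M M0 HM] : forall k, exists2 M : R, 0 <= M &
    forall n t x, (t <= n)%N ->
    (path_expect N pol n x (fun p => `|walk (noise k) x p t|%:E) <= (eta * t%:R + M)%:E)%E.
  by move=> k; exact: noise_bound_class.
exists (\sum_k M k); first exact: sumr_ge0.
move=> k n t x tn; apply: (le_trans (HM k n t x tn)); rewrite lee_fin lerD2l.
by rewrite (bigD1 k) //= lerDl sumr_ge0.
Qed.

End Noise.

(** * Drift form and capacity region *)

(** Cauchy-Schwarz, by Lagrange's identity. *)
Lemma ler_sqr_sum (R : realDomainType) (I : finType) (u : I -> R) :
  (\sum_i u i) ^+ 2 <= #|I|%:R * \sum_i u i ^+ 2.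
Proof.
have : 0 <= \sum_i \sum_j (u i - u j) ^+ 2.
  by apply: sumr_ge0 => i _; apply: sumr_ge0 => j _; exact: sqr_ge0.
have -> : \sum_i \sum_j (u i - u j) ^+ 2
    = (#|I|%:R * \sum_i u i ^+ 2 - (\sum_i u i) ^+ 2) *+ 2.
  have E i j : (u i - u j) ^+ 2 = u i ^+ 2 + u j ^+ 2 - 2 * (u i * u j) by ring.
  under eq_bigr do under eq_bigr do rewrite E.
  under eq_bigr do rewrite sumrB big_split /= sumr_const -mulr_sumr -mulr_sumr.
  rewrite sumrB big_split /= sumr_const -mulr_sumr -mulr_suml -sumrMnl.
  rewrite -[\sum_i (_ *+ _)]/(\sum_(i : I) (u i ^+ 2 *+ #|I|)) sumrMnl.
  rewrite -[_ *+ #|I|]mulr_natl; ring.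
by rewrite pmulrn_lge0 // subr_ge0.
Qed.

(** Jensen's inequality for weights of mass at most 1, such as a row of the routing matrix: expand
    the weighted squares around [m]. *)
Lemma sqr_wsum_le (R : realDomainType) (I : finType) (w u : I -> R) :
  (forall i, 0 <= w i) -> \sum_i w i <= 1 ->
  (\sum_i w i * u i) ^+ 2 <= \sum_i w i * u i ^+ 2.
Proof.
move=> w0 w1; set m := \sum_i w i * u i.
have : 0 <= \sum_i w i * (u i - m) ^+ 2.
  by apply: sumr_ge0 => i _; rewrite mulr_ge0 ?sqr_ge0.
have -> : \sum_i w i * (u i - m) ^+ 2
    = \sum_i w i * u i ^+ 2 - 2 * m ^+ 2 + m ^+ 2 * \sum_i w i.
  have E i : w i * (u i - m) ^+ 2 = w i * u i ^+ 2 - 2 * m * (w i * u i) + m ^+ 2 * w i.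
    by ring.
  under eq_bigr do rewrite E.
  by rewrite big_split sumrB /= -!mulr_sumr -/m; ring.
have : m ^+ 2 * \sum_i w i <= m ^+ 2 * 1 by rewrite ler_wpM2l ?sqr_ge0.
lra.
Qed.

Section Traffic.
Context {R : realType} {J K : finType}.
Variable N : network R J K.
Variable lambda : K -> R.
Hypothesis traffic : traffic_equations N lambda.
Hypothesis nu_gt0 : forall k, 0 < class_intensity N lambda k.

Local Notation nu := (class_intensity N lambda).

Lemma intensityK k : nu k * completion N k = lambda k.
Proof.
have /andP[p0 _] := completion_itv N k.
by rewrite /class_intensity divfK // gt_eqF.
Qed.

Lemma lambda_gt0 k : 0 < lambda k.
Proof. by have /andP[p0 _] := completion_itv N k; rewrite -intensityK mulr_gt0. Qed.

Lemma arrival_mean_ge0 k : 0 <= arrival_mean N k.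
Proof. by rewrite -lee_fin -arrival_meanE; apply: integral_ge0 => n _; rewrite lee_fin. Qed.

(** If the work used is [nu * (1 + u)], the part due to [nu] cancels the arrivals by
    [arrival_mean_transfer]; what is left is the mean increment of the state, paired with [w]. *)
Definition drift_form (u w : {ffun K -> R^o}) : R :=
  \sum_k mean_transfer N (fun l => nu l * u l) k * w k.

Lemma mean_transfer_intensity (u : K -> R) k : mean_transfer N (fun l => nu l * u l) k
  = \sum_l lambda l * routing N l k * u l - lambda k * u k.
Proof.
rewrite /mean_transfer; congr (_ - _); last by rewrite mulrAC intensityK.
by apply: eq_bigr => l _; rewrite -(intensityK l); ring.
Qed.

Lemma arrival_mean_transfer k : arrival_mean N k = - mean_transfer N nu k.
Proof.
have := mean_transfer_intensity (fun=> 1) k.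
under eq_bigr do rewrite mulr1.
rewrite mulr1 => E; rewrite (_ : mean_transfer N nu k = \sum_l lambda l * routing N l k - lambda k).
  by have := traffic k; lra.
by rewrite -E /mean_transfer mulr1; under [in RHS]eq_bigr do rewrite mulr1.
Qed.

Lemma drift_formDl (u v w : {ffun K -> R^o}) :
  drift_form (u + v) w = drift_form u w + drift_form v w.
Proof.
rewrite /drift_form -big_split /=; apply: eq_bigr => k _; rewrite -mulrDl; congr (_ * _).
rewrite !mean_transfer_intensity ffunE mulrDr opprD addrACA -big_split /=; congr (_ + _).
by apply: eq_bigr => l _; rewrite ffunE mulrDr.
Qed.

Lemma drift_formDr (u v w : {ffun K -> R^o}) :
  drift_form w (u + v) = drift_form w u + drift_form w v.
Proof.
by rewrite /drift_form -big_split /=; apply: eq_bigr => k _; rewrite ffunE mulrDr.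
Qed.

Lemma drift_formZl (a : R) (u w : {ffun K -> R^o}) : drift_form (a *: u) w = a * drift_form u w.
Proof.
rewrite /drift_form mulr_sumr; apply: eq_bigr => k _; rewrite mulrA; congr (_ * _).
rewrite !mean_transfer_intensity ffunE mulrBr mulr_sumr /=; congr (_ - _).
  by apply: eq_bigr => l _; rewrite ffunE mulrCA.
by rewrite mulrCA.
Qed.

Lemma drift_formZr (a : R) (u w : {ffun K -> R^o}) : drift_form w (a *: u) = a * drift_form w u.
Proof.
rewrite /drift_form mulr_sumr; apply: eq_bigr => k _; rewrite ffunE /=.
by rewrite mulrCA.
Qed.

Lemma drift_form0l w : drift_form 0 w = 0.
Proof. by have := drift_formZl 0 0 w; rewrite scale0r mul0r. Qed.

Definition norm1 (u : {ffun K -> R^o}) : R := \sum_k `|u k|.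

Definition dot (u w : {ffun K -> R^o}) : R := \sum_k u k * w k.

Lemma norm1_ge0 u : 0 <= norm1 u. Proof. exact: sumr_ge0. Qed.

Lemma norm1D (u v : {ffun K -> R^o}) : norm1 (u + v) <= norm1 u + norm1 v.
Proof. by rewrite /norm1 -big_split; apply: ler_sum => k _; rewrite ffunE ler_normD. Qed.

Lemma norm1_0 : norm1 0 = 0.
Proof. by rewrite /norm1 big1 // => k _; rewrite ffunE normr0. Qed.

Lemma le_norm1 (u : {ffun K -> R^o}) k : `|u k| <= norm1 u.
Proof. by rewrite /norm1 (bigD1 k) //= lerDl sumr_ge0. Qed.

Lemma dotDl (u v w : {ffun K -> R^o}) : dot (u + v) w = dot u w + dot v w.
Proof. by rewrite /dot -big_split; apply: eq_bigr => k _; rewrite ffunE mulrDl. Qed.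

Lemma dotZl (a : R) (u w : {ffun K -> R^o}) : dot (a *: u) w = a * dot u w.
Proof. by rewrite /dot mulr_sumr; apply: eq_bigr => k _; rewrite ffunE mulrA. Qed.

Lemma dotC u w : dot u w = dot w u.
Proof. by apply: eq_bigr => k _; rewrite mulrC. Qed.

Lemma dot_ge0 u : 0 <= dot u u.
Proof. by apply: sumr_ge0 => k _; rewrite -expr2 sqr_ge0. Qed.

(** The successor keeps the constant positive when there are no classes. *)
Lemma norm1_dot u : norm1 u ^+ 2 <= #|K|.+1%:R * dot u u.
Proof.
apply: (le_trans (ler_sqr_sum _)).
have -> : \sum_k `|u k| ^+ 2 = dot u u.
  by apply: eq_bigr => k _; rewrite real_normK ?num_real // expr2.
by rewrite ler_wpM2r ?dot_ge0 // ler_nat.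
Qed.

Lemma dot_norm1 u : dot u u <= norm1 u ^+ 2.
Proof.
rewrite expr2 {1}/norm1 mulr_suml; apply: ler_sum => k _.
by rewrite -expr2 -real_normK ?num_real // expr2 ler_wpM2l // le_norm1.
Qed.

Lemma drift_form_bound : exists2 C : R, 0 < C & forall u w,
  drift_form u w <= C * norm1 u * norm1 w.
Proof.
pose L := \sum_k lambda k.
have L0 : 0 <= L by apply: sumr_ge0 => k _; exact/ltW/lambda_gt0.
have lL k : lambda k <= L.
  by rewrite /L (bigD1 k) //= lerDl sumr_ge0 // => l _; exact/ltW/lambda_gt0.
exists (2 * L + 1) => [|u w]; first by rewrite ltr_wpDl // mulr_ge0.
have mt k : `|mean_transfer N (fun l => nu l * u l) k| <= (2 * L + 1) * norm1 u.
  rewrite mean_transfer_intensity; apply: (le_trans (ler_normB _ _)).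
  have H1 : `|\sum_l lambda l * routing N l k * u l| <= L * norm1 u.
    apply: (le_trans (ler_norm_sum _ _ _)); rewrite /norm1 mulr_sumr; apply: ler_sum => l _.
    have l0 := ltW (lambda_gt0 l).
    rewrite !normrM (ger0_norm l0) (ger0_norm (routing_ge0 _ _ _)).
    rewrite ler_wpM2r // -[leRHS]mulr1 ler_pM // ?routing_ge0 //.
    apply: le_trans (routing_le1 N l); rewrite (bigD1 k) //= lerDl.
    by apply: sumr_ge0 => i _; exact: routing_ge0.
  have H2 : `|lambda k * u k| <= L * norm1 u.
    rewrite normrM ger0_norm ?(ltW (lambda_gt0 k)) //.
    by rewrite ler_pM ?(ltW (lambda_gt0 k)) // le_norm1.
  by have := norm1_ge0 u; lra.
apply: (@le_trans _ _ (\sum_k (2 * L + 1) * norm1 u * `|w k|)); last by rewrite -mulr_sumr.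
apply: ler_sum => k _; apply: (le_trans (ler_norm _)); rewrite normrM.
by rewrite ler_wpM2r.
Qed.

(* [lambda] is a subinvariant measure of the routing chain, hence the drift form
   is dominated by minus the energy of [(I - P) u]; as the network is open,
   [u] is controlled by [(I - P) u]. *)
Lemma drift_form_negative : exists2 c : R, 0 < c & forall u,
  drift_form u u <= - c * norm1 u ^+ 2.
Proof.
pose z (u : {ffun K -> R^o}) (l : K) : R := u l - \sum_k routing N l k * u k.
pose S u := \sum_l lambda l * z u l ^+ 2.
have S0 u : 0 <= S u.
  by apply: sumr_ge0 => l _; rewrite mulr_ge0 ?sqr_ge0 // ltW // lambda_gt0.
have energy u : 2 * drift_form u u <= - S u.
  pose Pu l := \sum_k routing N l k * u k.
  have -> : drift_form u u = \sum_l lambda l * (u l * Pu l) - \sum_k lambda k * u k ^+ 2.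
    rewrite /drift_form; under eq_bigr do rewrite mean_transfer_intensity mulrBl mulr_suml.
    rewrite sumrB exchange_big /=; congr (_ - _); apply: eq_bigr => k _; last first.
      by rewrite expr2 mulrA.
    by rewrite /Pu !mulr_sumr; apply: eq_bigr => l _; ring.
  have -> : S u = \sum_l lambda l * u l ^+ 2 - 2 * (\sum_l lambda l * (u l * Pu l))
      + \sum_l lambda l * Pu l ^+ 2.
    rewrite mulr_sumr -sumrB -big_split /=; apply: eq_bigr => l _.
    by rewrite /z -/(Pu l); ring.
  (* Jensen along each routing row, then the traffic equations with nonnegative external
     arrivals. *)
  have : \sum_l lambda l * Pu l ^+ 2 <= \sum_k lambda k * u k ^+ 2.
    apply: (@le_trans _ _ (\sum_l lambda l * \sum_k routing N l k * u k ^+ 2)).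
      apply: ler_sum => l _; rewrite ler_wpM2l //; first exact/ltW/lambda_gt0.
      by apply: sqr_wsum_le; [exact: routing_ge0|exact: routing_le1].
    under eq_bigr do rewrite mulr_sumr.
    rewrite exchange_big /=; apply: ler_sum => k _.
    under eq_bigr do rewrite mulrA.
    rewrite -mulr_suml ler_wpM2r ?sqr_ge0 // [leRHS]traffic lerDr.
    exact: arrival_mean_ge0.
  lra.
pose A := (1%:M - \matrix_(i < #|K|, j < #|K|) routing N (enum_val i) (enum_val j)) : 'M[R]_#|K|.
pose M : R := \sum_i \sum_j `|invmx A i j|.
have uz (u : {ffun K -> R^o}) k : `|u k| <= M * \sum_l `|z u l|.
  pose U : 'cV[R]_#|K| := \col_i u (enum_val i).
  pose Z : 'cV[R]_#|K| := \col_i z u (enum_val i).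
  have AU : A *m U = Z.
    rewrite mulmxBl mul1mx; apply/matrixP => i j; rewrite !mxE /z; congr (_ - _).
    rewrite [RHS](reindex (enum_val : 'I_#|K| -> K)) /=; last first.
      by apply: onW_bij; exact: enum_val_bij.
    by apply: eq_bigr => m _; rewrite !mxE.
  have UE : U = invmx A *m Z by rewrite -AU mulKmx // network_open.
  have -> : u k = U (enum_rank k) 0 by rewrite mxE enum_rankK.
  rewrite UE mxE; apply: (le_trans (ler_norm_sum _ _ _)).
  apply: (@le_trans _ _ (\sum_j M * `|Z j 0|)).
    apply: ler_sum => j _; rewrite normrM ler_wpM2r // /M.
    rewrite (bigD1 (enum_rank k)) //= (bigD1 j) //= -addrA lerDl.
    by rewrite addr_ge0 ?sumr_ge0 // => i _; apply: sumr_ge0.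
  rewrite -mulr_sumr ler_wpM2l //; first by apply: sumr_ge0 => i _; apply: sumr_ge0.
  rewrite [leRHS](reindex (enum_val : 'I_#|K| -> K)) /=; last first.
    by apply: onW_bij; exact: enum_val_bij.
  by apply: ler_sum => j _; rewrite mxE.
pose L : R := \sum_l (lambda l)^-1.
have L0 : 0 <= L by apply: sumr_ge0 => l _; rewrite invr_ge0 ltW // lambda_gt0.
have zS u : (\sum_l `|z u l|) ^+ 2 <= #|K|%:R * (L * S u).
  apply: (le_trans (ler_sqr_sum _)); rewrite ler_wpM2l //.
  rewrite /L mulr_suml; apply: ler_sum => l _.
  rewrite real_normK ?num_real // ler_pdivlMl ?lambda_gt0 // /S (bigD1 l) //= lerDl.
  by apply: sumr_ge0 => i _; rewrite mulr_ge0 ?sqr_ge0 // ltW // lambda_gt0.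
pose C : R := (#|K|%:R * M) ^+ 2 * #|K|%:R * L.
have C0 : 0 <= C by rewrite mulr_ge0 // mulr_ge0 // sqr_ge0.
have nS u : norm1 u ^+ 2 <= C * S u.
  have M0 : 0 <= M by apply: sumr_ge0 => i _; apply: sumr_ge0.
  have n1 : norm1 u <= #|K|%:R * M * \sum_l `|z u l|.
    apply: (@le_trans _ _ (\sum_(k : K) M * \sum_l `|z u l|)).
      by apply: ler_sum => k _; exact: uz.
    by rewrite sumr_const -[_ *+ _]mulr_natl mulrA.
  apply: (@le_trans _ _ ((#|K|%:R * M * \sum_l `|z u l|) ^+ 2)).
    by rewrite lerXn2r ?nnegrE ?norm1_ge0 // !mulr_ge0 // sumr_ge0.
  by rewrite exprMn /C -!mulrA !ler_wpM2l ?sqr_ge0 // !mulrA -mulrA; exact: zS.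
exists (2 * (C + 1))^-1 => [|u].
  by rewrite invr_gt0 mulr_gt0 // ltr_wpDl.
have C1 : 0 < C + 1 by rewrite ltr_wpDl.
have C2 : 0 < 2 * (C + 1) by rewrite mulr_gt0.
rewrite -(ler_pM2l C2) mulrA mulrN mulfV ?gt_eqF // mulN1r.
have E1 := ler_wpM2l (ltW C1) (energy u); have E2 := nS u; have E3 := S0 u.
by rewrite mulrAC in E1 *; rewrite mulrA in E1; lra.
Qed.

(** As [rho] is interior, the ray through it stays in the hull a little beyond [rho]. A half-space
    containing all schedules is convex, hence contains the hull and that further point. *)
Lemma capacity_slack : capacity_region N (queue_intensity N lambda) ->
  exists2 delta : R, 0 < delta & forall (w : J -> R) (M : R), (forall j, 0 <= w j) ->
    (forall s, s \in schedules N -> \sum_j w j * (s j)%:R <= M) ->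
    (1 + delta) * \sum_j w j * queue_intensity N lambda j <= M.
Proof.
set rho := queue_intensity N lambda.
rewrite /capacity_region /interior /= => hull.
pose F (r : R) : {ptws J -> R} := fun j => r * rho j.
have cF : F r @[r --> (1 : R)] --> (rho : {ptws J -> R}).
  have FF : Filter (F r @[r --> (1 : R)]) by exact: fmap_filter.
  rewrite cvg_sup => j.
  rewrite cvg_image; last by rewrite eqEsubset; split=> v // _; exists (cst v).
  have cj : r * rho j @[r --> (1 : R)] --> rho j.
    by rewrite -[X in _ --> X]mul1r; apply: cvgM; [exact: cvg_id|exact: cvg_cst].
  move=> B /= /cj HB; exists (@^~ j @^-1` B) => //.
  by rewrite eqEsubset; split => [y [? + <-//]|y By]; exists (fun=> y).
have /nbhs_ballP[e /= e0 He] := cF _ hull.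
have := He (1 + e / 2); rewrite /ball /= opprD addrA subrr sub0r normrN.
rewrite gtr0_norm ?divr_gt0 // ltr_pdivrMr // ltr_pMr // ltr1n => /(_ isT) hullF.
exists (e / 2) => [|w M w0 HM]; first by rewrite divr_gt0.
pose H : set {ptws J -> R} := [set y | \sum_j w j * y j <= M].
have : H (F (1 + e / 2)).
  apply: (smallest_sub _ _ hullF) => [|_ [s sN] <-]; last exact: HM.
  move=> x y t /set_mem Hx /set_mem Hy; apply/mem_set; rewrite /H /=.
  have -> : \sum_j w j * (conv t x y : {ptws J -> R}) j
     = t%:num * (\sum_j w j * x j) + (1 - t%:num) * (\sum_j w j * y j).
    rewrite !mulr_sumr -big_split /=; apply: eq_bigr => j _.
    rewrite -[(conv t x y : {ptws J -> R}) j]/(t%:num * x j + (1 - t%:num) * y j); ring.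
  have t0 : 0 <= t%:num by [].
  have t1 : 0 <= 1 - t%:num by rewrite subr_ge0.
  have := ler_wpM2l t0 Hx; have := ler_wpM2l t1 Hy; rewrite /H /=; lra.
rewrite /H /= /F; apply: le_trans; rewrite mulr_sumr.
by apply: ler_sum => j _; rewrite mulrCA.
Qed.

End Traffic.

(** * Lyapunov function *)

Section Lyapunov.
Context {R : realType} {J K : finType}.
Variable N : network R J K.
Variable lambda : K -> R.
Hypothesis traffic : traffic_equations N lambda.
Hypothesis nu_gt0 : forall k, 0 < class_intensity N lambda k.
Local Notation nu := (class_intensity N lambda).
Local Notation state := {ffun K -> nat}.
Local Notation schedule := {ffun J -> nat}.
Variable delta : R.
Hypothesis delta_gt0 : 0 < delta.
Hypothesis slack : forall (w : J -> R) (M : R), (forall j, 0 <= w j) ->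
  (forall s, s \in schedules N -> \sum_j w j * (s j)%:R <= M) ->
  (1 + delta) * \sum_j w j * queue_intensity N lambda j <= M.

Definition max_weight (x : state) : R :=
  \big[Num.max/0]_(s <- schedules N) schedule_weight N nu x s.

Definition population (x : state) : R := \sum_k (x k)%:R.

(* The largest rate at which a feasible schedule, compared with [nu], can reduce
   the weighted queue lengths. *)
Definition lyapunov (x : state) : R := max_weight x - population x.

Lemma population_ge0 x : 0 <= population x. Proof. exact: sumr_ge0. Qed.

Lemma ratio_ge0 (x : state) k : 0 <= (x k)%:R / nu k.
Proof. by rewrite divr_ge0 // ltW. Qed.

Lemma queue_weight_ge0 (x : state) j : 0 <= queue_weight N nu x j.
Proof. exact: bigmax_ge_id. Qed.

Lemma le_queue_weight (x : state) k : (x k)%:R / nu k <= queue_weight N nu x (queue_of N k).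
Proof. by apply: (@le_bigmax_cond _ _ _ _ k _ (fun l => (x l)%:R / nu l)). Qed.

Lemma schedule_weight_ge0 (x : state) s : 0 <= schedule_weight N nu x s.
Proof. by apply: sumr_ge0 => j _; rewrite mulr_ge0 ?queue_weight_ge0. Qed.

Lemma schedule_weight_le (x : state) s : s \in schedules N ->
  schedule_weight N nu x s <= max_weight x.
Proof. by move=> sN; apply: le_bigmax_seq. Qed.

Lemma maxweight_scheduleE (x : state) s : maxweight_schedule N nu x s ->
  schedule_weight N nu x s = max_weight x.
Proof.
move=> [sN smax]; apply/eqP; rewrite eq_le schedule_weight_le //=.
rewrite /max_weight big_seq; apply: bigmax_le => [|s' /smax //].
exact: schedule_weight_ge0.
Qed.

(** Since [x k <= queue_weight * nu k] at the queue of [k], the population is at most the queue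
    weights paired with [rho], and the slack of [rho] leaves [delta] times this amount. *)
Lemma lyapunov_lower x : delta * population x <= lyapunov x.
Proof.
have := slack (queue_weight_ge0 x) (fun s => @schedule_weight_le x s).
have : population x <= \sum_j queue_weight N nu x j * queue_intensity N lambda j.
  rewrite /queue_intensity /population.
  rewrite (partition_big (queue_of N) xpredT) //=; apply: ler_sum => j _.
  rewrite mulr_sumr; apply: ler_sum => k /eqP <-.
  by rewrite -ler_pdivrMr ?le_queue_weight.
rewrite /lyapunov; set S := \sum_j _; set P := population x => PS.
have := ler_wpM2l (ltW delta_gt0) PS; lra.
Qed.

Lemma lyapunov_upper : exists2 C : R, 0 <= C & forall x, lyapunov x <= C * population x.
Proof.
pose Q := \sum_k (nu k)^-1.
have Q0 : 0 <= Q by apply: sumr_ge0 => k _; rewrite invr_ge0 ltW.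
have qw (x : state) j : queue_weight N nu x j <= Q * population x.
  apply: bigmax_le => [|k _]; first by rewrite mulr_ge0 ?population_ge0.
  rewrite mulrC; apply: ler_pM => //; first by rewrite invr_ge0 ltW.
    by rewrite /Q (bigD1 k) //= lerDl; apply: sumr_ge0 => l _; rewrite invr_ge0 ltW.
  by rewrite /population (bigD1 k) //= lerDl sumr_ge0.
pose S : R := #|J|%:R * (max_service N)%:R.
exists (S * Q) => [|x]; first by rewrite !mulr_ge0.
have : max_weight x <= S * Q * population x.
  rewrite /max_weight big_seq; apply: bigmax_le => [|s sN].
    by rewrite !mulr_ge0 // population_ge0.
  apply: (@le_trans _ _ (\sum_(j : J) Q * population x * (max_service N)%:R)).
    apply: ler_sum => j _; apply: ler_pM => //; first exact: queue_weight_ge0.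
    by rewrite ler_nat schedule_le_max_service.
  rewrite sumr_const -[_ *+ _]mulr_natl le_eqVlt; apply/orP; left; apply/eqP.
  rewrite /S; have -> : #|(fun=> true) : {pred J}| = #|J| by [].
  ring.
by have := population_ge0 x; rewrite /lyapunov; lra.
Qed.

(** Relative excess of the work used over the traffic intensity. *)
Definition service_vector (D : state) : {ffun K -> R^o} := [ffun k => (D k)%:R / nu k - 1].

Definition pairing (x : state) (v : {ffun K -> R^o}) : R := \sum_k (x k)%:R * v k.

Lemma pairing_service (x D : state) : pairing x (service_vector D)
  = \sum_k (x k)%:R / nu k * (D k)%:R - population x.
Proof.
rewrite /pairing /population -sumrB; apply: eq_bigr => k _.
by rewrite ffunE; ring.
Qed.

Lemma sum_assigned_work (s : schedule) (c : {ffun J -> K}) (y : K -> R) :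
  (forall j, queue_of N (c j) = j) ->
  \sum_k y k * (assigned_work N s c k)%:R = \sum_j y (c j) * (s j)%:R.
Proof.
move=> qc; rewrite (partition_big (queue_of N) xpredT) //=; apply: eq_bigr => j _.
rewrite (bigD1 (c j)) ?qc //= big1 ?addr0 => [|k /andP[/eqP <- ck]].
  by rewrite /assigned_work qc eqxx.
by rewrite /assigned_work eq_sym (negbTE ck) mulr0.
Qed.

(** The work used in one state competes in the maximum that defines [lyapunov] at any other state;
    this is how the values at two times are compared through one service vector. *)
Lemma pairing_le_lyapunov (x y : state) (s : schedule) (c : {ffun J -> K}) : s \in schedules N ->
  (forall j, queue_of N (c j) = j) ->
  pairing x (service_vector (used_work N y s c)) <= lyapunov x.
Proof.
move=> sN qc; rewrite pairing_service lerD2r; apply: le_trans (schedule_weight_le x sN).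
apply: (@le_trans _ _ (\sum_k (x k)%:R / nu k * (assigned_work N s c k)%:R)).
  by apply: ler_sum => k _; rewrite ler_wpM2l ?ratio_ge0 // ffunE ler_nat geq_minl.
rewrite (sum_assigned_work s _ qc); apply: ler_sum => j _; rewrite ler_wpM2r //.
by have := le_queue_weight x (c j); rewrite qc.
Qed.

(** Work is wasted only at a class with fewer jobs than units assigned, hence with at most
    [max_service] jobs, so the loss in the pairing does not depend on the state. *)
Definition service_gap : R := \sum_k (max_service N)%:R ^+ 2 / nu k.

Lemma service_gap_ge0 : 0 <= service_gap.
Proof. by apply: sumr_ge0 => k _; rewrite divr_ge0 ?sqr_ge0 // ltW. Qed.

Lemma lyapunov_le_pairing (x : state) (s : schedule) (c : {ffun J -> K}) :
  maxweight_schedule N nu x s -> (forall j, largest_class N nu x j (c j)) ->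
  lyapunov x <= pairing x (service_vector (used_work N x s c)) + service_gap.
Proof.
move=> ms lc; have qc j : queue_of N (c j) = j by case: (lc j).
have sN : s \in schedules N by case: ms.
rewrite pairing_service /lyapunov -(maxweight_scheduleE ms) addrAC lerD2r.
have -> : schedule_weight N nu x s = \sum_k (x k)%:R / nu k * (assigned_work N s c k)%:R.
  rewrite (sum_assigned_work s (fun k => (x k)%:R / nu k) qc); apply: eq_bigr => j _.
  congr (_ * _); apply/eqP; rewrite eq_le; apply/andP; split.
    apply: bigmax_le => [|k /eqP kj]; first exact: ratio_ge0.
    by case: (lc j) => _; apply.
  by have := le_queue_weight x (c j); rewrite qc.
rewrite /service_gap -big_split /=; apply: ler_sum => k _.
rewrite ffunE; have [ax|/ltnW xa] := leqP (assigned_work N s c k) (x k).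
  by rewrite lerDl divr_ge0 ?sqr_ge0 // ltW.
have am : (assigned_work N s c k <= max_service N)%N.
  by rewrite /assigned_work; case: ifP => // _; exact: schedule_le_max_service.
apply: (@le_trans _ _ ((max_service N)%:R ^+ 2 / nu k)); last first.
  by rewrite lerDr mulr_ge0 ?ratio_ge0.
rewrite mulrAC expr2; apply: ler_wpM2r; first by rewrite invr_ge0 ltW.
by apply: ler_pM => //; rewrite ler_nat // (leq_trans xa).
Qed.

Lemma service_vector_bound : exists2 C : R, 0 < C & forall D : state,
  (forall k, (D k <= max_service N)%N) -> norm1 (service_vector D) <= C.
Proof.
(* The last 1 makes the bound positive even without classes. *)
exists (\sum_k ((max_service N)%:R / nu k + 1) + 1) => [|D Dm].
  rewrite ltr_wpDl //; apply: sumr_ge0 => k _.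
  by rewrite addr_ge0 // divr_ge0 // ltW.
apply: (@le_trans _ _ (\sum_k ((max_service N)%:R / nu k + 1))); last by rewrite lerDl.
apply: ler_sum => k _; rewrite ffunE.
apply: (le_trans (ler_normB _ _)); rewrite normr1 lerD2r ger0_norm ?ratio_ge0 //.
by apply: ler_wpM2r; [rewrite invr_ge0 ltW|rewrite ler_nat].
Qed.

End Lyapunov.

(** * Estimates along a single path *)

Section PathEstimates.
Context {R : realType} {J K : finType}.
Variable N : network R J K.
Variable lambda : K -> R.
Hypothesis traffic : traffic_equations N lambda.
Hypothesis nu_gt0 : forall k, 0 < class_intensity N lambda k.
Local Notation nu := (class_intensity N lambda).
Local Notation state := {ffun K -> nat}.
Variable pol : state -> {ffun J -> nat} -> {ffun J -> K} -> R.
Hypothesis policy : largest_class_maxweight N nu pol.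
Variables delta Cb C1 : R.
Hypothesis delta_gt0 : 0 < delta.
Hypothesis lyapunov_delta : forall x, delta * population x <= lyapunov N lambda x.
Hypotheses (Cb_gt0 : 0 < Cb) (C1_gt0 : 0 < C1).
Hypothesis form_bound : forall u w, drift_form N lambda u w <= Cb * norm1 u * norm1 w.
Hypothesis vector_bound : forall D : state, (forall k, (D k <= max_service N)%N) ->
  norm1 (service_vector N lambda D) <= C1.
Variables (n : nat) (x : state) (p : seq (step (K := K))).
Hypotheses (size_p : size p = n) (p_ok : path_ok N pol x p).

Let st t := state_at x p t.
Definition path_work t : {ffun K -> R^o} :=
  service_vector N lambda (nth no_step p t).1.1.
Definition total_noise t : R := \sum_k `|walk (noise N k) x p t|.
Let v := path_work.
Let zeta k t := walk (noise N k) x p t.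
Let C0 := service_gap N lambda.

Let total_noise_ge0 t : 0 <= total_noise t.
Proof. exact: sumr_ge0. Qed.

Lemma path_work_step t : (t < n)%N -> exists s (c : {ffun J -> K}),
  [/\ maxweight_schedule N nu (st t) s, forall j, largest_class N nu (st t) j (c j) &
      v t = service_vector N lambda (used_work N (st t) s c)].
Proof.
rewrite -size_p => /(path_ok_nth p_ok)[[s [c [polx [oc E]]]] _].
have [_ _ /(_ _ _ _ polx)[ms lc]] := policy.
by exists s, c; split => //; rewrite /v /path_work E.
Qed.

Lemma path_work_bound t : norm1 (v t) <= C1.
Proof.
have [tn|nt] := ltnP t n.
  have [s [c [[sN _] _ ->]]] := path_work_step tn.
  by apply: vector_bound => k; exact: used_work_le.
by apply: vector_bound => k; rewrite nth_default ?size_p // ffunE.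
Qed.

Lemma path_increment t k : (t < n)%N -> (st t.+1 k)%:R - (st t k)%:R
  = mean_transfer N (fun l => nu l * v t l) k + (zeta k t.+1 - zeta k t).
Proof.
rewrite -size_p => /(path_ok_nth p_ok)[_ E].
have -> : zeta k t.+1 - zeta k t = noise N k (st t) (nth no_step p t).
  rewrite /zeta /walk big_ord_recr /= [LHS]addrC.
  exact: addKr.
rewrite /noise -E (arrival_mean_transfer traffic) // /v /path_work -/(st t.+1).
set D := (nth no_step p t).1.1.
have -> : mean_transfer N (fun l => nu l * service_vector N lambda D l) k
    = mean_transfer N (fun l => (D l)%:R) k - mean_transfer N nu k.
  have e l : nu l * service_vector N lambda D l = (D l)%:R - nu l.
    by rewrite ffunE mulrBr mulr1 mulrCA mulfV ?mulr1 // gt_eqF.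
  rewrite /mean_transfer e; under eq_bigr do rewrite e mulrBl.
  by rewrite sumrB; ring.
by ring.
Qed.

Lemma pairing_increment a r (w : {ffun K -> R^o}) : (a + r <= n)%N ->
  pairing (st (a + r)) w - pairing (st a) w
  = drift_form N lambda (window v a r) w + \sum_k (zeta k (a + r) - zeta k a) * w k.
Proof.
elim: r => [|r IH] arn.
  rewrite addn0 subrr /window big_ord0 big1 ?addr0 => [|k _]; last by rewrite subrr mul0r.
  by rewrite drift_form0l.
have -> : window v a r.+1 = window v a r + v (a + r)%N by rewrite /window big_ord_recr.
rewrite addnS drift_formDl; rewrite addnS in arn.
have -> : pairing (st (a + r).+1) w = pairing (st (a + r)) w
   + (drift_form N lambda (v (a + r)%N) w
      + \sum_k (zeta k (a + r).+1 - zeta k (a + r)) * w k).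
  rewrite /pairing /drift_form -!big_split /=; apply: eq_bigr => k _.
  by have := path_increment k arn; rewrite -!mulrDl => <-; rewrite addrC subrK.
have := IH (ltnW arn); have -> : \sum_k (zeta k (a + r).+1 - zeta k a) * w k
   = \sum_k (zeta k (a + r).+1 - zeta k (a + r)) * w k
     + \sum_k (zeta k (a + r) - zeta k a) * w k.
  by rewrite -big_split /=; apply: eq_bigr => k _; rewrite -mulrDl addrA subrK.
lra.
Qed.

Lemma noise_pairing_le a t (w : {ffun K -> R^o}) (C : R) : norm1 w <= C ->
  `|\sum_k (zeta k t - zeta k a) * w k| <= C * (total_noise a + total_noise t).
Proof.
move=> wC; apply: (le_trans (ler_norm_sum _ _ _)).
rewrite /total_noise -big_split mulr_sumr; apply: ler_sum => k _ /=.
rewrite normrM mulrC; apply: ler_pM => //; first exact: le_trans (le_norm1 w k) wC.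
by rewrite [leRHS]addrC ler_normB.
Qed.

Lemma path_increment_le a r : (a + r < n)%N ->
  lyapunov N lambda (st (a + r)) - lyapunov N lambda (st a)
  <= drift_form N lambda (window v a r) (v (a + r)%N)
     + (C0 + C1 * total_noise a) + (C0 + C1 * total_noise (a + r)).
Proof.
move=> arn; have [s [c [ms lc vE]]] := path_work_step arn.
have qc j : queue_of N (c j) = j by case: (lc j).
have sN : s \in schedules N by case: ms.
have H1 := lyapunov_le_pairing nu_gt0 ms lc.
have H2 := pairing_le_lyapunov nu_gt0 (st a) (st (a + r)) sN qc.
rewrite -vE in H1 H2.
have H3 := pairing_increment (v (a + r)%N) (ltnW arn).
have H4 := le_trans (ler_norm _)
  (noise_pairing_le a (a + r) (path_work_bound (a + r))).
have H5 : 0 <= C0 by exact: service_gap_ge0.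
rewrite -/v in H4; rewrite -/C0 in H1; lra.
Qed.

Let one : {ffun K -> R^o} := [ffun=> 1].

(** Dominates at once the coefficients of 1, of [t] and of the noise in the error of
    [pairing_initial_lower]. *)
Definition window_error_constant : R :=
  delta * (Cb * C1 * norm1 one + norm1 one) + C0 + Cb * C1 ^+ 2 + C1.

Lemma window_error_constant_ge0 : 0 <= window_error_constant.
Proof.
have := service_gap_ge0 nu_gt0; have := norm1_ge0 one => o0 g0.
have c1 := ltW C1_gt0; have cb := ltW Cb_gt0; have d0 := ltW delta_gt0.
by rewrite /window_error_constant !addr_ge0 ?mulr_ge0 ?exprn_ge0 ?addr_ge0 ?mulr_ge0.
Qed.

(* Every vector of used service pairs with a large initial state to at least
   [delta] times its population, so the sum over a window cannot be small. *)
Lemma pairing_initial_lower t : (t < n)%N ->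
  delta * population x - window_error_constant * (1 + t%:R + total_noise t)
  <= pairing x (v t).
Proof.
move=> tn; have [s [c [ms lc vE]]] := path_work_step tn.
have H1 := lyapunov_le_pairing nu_gt0 ms lc.
rewrite -vE -/C0 in H1.
have z0 k : zeta k 0 = 0 by rewrite /zeta /walk big_ord0.
have Z0 : total_noise 0 = 0.
  by rewrite /total_noise big1 // => k _; rewrite -/(zeta k 0) z0 normr0.
have s0 : st 0 = x by rewrite /st state_at0.
have N0 : norm1 (window v 0 t) <= t%:R * C1.
  apply: N_window; [exact: norm1D|exact: norm1_0|exact: path_work_bound].
have H3 := pairing_increment (a := 0) (v t) (ltnW tn).
have H4 := le_trans (ler_norm _) (noise_pairing_le 0 t (path_work_bound t)).
rewrite add0n s0 in H3; rewrite Z0 add0r in H4.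
have H5 : drift_form N lambda (window v 0 t) (v t) <= Cb * C1 ^+ 2 * t%:R.
  apply: (le_trans (form_bound _ _)).
  have -> : Cb * C1 ^+ 2 * t%:R = Cb * (t%:R * C1) * C1 by ring.
  apply: ler_pM; rewrite ?mulr_ge0 ?norm1_ge0 ?(ltW Cb_gt0) //; last exact: path_work_bound.
  by rewrite ler_pM2l.
have pone y : pairing y one = population y.
  by apply: eq_bigr => k _; rewrite ffunE mulr1.
(* Pairing with the all-ones vector bounds how far the population may have dropped by time [t]. *)
have H6 : population x <= population (st t)
    + (Cb * C1 * norm1 one * t%:R + norm1 one * total_noise t).
  have := pairing_increment (a := 0) one (ltnW tn); rewrite add0n s0 !pone.
  have := le_trans (ler_norm _) (noise_pairing_le t 0 (lexx (norm1 one))).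
  rewrite Z0 addr0.
  have -> : \sum_k (zeta k 0 - zeta k t) * one k = - \sum_k (zeta k t - zeta k 0) * one k.
    by rewrite -sumrN; apply: eq_bigr => k _; rewrite -mulNr opprB.
  have := form_bound (-1 *: window v 0 t) one; rewrite drift_formZl.
  have -> : norm1 (-1 *: window v 0 t) = norm1 (window v 0 t).
    by apply: eq_bigr => k _; rewrite ffunE /= scaleN1r normrN.
  have : Cb * norm1 (window v 0 t) * norm1 one <= Cb * (t%:R * C1) * norm1 one.
    by rewrite ler_wpM2r ?norm1_ge0 // ler_pM2l.
  lra.
have H7 := lyapunov_delta (st t).
have H8 := ler_wpM2l (ltW delta_gt0) H6.
have T0 : 0 <= t%:R :> R by [].
have Zt := total_noise_ge0 t.
have o0 := norm1_ge0 one; have g0 := service_gap_ge0 nu_gt0.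
have c1 := ltW C1_gt0; have cb := ltW Cb_gt0; have d0 := ltW delta_gt0.
rewrite -/C0 in g0.
have P1 : 0 <= delta * (Cb * C1 * norm1 one) by rewrite !mulr_ge0.
have P2 : 0 <= delta * norm1 one by rewrite !mulr_ge0.
have P3 : 0 <= Cb * C1 ^+ 2 by rewrite mulr_ge0 ?exprn_ge0.
have expand : delta * (Cb * C1 * norm1 one * t%:R + norm1 one * total_noise t)
   + C0 + Cb * C1 ^+ 2 * t%:R + C1 * total_noise t
   <= window_error_constant * (1 + t%:R + total_noise t).
  have W1 : C0 <= window_error_constant by rewrite /window_error_constant; lra.
  have W2 : delta * (Cb * C1 * norm1 one) + Cb * C1 ^+ 2 <= window_error_constant.
    by rewrite /window_error_constant; lra.
  have W3 : delta * norm1 one + C1 <= window_error_constant.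
    by rewrite /window_error_constant; lra.
  have := ler_wpM2r T0 W2; have := ler_wpM2r Zt W3; rewrite !mulrDr mulr1; lra.
rewrite mulrDr in H8; lra.
Qed.

(** Pairing with [x] is at most [population x] times [norm1]. Dividing by the population makes the
    error as small as desired for large initial states. *)
Lemma window_lower_bound a h : 0 < population x :> R -> (a + h <= n)%N ->
  delta * h%:R - \sum_(r < h)
     window_error_constant * (1 + n%:R + total_noise (a + r)) / population x
  <= norm1 (window v a h).
Proof.
move=> P0 ahn; rewrite -(ler_pM2r P0) mulrBl mulr_suml.
have pw : pairing x (window v a h) <= norm1 (window v a h) * population x.
  rewrite /pairing /population mulr_sumr; apply: ler_sum => k _.
  rewrite mulrC ler_wpM2r //; apply: le_trans (le_norm1 _ k); exact: ler_norm.
apply: le_trans pw.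
have -> : pairing x (window v a h) = \sum_(r < h) pairing x (v (a + r)%N).
  rewrite /pairing exchange_big /=; apply: eq_bigr => k _.
  by rewrite /window sum_ffunE mulr_sumr.
have -> : delta * h%:R * population x = \sum_(r < h) delta * population x.
  by rewrite sumr_const card_ord -[_ *+ _]mulr_natl; ring.
rewrite -sumrB; apply: ler_sum => r _.
have arn : (a + r < n)%N by apply: leq_trans ahn; rewrite ltn_add2l.
apply: le_trans (pairing_initial_lower arn); rewrite lerD2l lerN2.
rewrite divfK ?gt_eqF // ler_wpM2l ?window_error_constant_ge0 //.
by rewrite lerD2r lerD2l ler_nat ltnW.
Qed.

End PathEstimates.

(** * Stability *)

Lemma finite_population (R : realType) (K : finType) (r : R) :
  finite_set [set x : {ffun K -> nat} | population x <= r].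
Proof.
pose m := (Num.truncn r).+1.
pose emb (a : {ffun K -> 'I_m}) : {ffun K -> nat} := [ffun k => a k : nat].
apply: (@sub_finite_set _ _ (range emb)).
  move=> x /= xr; have xm k : (x k < m)%N.
    rewrite -(ltr_nat R); apply: le_lt_trans (truncnS_gt r); apply: le_trans xr.
    by rewrite /population (bigD1 k) //= lerDl sumr_ge0.
  by exists [ffun k => Ordinal (xm k)] => //; apply/ffunP => k; rewrite !ffunE.
by apply: finite_image; exact: finite_finset.
Qed.

Section Stability.
Context {R : realType} {J K : finType}.
Variable N : network R J K.
Variable lambda : K -> R.
Hypothesis traffic : traffic_equations N lambda.
Hypothesis nu_gt0 : forall k, 0 < class_intensity N lambda k.
Local Notation nu := (class_intensity N lambda).
Local Notation state := {ffun K -> nat}.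
Variable pol : state -> {ffun J -> nat} -> {ffun J -> K} -> R.
Hypothesis policy : largest_class_maxweight N nu pol.
Variable delta : R.
Hypothesis delta_gt0 : 0 < delta.
Hypothesis lyapunov_delta : forall x, delta * population x <= lyapunov N lambda x.

Let pol_ge0 x s c : 0 <= pol x s c. Proof. by case: policy. Qed.
Let pol_sum x : \sum_(s <- schedules N) \sum_c pol x s c = 1. Proof. by case: policy. Qed.
Let pol_schedule x s c : pol x s c != 0 -> s \in schedules N.
Proof. by move=> polx; case: policy => _ _ /(_ _ _ _ polx)[[]]. Qed.

Let V := lyapunov N lambda.
Let V_ge0 x : 0 <= V x.
Proof.
by apply: le_trans (lyapunov_delta x); rewrite mulr_ge0 ?population_ge0 // ltW.
Qed.

Definition value t (x : state) : \bar R :=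
  iter t (chain_expect N pol) (fun y => (V y)%:E) x.

Lemma value_ge0 t x : (0 <= value t x)%E.
Proof.
case: t => [|t]; first by rewrite lee_fin.
elim: t x => [|t IH] x; apply: (expect_ge0 (step_expectation pol_ge0 pol_sum x)) => w _.
  by rewrite lee_fin.
exact: IH.
Qed.

Lemma population_next : exists2 C : R, 0 <= C & forall x,
  (step_expect N pol x (fun w => (population (next w))%:E) <= (population x + C)%:E)%E.
Proof.
pose c : R := #|K|%:R * (max_service N)%:R.
pose C := \sum_(k : K) (c + arrival_mean N k).
have a0 := arrival_mean_ge0 N.
have c0 : 0 <= c by rewrite mulr_ge0.
exists C => [|x]; first by apply: sumr_ge0 => k _; rewrite addr_ge0.
have SE := step_expectation pol_ge0 pol_sum x.
have xc k : 0 <= (x k)%:R + c by rewrite addr_ge0.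
apply: (@le_trans _ _ (step_expect N pol x
  (fun w => \sum_(k : K) (((x k)%:R + c)%:E + (w.2 k)%:R%:E))))%E.
  apply: (le_expect SE) => w [s [cc [polx [oc E]]]].
  rewrite sumEFin lee_fin /population; apply: ler_sum => k _.
  rewrite ffunE natrD E /= lerD2r -lerBlDl served_state_sub.
  by apply: (le_trans (ler_norm _)); apply: net_transfer_bound; exact: pol_schedule polx.
rewrite (expect_sum SE); last by move=> k w _; rewrite adde_ge0 ?lee_fin.
rewrite /population /C -big_split /= -sumEFin; apply: lee_sum => k _.
rewrite (expectD SE) => [|w _|w _]; last 2 first.
- by rewrite lee_fin.
- by rewrite lee_fin.
rewrite (expect_cst SE) // addrA [leRHS]EFinD leeD2l //.
apply: step_expect_le => // [|s cc _]; first by rewrite lee_fin.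
rewrite (local_expect_arrival x s cc (k := k) (phi := fun n => n%:R) (r := arrival_mean N k)) //.
by rewrite -integral_nat // arrival_meanE.
Qed.

(** [V] is at most linear in the population, whose mean grows by a bounded amount per step. *)
Lemma value_fin t x : value t x \is a fin_num.
Proof.
have [CV CV0 HV] := lyapunov_upper nu_gt0.
have [C C0 HC] := population_next.
suff H y : (value t y <= (CV * (population y + t%:R * C))%:E)%E.
  by rewrite ge0_fin_numE ?value_ge0 //; apply: le_lt_trans (H x) (ltry _).
elim: t y => [|t IH] y; first by rewrite mul0r addr0 lee_fin.
have SE := step_expectation pol_ge0 pol_sum y.
have tC : 0 <= t%:R * C by rewrite mulr_ge0.
apply: (@le_trans _ _ (step_expect N pol y
   (fun w => CV%:E * ((population (next w))%:E + (t%:R * C)%:E))))%E.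
  by apply: (le_expect SE) => w _; rewrite -EFinD -EFinM; apply: IH.
rewrite (expectZ SE) // => [|w _]; last by rewrite -EFinD lee_fin addr_ge0 ?population_ge0.
rewrite [leRHS]EFinM lee_wpmul2l ?lee_fin //.
rewrite (expectD SE) => [|w _|w _]; last 2 first.
- by rewrite lee_fin population_ge0.
- by rewrite lee_fin.
rewrite (expect_cst SE) //; apply: le_trans (leeD2r _ (HC y)) _.
by rewrite -EFinD lee_fin -natr1; lra.
Qed.

Definition rvalue t x : R := fine (value t x).

Lemma rvalueE t x : (rvalue t x)%:E = value t x.
Proof. by rewrite fineK // value_fin. Qed.

Lemma rvalue_ge0 t x : 0 <= rvalue t x.
Proof. by apply: fine_ge0; exact: value_ge0. Qed.

Lemma step_expect_rvalue t x :
  (step_expect N pol x (fun w => (rvalue t (next w))%:E) = (rvalue t.+1 x)%:E)%E.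
Proof.
rewrite rvalueE; apply: (eq_expect (step_expectation pol_ge0 pol_sum x)) => w _.
by rewrite rvalueE.
Qed.

Lemma path_expect_total_noise (eta M : R) :
  (forall k n t x, (t <= n)%N ->
    (path_expect N pol n x (fun p => `|walk (noise N k) x p t|%:E) <= (eta * t%:R + M)%:E)%E) ->
  forall n t x, (t <= n)%N -> (path_expect N pol n x (fun p => (total_noise N x p t)%:E)
    <= (#|K|%:R * (eta * t%:R + M))%:E)%E.
Proof.
move=> HM n t x tn; have PE := path_expectation pol_ge0 pol_sum n x.
rewrite (eq_expect PE (g := fun p => \sum_k `|walk (noise N k) x p t|%:E)%E); last first.
  by move=> p _; rewrite sumEFin.
rewrite (expect_sum PE) => [|k p _]; last by rewrite lee_fin.
apply: (@le_trans _ _ (\sum_(k : K) (eta * t%:R + M)%:E)%E).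
  by apply: lee_sum => k _; exact: HM.
by rewrite sumEFin lee_fin sumr_const mulr_natl.
Qed.

Lemma value_drift : exists (T : nat) (w : nat -> R) (r : R),
  [/\ (0 < T)%N, forall t, 0 <= w t & forall x, r < population x ->
   \sum_(t < T) w t * rvalue (T + t) x + T%:R / 2 <= \sum_(t < T) w t * rvalue t x].
Proof.
have [Cb Cb0 form_bound] := drift_form_bound nu_gt0.
have [c c0 form_neg] := drift_form_negative traffic nu_gt0.
have [C1 C10 vector_bound] := service_vector_bound nu_gt0.
have K0 : 0 < #|K|.+1%:R :> R by [].
have [B [m [Cc [B1 Cc0 HB]]]] := multiscale_lyapunov
  (@drift_formDl R J K N lambda) (@drift_formDr R J K N lambda)
  (@drift_formZl R J K N lambda) (@drift_formZr R J K N lambda) form_bound form_neg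
  (@dotDl R K) (@dotZl R K) (@dotC R K) (@norm1_dot R K) (@dot_norm1 R K) (@dot_ge0 R K)
  (@norm1_ge0 R K) (@norm1D R K) (@norm1_0 R K) Cb0 K0 c0 C10 delta_gt0.
pose beta : R := (B ^ m)%:R.
have beta0 : 0 < beta by rewrite ltr0n expn_gt0 ltnW.
(* The accumulated noise is of order [eta * T = eta * g0 * beta] and is later divided by [g0], so
   [eta] can be fixed before [g0]. *)
pose eta := (32 * Cc * C1 * #|K|.+1%:R * beta)^-1.
have eta0 : 0 < eta by rewrite invr_gt0 !mulr_gt0.
have [M M0 HM] := noise_bound pol_ge0 pol_sum pol_schedule eta0.
pose C0 := service_gap N lambda; have C00 : 0 <= C0 by exact: service_gap_ge0.
(* Now [M] is known, and [g0] is taken large enough to absorb it together with the service gap. *)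
pose g0 := (Num.truncn (16 * Cc * (C0 + C1 * #|K|%:R * M))).+1.
have g0gt : 16 * Cc * (C0 + C1 * #|K|%:R * M) <= g0%:R by apply: ltW; exact: truncnS_gt.
have [w [w0 Hw]] := HB g0 (ltn0Sn _).
pose T := (g0 * B ^ m)%N.
have TE : T%:R = g0%:R * beta :> R by rewrite natrM.
have T0 : (0 < T)%N by rewrite muln_gt0 expn_gt0 (ltnW B1).
have TR : 0 < T%:R :> R by rewrite ltr0n.
pose W := window_error_constant N lambda delta Cb C1.
have W0 : 0 <= W by apply: window_error_constant_ge0.
pose Zb := #|K|%:R * (eta * (2 * T)%:R + M).
have Zb0 : 0 <= Zb by rewrite mulr_ge0 // addr_ge0 // mulr_ge0 // ltW.
(* The window defect is inversely proportional to the population; above [r] it costs at most [1 / 8]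
   per time step. *)
pose r := 8 * Cc * W * (1 + (2 * T)%:R + Zb).
have r0 : 0 <= r by rewrite !mulr_ge0 // ?addr_ge0 // ltW.
exists T, w, r; split => // x rx.
have P0 : 0 < population x :> R by apply: le_lt_trans rx.
have PE := path_expectation pol_ge0 pol_sum (2 * T) x.
pose d p t := W * (1 + (2 * T)%:R + total_noise N x p t) / population x.
pose e p t := C0 + C1 * total_noise N x p t.
pose c1 := Cc * W / population x + Cc / g0%:R * C1.
pose c2 := (2 * T)%:R * (Cc * W * (1 + (2 * T)%:R) / population x + Cc / g0%:R * C0).
have g0R : 0 < g0%:R :> R by rewrite ltr0n.
have c10 : 0 <= c1.
  by rewrite addr_ge0 // mulr_ge0 ?invr_ge0 // ?mulr_ge0 ?invr_ge0 // ltW.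
have c20 : 0 <= c2.
  by rewrite mulr_ge0 // addr_ge0 // !mulr_ge0 ?invr_ge0 // ?addr_ge0 // ltW.
have Z0 p t : 0 <= total_noise N x p t by apply: sumr_ge0.
have pathwise p : size p = (2 * T)%N -> path_ok N pol x p ->
  \sum_(t < T) w t * V (state_at x p (T + t)) + T%:R
  <= \sum_(t < T) w t * V (state_at x p t) + (c2 + \sum_(t < 2 * T) c1 * total_noise N x p t).
  move=> sp pp.
  have d0 t : 0 <= d p t.
    rewrite divr_ge0 ?mulr_ge0 ?population_ge0 // addr_ge0 //; exact: Z0.
  have e0 t : 0 <= e p t by rewrite addr_ge0 ?mulr_ge0 ?Z0 // ltW.
  have := Hw (path_work N lambda p) (fun t => V (state_at x p t)) (d p) (e p)
    (path_work_bound policy vector_bound sp pp) d0 e0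
    (path_increment_le traffic nu_gt0 policy vector_bound sp pp)
    (fun a h => window_lower_bound traffic nu_gt0 policy delta_gt0 lyapunov_delta Cb0 C10
       form_bound vector_bound sp pp P0).
  rewrite -/T => H; apply: (le_trans H); rewrite -addrA lerD2l.
  rewrite !mulr_sumr -big_split /=.
  have -> : c2 + \sum_(t < 2 * T) c1 * total_noise N x p t = \sum_(t < 2 * T)
    (Cc * W * (1 + (2 * T)%:R) / population x + Cc / g0%:R * C0 + c1 * total_noise N x p t).
    by rewrite big_split /= sumr_const card_ord /c2 mulr_natl.
  apply: ler_sum => t _; rewrite /d /e /c1 le_eqVlt; apply/orP; left; apply/eqP; ring.
(* The window defect and the noise each take at most [1 / 8] per time step over [2 * T] steps, which
   leaves half of the drift [T]. *)
have e1 : c2 + \sum_(t < 2 * T) c1 * Zb <= T%:R / 2.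
  rewrite sumr_const card_ord -[_ *+ _]mulr_natl /c1 /c2 -mulrDr.
  have -> : Cc * W * (1 + (2 * T)%:R) / population x + Cc / g0%:R * C0
      + (Cc * W / population x + Cc / g0%:R * C1) * Zb
    = r / 8 / population x + Cc * (C0 + C1 * Zb) / g0%:R.
    by rewrite /r; field; rewrite !gt_eqF.
  have A1 : r / 8 / population x <= 1 / 8.
    by rewrite ler_pdivrMr //; lra.
  have A2 : Cc * (C0 + C1 * Zb) / g0%:R <= 1 / 8.
    rewrite ler_pdivrMr // /Zb natrM TE.
    have E1 : Cc * C1 * #|K|%:R * (eta * (2 * (g0%:R * beta))) <= g0%:R / 16.
      apply: (@le_trans _ _ (Cc * C1 * #|K|.+1%:R * (eta * (2 * (g0%:R * beta))))).
        have [e0' b0' c0' C0'] := And4 (ltW eta0) (ltW beta0) (ltW Cc0) (ltW C10).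
        apply: ler_wpM2r; first by rewrite !mulr_ge0.
        by apply: ler_wpM2l; [rewrite mulr_ge0|rewrite ler_nat].
      rewrite le_eqVlt; apply/orP; left; apply/eqP; rewrite /eta.
      by field; rewrite !gt_eqF.
    lra.
  have T2 : 0 <= (2 * T)%:R :> R by [].
  have := ler_wpM2l T2 (lerD A1 A2); rewrite natrM; lra.
have c1Z p t : (0 <= (c1 * total_noise N x p t)%:E)%E by rewrite lee_fin mulr_ge0 ?Z0.
have wV t p : (0 <= (w t * V (state_at x p t))%:E)%E by rewrite lee_fin mulr_ge0 ?V_ge0.
have wVT t p : (0 <= (w t * V (state_at x p (T + t)))%:E)%E.
  by rewrite lee_fin mulr_ge0 ?V_ge0.
have := le_expect PE
  (f := fun p => ((\sum_(t < T) (w t * V (state_at x p (T + t)))%:E) + T%:R%:E)%E)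
  (g := fun p => ((\sum_(t < T) (w t * V (state_at x p t))%:E) +
     (c2%:E + \sum_(t < 2 * T) (c1 * total_noise N x p t)%:E))%E) _.
have wE (u : nat -> nat) : (forall t, (t < T)%N -> (u t <= 2 * T)%N) ->
    (path_expect N pol (2 * T) x (fun p => \sum_(t < T) (w t * V (state_at x p (u t)))%:E)
     = (\sum_(t < T) w t * rvalue (u t) x)%:E)%E.
  move=> uT; rewrite (expect_sum PE) => [|t p _]; last by rewrite lee_fin mulr_ge0 ?V_ge0.
  rewrite -sumEFin; apply: eq_bigr => t _.
  rewrite EFinM rvalueE /value -(path_expect_state_at pol_ge0 pol_sum x V_ge0 (uT t (ltn_ord t))).
  by rewrite -(expectZ PE) // => p _; rewrite lee_fin V_ge0.
move=> H; have {H} := H _; rewrite (expectD PE) => [|p _|p _]; last 2 first.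
- by apply: sume_ge0 => t _.
- by rewrite lee_fin.
rewrite (expect_cst PE) // (wE (fun t => T + t)%N) => [|t tT]; last first.
  by rewrite mul2n -addnn leq_add2l ltnW.
rewrite (expectD PE) => [|p _|p _]; last 2 first.
- by apply: sume_ge0 => t _.
- by rewrite adde_ge0 ?lee_fin //; apply: sume_ge0.
rewrite (wE id) => [|t tT]; last first.
  by rewrite mul2n -addnn (leq_trans (ltnW tT)) // leq_addr.
rewrite (expectD PE) => [|p _|p _]; last 2 first.
- by rewrite lee_fin.
- by apply: sume_ge0.
rewrite (expect_cst PE) // (expect_sum PE) => [|t p _ //].
have Ec1 : (\sum_(t < 2 * T) path_expect N pol (2 * T) x
    (fun p => (c1 * total_noise N x p t)%:E) <= (\sum_(t < 2 * T) c1 * Zb)%:E)%E.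
  rewrite -sumEFin; apply: lee_sum => t _.
  rewrite (eq_expect PE (g := fun p => c1%:E * (total_noise N x p t)%:E)%E) //.
  rewrite (expectZ PE) // => [|p _]; last by rewrite lee_fin.
  rewrite EFinM lee_wpmul2l ?lee_fin //.
  apply: le_trans (path_expect_total_noise HM x (ltnW (ltn_ord t))) _.
  by rewrite lee_fin ler_wpM2l // lerD2r ler_pM2l // ler_nat ltnW.
move=> H; have {H} : ((\sum_(t < T) w t * rvalue (T + t) x + T%:R)%:E <=
    (\sum_(t < T) w t * rvalue t x + (c2 + \sum_(t < 2 * T) c1 * Zb))%:E)%E.
  rewrite !EFinD; apply: le_trans (H _) _.
    move=> p [sp pp]; rewrite !sumEFin -!EFinD lee_fin; exact: pathwise.
  by rewrite leeD2l // leeD2l.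
by rewrite lee_fin; lra.
Qed.

Lemma transition_positive_recurrent : positive_recurrent (transition N pol).
Proof.
have [T [w [r [T0 w0 drift]]]] := value_drift.
pose F x s := \sum_(t < T) w t * rvalue (s + t) x.
(* Summing over [T] consecutive shifts turns the drift over [T] steps into a one-step drift: the
   mean change of [G] telescopes to [F x T - F x 0]. *)
pose G x := \sum_(s < T) F x s.
have F0 x s : 0 <= F x s by apply: sumr_ge0 => t _; rewrite mulr_ge0 ?rvalue_ge0.
have G0 x : 0 <= G x by apply: sumr_ge0.
have PF x s : (step_expect N pol x (fun y => (F (next y) s)%:E) = (F x s.+1)%:E)%E.
  have SE := step_expectation pol_ge0 pol_sum x.
  rewrite (eq_expect SE (g := fun y =>
    \sum_(t < T) (w t)%:E * (rvalue (s + t) (next y))%:E)%E); last first.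
    by move=> y _; rewrite -sumEFin.
  rewrite (expect_sum SE) => [|t y _]; last by rewrite mule_ge0 ?lee_fin ?rvalue_ge0.
  rewrite -sumEFin; apply: eq_bigr => t _.
  rewrite (expectZ SE) // => [|y _]; last by rewrite lee_fin rvalue_ge0.
  by rewrite step_expect_rvalue addSn.
have PG x : (\esum_(y in setT) (transition N pol x y * (G y)%:E)
    = (\sum_(s < T) F x s.+1)%:E)%E.
  have SE := step_expectation pol_ge0 pol_sum x.
  rewrite (transition_expect N pol_ge0 x G0).
  rewrite (eq_expect SE (g := fun y => \sum_(s < T) (F (next y) s)%:E)%E); last first.
    by move=> y _; rewrite sumEFin.
  rewrite (expect_sum SE) => [|s y _]; last by rewrite lee_fin.
  by rewrite -sumEFin; apply: eq_bigr => s _; exact: PF.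
have tr0 := transition_ge0 N pol_ge0; have tr1 := transition_sum pol_ge0 pol_sum.
apply: (positive_recurrent_of_hit tr0 tr1 (finite_population K r)).
have TR : 0 < T%:R :> R by rewrite ltr0n.
apply: (foster tr0 (g := G) (delta := T%:R / 2)) => // [|x|x /negP].
- by rewrite divr_gt0.
- by rewrite PG ltry.
rewrite -ltNge => /drift xr; rewrite PG -EFinD lee_fin.
have := sum_shift (F x) T 1; rewrite big_ord1 addn0.
under eq_bigr do rewrite addn1.
rewrite -/(G x) /F; under [X in _ = _ - X]eq_bigr do rewrite add0n.
lra.
Qed.

End Stability.

Theorem theorem5 (R : realType) (J K : finType) (N : network R J K)
    (lambda : K -> R)
    (pol : {ffun K -> nat} -> {ffun J -> nat} -> {ffun J -> K} -> R) :
  traffic_equations N lambda ->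
  (forall k, 0 < class_intensity N lambda k) ->
  largest_class_maxweight N (class_intensity N lambda) pol ->
  capacity_region N (queue_intensity N lambda) ->
  positive_recurrent (transition N pol).
Proof.
move=> traffic nu_gt0 policy /capacity_slack[delta delta_gt0 slack].
apply: (transition_positive_recurrent traffic nu_gt0 policy delta_gt0) => x.
exact: (lyapunov_lower nu_gt0 delta_gt0 slack).
Qed.
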